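(* Let $R$ be a reduced (commutative) ring that is finitely generated as an algebra over a computable field of characteristic $p>0$. Let $\overline{R}$ be the integral closure of $R$ in its total ring of fractions. Suppose $D$ is a nonzerodivisor in the conductor ideal of $R$, i.e., $D\in R$ is a nonzerodivisor with $D\overline{R}\subseteq R$. (1) Set $V_0=\frac{1}{D}R$ (an $R$-submodule of the total ring of fractions of $R$), and inductively define $$V_{e+1}=\{f\in V_e \mid f^p\in V_e\}\qquad\text{for } e\geq 0.$$ Then the modules $V_e$ are algorithmically constructible. (2) The descending chain $$V_0\supseteq V_1\supseteq V_2\supseteq V_3\supseteq\cdots$$ stabilizes. If $V_e=V_{e+1}$ for some $e\ge 0$, then $V_e=\overline{R}$.
   Context: The total ring of fractions of $R$ is the localization of $R$ at the set of all its nonzerodivisors; $\frac{1}{D}R$ denotes $\{r/D \mid r\in R\}$ inside it. The conductor ideal of $R$ is $\{r\in R \mid r\overline{R}\subseteq R\}$. A computable field is a field $K$ whose elements have finite representations for which the field operations and equality testing are carried out by algorithms. ''The modules $V_e$ are algorithmically constructible'' means: there is an algorithm which, given a finite presentation $R=K[x_1,\dots,x_n]/(f_1,\dots,f_m)$ over the computable field $K$, a polynomial representing $D$, and an integer $e\ge 0$, outputs a finite set of generators of $V_e$ as an $R$-module (equivalently, of the ideal $DV_e$ of $R$).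
   Formalization: Part (1) is proved under the added assumption that linear dependence over K^p of finite families in the computable field K is decidable (Seidenberg's condition (P)); without it (1) fails, since V_1 for D = X^p − aY^p in K[X,Y] decides whether a is a p-th power. Part (2) is unchanged. *)

(* Defs.v *)
From mathcomp Require Import all_boot all_algebra.
From mathcomp Require Export mpoly.

Set Implicit Arguments.
Unset Strict Implicit.
Unset Printing Implicit Defensive.

Import GRing.Theory.
Local Open Scope ring_scope.

(* Algorithms are programs of Jones's WHILE language, in its one-variable     *)
(* form: the store is a single finite binary tree.  The language is           *)
(* Turing-complete, and eval P is a partial function since a loop may run     *)
(* forever.                                                                   *)
Inductive data : Type := DNil | DCons of data & data.

Definition hd (d : data) : data := if d is DCons a _ then a else DNil.
Definition tl (d : data) : data := if d is DCons _ b then b else DNil.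

Inductive prog : Type :=
  | PId
  | PNil
  | PHd
  | PTl
  | PCons of prog & prog
  | PComp of prog & prog
  | PIf of prog & prog & prog
  | PWhile of prog & prog.

Inductive eval : prog -> data -> data -> Prop :=
  | EvId x : eval PId x x
  | EvNil x : eval PNil x DNil
  | EvHd x : eval PHd x (hd x)
  | EvTl x : eval PTl x (tl x)
  | EvCons P Q x y z : eval P x y -> eval Q x z ->
      eval (PCons P Q) x (DCons y z)
  | EvComp P Q x y z : eval Q x y -> eval P y z -> eval (PComp P Q) x z
  | EvIfT C P Q x a b y : eval C x (DCons a b) -> eval P x y ->
      eval (PIf C P Q) x y
  | EvIfF C P Q x y : eval C x DNil -> eval Q x y -> eval (PIf C P Q) x y
  | EvWhileF C P x : eval C x DNil -> eval (PWhile C P) x x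
  | EvWhileT C P x a b y z : eval C x (DCons a b) -> eval P x y ->
      eval (PWhile C P) y z -> eval (PWhile C P) x z.

(* The list a_1, ..., a_k is DCons a_1 (... (DCons a_k DNil)), and a natural  *)
(* number is given in unary by the length of such a list.  Decoding is total. *)
Fixpoint items (d : data) : seq data :=
  if d is DCons a b then a :: items b else [::].

Definition data_of_bool (b : bool) : data := if b then DCons DNil DNil else DNil.

Fixpoint data_of_nat (n : nat) : data :=
  if n is m.+1 then DCons DNil (data_of_nat m) else DNil.

Definition nat_of_data (d : data) : nat := size (items d).

(* rep d is the field element represented by d; an element may have several   *)
(* representations.  Totality of rep is a normalization: meaningless data may *)
(* be taken to represent 0.                                                   *)
Record computable_field (K : fieldType) (rep : data -> K) : Prop :=
  ComputableField {
    rep_surj : forall x : K, exists d, rep d = x;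
    rep_add : exists P, forall a b,
      exists2 c, eval P (DCons a b) c & rep c = rep a + rep b;
    rep_opp : exists P, forall a, exists2 c, eval P a c & rep c = - rep a;
    rep_mul : exists P, forall a b,
      exists2 c, eval P (DCons a b) c & rep c = rep a * rep b;
    rep_inv : exists P, forall a, rep a != 0 ->
      exists2 c, eval P a c & rep c = (rep a)^-1;
    rep_eq : exists P, forall a b,
      eval P (DCons a b) (data_of_bool (rep a == rep b)) }.

(* Linear dependence over the subfield of p-th powers of K. *)
Definition pth_power_dependent (K : fieldType) (p : nat) (cs : seq K) : Prop :=
  exists lam : 'I_(size cs) -> K,
    (exists i, lam i != 0) /\ \sum_i lam i ^+ p * cs`_i = 0.

(* Seidenberg's condition (P).  It holds for every computable field K with    *)
(* [K : K^p] finite, but it does not follow from computability of K, and      *)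
(* without it the modules V_e below cannot in general be computed: for        *)
(* D = X^p - a Y^p in K[X, Y], the ideal D V_1 is (D) if a is not a p-th      *)
(* power in K, and ((X - b Y)^(p - 1)) if a = b^p, so generators of D V_1     *)
(* tell whether a is a p-th power.                                            *)
Definition condition_P (K : fieldType) (rep : data -> K) (p : nat) : Prop :=
  exists P, forall d, exists2 b : bool,
    eval P d (data_of_bool b) &
    b <-> pth_power_dependent p [seq rep c | c <- items d].

(* A polynomial is represented by a list of terms DCons c m, with c a         *)
(* representation of the coefficient and m the list of exponents; missing     *)
(* exponents are 0.  Every polynomial has a representation.                   *)
Definition monom_of_data (n : nat) (d : data) : 'X_{1..n} :=
  [multinom nat_of_data (nth DNil (items d) i) | i < n].

Definition poly_of_data (K : fieldType) (rep : data -> K) (n : nat)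
    (d : data) : {mpoly K[n]} :=
  \sum_(t <- items d) rep (hd t) *: 'X_[monom_of_data n (tl t)].

Definition polys_of_data (K : fieldType) (rep : data -> K) (n : nat)
    (d : data) : seq {mpoly K[n]} :=
  [seq poly_of_data rep n t | t <- items d].

Definition in_ideal (R : comPzRingType) (gs : seq R) (r : R) : Prop :=
  exists c : 'I_(size gs) -> R, r = \sum_i c i * gs`_i.

Definition surjective (A B : Type) (f : A -> B) : Prop :=
  forall y, exists x, f x = y.

Definition presents (K : fieldType) (n : nat) (fs : seq {mpoly K[n]})
    (R : comPzRingType) (pi : {rmorphism {mpoly K[n]} -> R}) : Prop :=
  surjective pi /\ forall q, pi q = 0 <-> in_ideal fs q.

(* A ring morphism from K[x_1, ..., x_n] is the same as a K-algebra structure *)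
(* on the target together with n elements of it.                              *)
Definition finitely_generated_algebra (K : fieldType) (R : comPzRingType) :
    Prop :=
  exists n (pi : {rmorphism {mpoly K[n]} -> R}), surjective pi.

Definition reduced (R : comPzRingType) : Prop :=
  forall (x : R) k, x ^+ k = 0 -> x = 0.

Definition nonzerodivisor (R : comPzRingType) (s : R) : Prop := GRing.lreg s.

Section TotalRingOfFractions.

Variables (R Q : comPzRingType) (iota : {rmorphism R -> Q}).

(* Characterization of the localization at the nonzerodivisors, unique up to  *)
(* unique isomorphism.                                                        *)
Definition total_ring_of_fractions : Prop :=
  [/\ injective iota,
      forall s, nonzerodivisor s -> exists u, u * iota s = 1 &
      forall f, exists r s, nonzerodivisor s /\ f * iota s = iota r].

(* f = r / D; the rings may be trivial, hence have no unit ring structure, so *)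
(* this is written without division.                                          *)
Definition is_frac (D r : R) (f : Q) : Prop := f * iota D = iota r.

Definition integral (f : Q) : Prop :=
  exists n (c : 'I_n -> R), f ^+ n + \sum_(i < n) iota (c i) * f ^+ i = 0.

Definition in_conductor (D : R) : Prop :=
  forall f, integral f -> exists r, iota D * f = iota r.

Fixpoint V (p : nat) (D : R) (e : nat) (f : Q) : Prop :=
  if e is e'.+1 then V p D e' f /\ V p D e' (f ^+ p)
  else exists r, is_frac D r f.

(* The fractions g / D, for g in gs, generate the R-module W. *)
Definition generated_by_fracs (D : R) (gs : seq R) (W : Q -> Prop) : Prop :=
  forall f, W f <-> exists r, is_frac D r f /\ in_ideal gs r.

End TotalRingOfFractions.

(* Main.v *)
Require Import Defs.
From HB Require Import structures.
From mathcomp Require Import all_boot all_algebra.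
From mathcomp Require Import zify.
From Stdlib Require Import Classical IndefiniteDescription.

Set Implicit Arguments.
Unset Strict Implicit.
Unset Printing Implicit Defensive.

Import GRing.Theory.
Local Open Scope ring_scope.

(** The part about the chain rests on one observation.  If [D f^(p^i)] lies in
    [R] for all [i], then the [f^(p^i)] span a submodule of the noetherian
    module [(1/D) R], so some [f^(p^k)] is a combination of the [f^(p^i)] with
    [i < k]: this is an equation of integral dependence.  Conversely an integral
    [f] has integral powers, and the conductor puts them all in [(1/D) R].
    Hence the intersection of the [V_e] is the integral closure
    ([integral_stable]), and a step of the chain that is an equality makes every
    later step one ([V_stationary]).  That the chain does stop
    ([V_stabilizes]) is usually read off the finitely many valuations that are
    positive on [D].  Here it follows from noetherian arguments alone.  If the
    chain never reached its intersection, then some [t] would have the property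
    that the elements of [R] which carry [t V_e] into the intersection for large
    [e] form a prime [P].  The ascending chain condition gives [e] and [y]
    outside [P] such that multiplication by [y] carries [t V_e] into
    [t V_(e+1)], up to the intersection, so that [x |-> (y x)^p] preserves
    [t V_e].  The relation among the iterates of [x] is then an equation of
    integral dependence for [y^2 x], whence [y^2] is in [P], which is absurd.

    For the algorithm, write [I_e = D V_e] and lift it to an ideal of
    [A = K[x_1, ..., x_n]] containing the relations of [R].  As [D] is regular,
    [r/D] is in [V_(e+1)] if and only if [r] is in [I_e] and [r^p] is in
    [D^(p-1) I_e].  So a step of the chain amounts to computing, for ideals [G]
    and [J] of [A], generators of the ideal of all [g] in [G] with [g^p] in [J].
    This is linear algebra once a degree bound is known.  The [g] of the form
    [sum a_j G_j], with [deg a_j <= B], such that [g^p] is a combination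
    [sum h_i J_i] with [deg h_i <= B] form a vector space over [K], cut out by
    equations that are linear in the coefficients of the [h_i] and in the p-th
    powers of those of the [a_j].  A basis is found by eliminating one monomial
    at a time: with a pivot among the multiples of the [J_i] as long as there is
    one, and then by a search for linear relations over the p-th powers of [K],
    which terminates because condition (P) decides whether there is one
    ([frobenius_kernel_span]).

    The bound ([bounded_generation]) comes from Hermann's theorem
    ([kernel_degree_bound]): over [k[x_1, ..., x_n]], the kernel of a matrix
    with [t] rows and entries of degree at most [d] is generated by vectors
    whose degree is bounded by a function of [n], [t] and [d].  It is applied
    with the p-th powers of [K], which Frobenius identifies with [K], for [k].
    Over them, the field generated by the coefficients of the [J_i] has a basis
    [b] of at most [p^q] elements, [q] being the number of these coefficients.  Expanding along the products of the
    elements of [b] with the monomials of exponents below [p] turns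
    [sum a_j^p G_j^p = sum h_i J_i] into a homogeneous linear system with at
    most [p^q p^n] rows. *)

(** * Spans and ideals *)

Inductive span (A : pzRingType) (V : lmodType A) (P : V -> Prop) : V -> Prop :=
  | span0 : span P 0
  | spanD a u v : P u -> span P v -> span P (a *: u + v).

Section Span.
Variables (A : pzRingType) (V : lmodType A).
Implicit Types (P Q : V -> Prop).

Lemma span_add P u v : span P u -> span P v -> span P (u + v).
Proof. by move=> + Sv; elim=> [|a u' v' Pu _ IH]; rewrite ?add0r // -addrA; apply: spanD. Qed.

Lemma span_scale P a u : span P u -> span P (a *: u).
Proof.
elim=> [|b u' v' Pu _ IH]; first by rewrite scaler0; apply: span0.
by rewrite scalerDr scalerA; apply: spanD.
Qed.

Lemma span_mem P u : P u -> span P u.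
Proof. by move=> Pu; rewrite -[u]addr0 -{1}[u]scale1r; apply: spanD (span0 _). Qed.

Lemma span_opp P u : span P u -> span P (- u).
Proof. by rewrite -scaleN1r; apply: span_scale. Qed.

Lemma span_sum P (I : Type) (r : seq I) (C : pred I) (F : I -> V) :
  (forall i, C i -> span P (F i)) -> span P (\sum_(i <- r | C i) F i).
Proof. move=> PF; elim/big_ind: _ => //; [exact: span0 | exact: span_add]. Qed.

Lemma span_trans P Q u : (forall v, P v -> span Q v) -> span P u -> span Q u.
Proof.
move=> PQ; elim=> [|a x y /PQ Px _ Qy]; first exact: span0.
by apply: span_add => //; apply: span_scale.
Qed.

Lemma span_sub P Q u : (forall v, P v -> Q v) -> span P u -> span Q u.
Proof. by move=> PQ; apply: span_trans => v /PQ/span_mem. Qed.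

End Span.

Lemma span_map (A A' : pzRingType) (V : lmodType A) (V' : lmodType A')
    (s : A -> A') (h : V -> V') (P : V -> Prop) (Q : V' -> Prop) u :
  h 0 = 0 -> (forall a x y, h (a *: x + y) = s a *: h x + h y) ->
  (forall v, P v -> span Q (h v)) -> span P u -> span Q (h u).
Proof.
move=> h0 hD PQ; elim=> [|a x y /PQ Px _ Qy]; first by rewrite h0; apply: span0.
by rewrite hD; apply: span_add => //; apply: span_scale.
Qed.

Lemma in_idealP (R : comPzRingType) (gs : seq R) (r : R) :
  in_ideal gs r <-> span (fun u : R^o => u \in gs) r.
Proof.
split=> [[c ->]|].
  by apply: span_sum => i _; apply: (@span_scale R R^o); apply: span_mem; exact: mem_nth.
elim=> [|a u v ugs _ [c ->]]; first by exists (fun=> 0); rewrite big1 // => i _; rewrite mul0r.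
have iu : (index u gs < size gs)%N by rewrite index_mem.
exists (fun i => (if i == Ordinal iu then a else 0) + c i).
under [RHS]eq_bigr do rewrite mulrDl.
rewrite big_split /=; congr (_ + _); rewrite (bigD1 (Ordinal iu)) //= eqxx nth_index //.
by rewrite big1 ?addr0 // => i /negbTE ->; rewrite mul0r.
Qed.

(** Turns a combination into a matrix product, so that a second linear condition
    on the combination becomes a linear system for its coefficients. *)
Lemma span_colP (A : comNzRingType) s (P : 'cV[A]_s -> Prop) v :
  span P v -> exists g (G : 'M[A]_(s, g)) (c : 'cV_g),
    v = G *m c /\ forall k, P (col k G).
Proof.
elim=> [|a x y Px _ [g [G [c [-> PG]]]]].
  by exists 0, 0, 0; split=> [|[]//]; rewrite mulmx0.
exists (1 + g)%N, (row_mx x G), (col_mx a%:M c); split.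
  by rewrite mul_row_col mul_mx_scalar.
move=> k; case: (splitP k) => j jk.
  have -> : k = lshift g j by apply: val_inj.
  by rewrite colKl ord1 col_id.
have -> : k = rshift 1 j by apply: val_inj.
by rewrite colKr.
Qed.

(** * Degrees of polynomials *)

Section Degree.
Variable K : fieldType.

Definition deg_le n d (p : {mpoly K[n]}) := (msize p <= d.+1)%N.

Lemma deg_leW n d d' (p : {mpoly K[n]}) : (d <= d')%N -> deg_le d p -> deg_le d' p.
Proof. by rewrite /deg_le => ? /leq_trans; apply; rewrite ltnS. Qed.

Lemma deg_le0 n d : deg_le d (0 : {mpoly K[n]}).
Proof. by rewrite /deg_le msize0. Qed.

Lemma deg_leC n d c : deg_le d (c%:MP : {mpoly K[n]}).
Proof. by rewrite /deg_le msizeC; case: eqP. Qed.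

Lemma deg_leN n d (p : {mpoly K[n]}) : deg_le d p -> deg_le d (- p).
Proof. by rewrite /deg_le msizeN. Qed.

Lemma deg_leD n d (p q : {mpoly K[n]}) : deg_le d p -> deg_le d q -> deg_le d (p + q).
Proof.
by rewrite /deg_le => ? ?; apply: leq_trans (msizeD_le _ _) _; rewrite geq_max; apply/andP.
Qed.

Lemma deg_le_sum n d (I : Type) (r : seq I) (C : pred I) (F : I -> {mpoly K[n]}) :
  (forall i, C i -> deg_le d (F i)) -> deg_le d (\sum_(i <- r | C i) F i).
Proof. by move=> h; elim/big_ind: _ => //; [apply: deg_le0 | apply: deg_leD]. Qed.

Lemma deg_leM n a b (p q : {mpoly K[n]}) : deg_le a p -> deg_le b q -> deg_le (a + b) (p * q).
Proof.
have [-> _ _|p0] := eqVneq p 0; first by rewrite mul0r deg_le0.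
have [-> _ _|q0] := eqVneq q 0; first by rewrite mulr0 deg_le0.
rewrite /deg_le msizeM //; move: (msize p) (msize q) => x y; lia.
Qed.

Lemma deg_leX n a k (p : {mpoly K[n]}) : deg_le a p -> deg_le (a * k) (p ^+ k).
Proof.
move=> h; elim: k => [|k IH]; first by rewrite muln0 expr0 -mpolyC1 deg_leC.
by rewrite exprS mulnS deg_leM.
Qed.

Lemma deg_le_prod n (I : Type) (r : seq I) (F : I -> {mpoly K[n]}) (a : I -> nat) :
  (forall i, deg_le (a i) (F i)) -> deg_le (\sum_(i <- r) a i) (\prod_(i <- r) F i).
Proof.
move=> h; elim: r => [|i r IH]; first by rewrite !big_nil -mpolyC1 deg_leC.
by rewrite !big_cons deg_leM.
Qed.

Lemma deg_le_mnm n m d : (mdeg m <= d)%N -> deg_le d ('X_[m] : {mpoly K[n]}).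
Proof. by rewrite /deg_le msizeX. Qed.

Lemma deg_le_supp n d (p : {mpoly K[n]}) m : deg_le d p -> m \in msupp p -> (mdeg m <= d)%N.
Proof. by rewrite /deg_le -ltnS => pd /msize_mdeg_lt mp; apply: leq_trans mp pd. Qed.

Lemma deg_leZ n d c (p : {mpoly K[n]}) : deg_le d p -> deg_le d (c *: p).
Proof. by apply: leq_trans (msizeZ_le _ _). Qed.

End Degree.

(** * Kernels of matrices over polynomial rings *)

Section RowUnit.
Variables (A : comNzRingType) (s d : nat) (f : 'rV[{poly A}]_s) (j0 : 'I_s) (u : A).
Hypotheses (fd : forall j, (size (f 0 j)%R <= d.+1)%N) (fu : u * lead_coef (f 0 j0) = 1).

(** The trivial syzygies between [f_j] and the distinguished entry [f_j0]. *)
Definition koszul j : 'cV[{poly A}]_s :=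
  f 0 j0 *: delta_mx j ord0 - f 0 j *: delta_mx j0 ord0.

Lemma mul_row_delta j : f *m delta_mx j ord0 = (f 0 j)%:M.
Proof.
apply/matrixP=> a b; rewrite !ord1 !mxE (bigD1 j) //= big1 ?addr0.
  by rewrite !mxE !eqxx mulr1.
by move=> i /negbTE ij; rewrite !mxE ij mulr0.
Qed.

Lemma koszulK j : f *m koszul j = 0.
Proof.
rewrite mulmxBr -!scalemxAr !mul_row_delta.
by rewrite !scale_scalar_mx mulrC subrr.
Qed.

(** Division by a polynomial whose leading coefficient is a unit: divide by its
    monic multiple. *)
Lemma euclid_unit (p : {poly A}) :
  exists q, (size (p - q * f 0 j0)%R < size (f 0 j0)%R)%N.
Proof.
set g := f 0 j0; pose g1 := u *: g.
have u0 : u != 0.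
  by apply/eqP=> u0; move: fu; rewrite u0 mul0r => /esym/eqP; rewrite oner_eq0.
have lg1 : (u%:P * g) = g1 by rewrite mul_polyC.
have lne : lead_coef u%:P * lead_coef g != 0 by rewrite lead_coefC fu oner_neq0.
have gm : g1 \is monic.
  by apply/monicP; rewrite -lg1 lead_coef_proper_mul // lead_coefC fu.
exists (Pdiv.Ring.rdivp p g1 * u%:P).
rewrite -mulrA lg1 {1}(Pdiv.RingMonic.rdivp_eq gm p) addrAC subrr add0r.
have := Pdiv.Ring.ltn_rmodpN0 p (monic_neq0 gm).
by rewrite -lg1 size_proper_mul // size_polyC u0.
Qed.

(** Subtracting multiples of the Koszul syzygies reduces every coordinate but
    [j0] modulo [f_j0]. The equation [f r = 0] then bounds the coordinate [j0]
    too, because multiplication by [f_j0] adds degrees exactly. *)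
Lemma row_unit_reduce v : f *m v = 0 ->
  exists r, [/\ f *m r = 0, forall j, (size (r j 0)%R <= d)%N &
    span (fun w => exists j, w = koszul j) (v - r)].
Proof.
move=> fv0; pose q j := xchoose (euclid_unit (v j 0)).
have qP j : (size (v j 0 - q j * f 0 j0)%R < size (f 0 j0)%R)%N := xchooseP (euclid_unit (v j 0)).
(* The coordinate [j] of [w] is [q j * f j0] for [j] other than [j0]. *)
pose w : 'cV_s := \sum_(j | j != j0) q j *: koszul j.
have rj j : j != j0 -> (v - w) j 0 = v j 0 - q j * f 0 j0.
  move=> jj0; rewrite !mxE summxE (bigD1 j) //= big1 ?addr0 => [|i /andP[_ ij]].
    by rewrite !mxE !eqxx (negbTE jj0) /= mulr0 subr0 mulr1.
  by rewrite !mxE eqxx eq_sym (negbTE ij) (negbTE jj0) /= !mulr0 subrr mulr0.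
have fr : f *m (v - w) = 0.
  rewrite mulmxBr fv0 mulmx_sumr big1 ?subrr // => j _.
  by rewrite -scalemxAr koszulK scaler0.
exists (v - w); split=> //; last first.
  rewrite opprB addrC subrK; apply: span_sum => j _.
  by apply: span_scale; apply: span_mem; exists j.
move=> j; have [->|jj0] := eqVneq j j0; last first.
  by rewrite rj // -ltnS; apply: leq_trans (qP j) _.
set r := v - w in fr *.
have g0 : f 0 j0 != 0.
  by apply: contraTneq isT => g0; move: fu; rewrite g0 lead_coef0 mulr0 => /eqP; rewrite eq_sym oner_eq0.
have [->|rn0] := eqVneq (r j0 0) 0; first by rewrite size_poly0.
have lne : lead_coef (f 0 j0) * lead_coef (r j0 0) != 0.
  apply: contraNneq rn0 => h; rewrite -lead_coef_eq0.
  by rewrite -[lead_coef _]mul1r -fu -mulrA h mulr0.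
have : (size (f 0 j0 * r j0 0)%R <= d + (size (f 0 j0)%R).-1)%N.
  have -> : f 0 j0 * r j0 0 = - \sum_(j | j != j0) f 0 j * r j 0.
    apply/eqP; rewrite -addr_eq0; apply/eqP.
    move/matrixP/(_ 0 0): fr; rewrite [LHS]mxE [RHS]mxE (bigD1 j0) //=.
  rewrite size_polyN; apply: (leq_trans (size_sum _ _ _)).
  apply/bigmax_leqP => i ij0; apply: (leq_trans (size_polyMleq _ _)).
  rewrite rj //; move: (fd i) (qP i).
  move: (size (f 0 i)) (size (f 0 j0)) (size (v i 0 - _)%R) => x y z; lia.
rewrite size_proper_mul //; move: g0 rn0; rewrite -!size_poly_gt0.
move: (size (f 0 j0)) (size (r j0 0)) => x y; lia.
Qed.

End RowUnit.

(** A degree bound for the kernel of one row in [n] variables, chosen to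
    dominate the sum of the degree of the row and of the degree of generators of
    its kernel: then the bound for several rows is a mere iteration. For [n = k
    + 1] and rows of degree [y], the factor [c] is [N^k] with [N = y + 1], the
    weight of the change of variables [shear], and [d] bounds the degree of the
    row after it. *)
Fixpoint row_bound n y :=
  if n is k.+1 then
    let c := (y.+1 ^ k)%N in let d := (y * c)%N in
    ((iter (d + d) (row_bound k) d).+1 * (c + d + d + y + 1))%N
  else y.+1.

(** The exponent [k] counts coefficients, and [p ^ k * p ^ n] bounds the number
    of rows of the linear system to which [bounded_generation] reduces the
    problem. Its entries have degree at most [p * d + n * p]. The outermost
    operations account for the multipliers of [J], which are built from p-th
    powers and from monomials of degree at most [n * p]. *)
Definition root_bound p n d k : nat :=
  let b := iter (p ^ k * p ^ n) (row_bound n) (p * d + n * p) in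
  (p * b + n * p)%N.

Lemma row_bound_ge n y : (y <= row_bound n y)%N.
Proof.
case: n => [|n] /=; first exact: leqnSn.
by move: (iter _ _ _) => i; move: (_ ^ n)%N => c; nia.
Qed.

Lemma iter_row_bound_ge n t y : (y <= iter t (row_bound n) y)%N.
Proof. by elim: t => //= t IH; apply: leq_trans IH (row_bound_ge _ _). Qed.

Section Hermann.
Variable K : fieldType.

Definition row_bounded n := forall s d (f : 'rV[{mpoly K[n]}]_s) (v : 'cV_s),
  (forall j, deg_le d (f 0 j)) -> f *m v = 0 ->
  span (fun w => f *m w = 0 /\ forall j, deg_le (row_bound n d - d) (w j 0)) v.

Definition rows_bounded n := forall t s d (M : 'M[{mpoly K[n]}]_(t, s)) (v : 'cV_s),
  (forall i j, deg_le d (M i j)) -> M *m v = 0 ->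
  span (fun w => M *m w = 0 /\ forall j, deg_le (iter t (row_bound n) d - d) (w j 0)) v.

Lemma span_delta (A : pzRingType) s (v : 'cV[A]_s) :
  span (fun w => exists i, w = delta_mx i ord0) v.
Proof.
have -> : v = \sum_i v i 0 *: delta_mx i 0.
  apply/matrixP=> i j; rewrite !ord1 summxE (bigD1 i) //= big1 ?addr0 => [|k ki].
    by rewrite !mxE !eqxx mulr1.
  by rewrite !mxE eq_sym (negbTE ki) mulr0.
by apply: span_sum => i _; apply: span_scale; apply: span_mem; exists i.
Qed.

(** Rows are imposed one at a time: a solution of the first row is [G c] with
    small [G], and the remaining rows become a system for [c] whose entries have
    the degree of [M] plus that of [G]. *)
Lemma rows_of_row n : row_bounded n -> rows_bounded n.
Proof.
move=> R; elim=> [|t IH] s d M v Md Mv.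
  apply: span_sub (span_delta v) => w [i ->]; split=> [|j].
    by rewrite (flatmx0 M) mul0mx.
  by rewrite mxE -mpolyC_nat deg_leC.
pose M1 : 'rV_s := usubmx (M : 'M_(1 + t, s)).
pose M2 : 'M_(t, s) := dsubmx (M : 'M_(1 + t, s)).
have defM : M = col_mx M1 M2 by rewrite vsubmxK.
have M1d j : deg_le d (M1 0 j) by rewrite mxE.
have M2d i j : deg_le d (M2 i j) by rewrite mxE.
clearbody M1 M2; subst M.
move: (Mv : @mulmx _ (1 + t) s 1 (col_mx M1 M2) v = 0); rewrite mul_col_mx => /(congr1 (fun x => (usubmx x, dsubmx x))).
rewrite col_mxKu col_mxKd (linear0 usubmx) (linear0 dsubmx) => -[M1v M2v].
have [g [G [c [defv GP]]]] := span_colP (R _ _ _ _ M1d M1v).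
have M1G : M1 *m G = 0.
  apply/matrixP=> i k; have [/matrixP/(_ i 0) + _] := GP k.
  rewrite [LHS]mxE [RHS]mxE => h; rewrite [LHS]mxE [RHS]mxE -[RHS]h.
  by apply: eq_bigr => j _; rewrite mxE.
have Gd i k : deg_le (row_bound n d - d) (G i k).
  by have [_ /(_ i)] := GP k; rewrite mxE.
have M2Gd i k : deg_le (row_bound n d) ((M2 *m G) i k).
  rewrite mxE; apply: deg_le_sum => j _.
  by rewrite -(subnKC (row_bound_ge n d)); apply: deg_leM.
have : (M2 *m G) *m c = 0 by rewrite -mulmxA -defv.
move/(IH _ _ _ _ M2Gd) => Sc; rewrite defv.
apply: (@span_map _ _ _ _ id (mulmx G) _ _ _ _ _ _ Sc).
- by rewrite mulmx0.
- by move=> a x y; rewrite mulmxDr scalemxAr.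
move=> w [M2w wd]; apply: span_mem; split=> [|j].
  rewrite -[LHS]/(@mulmx _ (1 + t) s 1 (col_mx M1 M2) _) mul_col_mx.
  by rewrite [M1 *m _]mulmxA M1G mul0mx [M2 *m _]mulmxA M2w col_mx0.
rewrite mxE; apply: deg_le_sum => k _; rewrite iterSr.
apply: (deg_leW _ (deg_leM (Gd j k) (wd k))).
by move: (row_bound_ge n d) (iter_row_bound_ge n t (row_bound n d)); lia.
Qed.

Definition bideg_le n a b (p : {poly {mpoly K[n]}}) :=
  (size p <= a.+1)%N /\ forall i, deg_le b p`_i.

Lemma bideg_leW n a b a' b' (p : {poly {mpoly K[n]}}) :
  (a <= a')%N -> (b <= b')%N -> bideg_le a b p -> bideg_le a' b' p.
Proof.
move=> aa bb [pa pb]; split=> [|i]; first by apply: leq_trans pa _; rewrite ltnS.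
by apply: deg_leW (pb i).
Qed.

Lemma bideg_leD n a b (p q : {poly {mpoly K[n]}}) :
  bideg_le a b p -> bideg_le a b q -> bideg_le a b (p + q).
Proof.
move=> [pa pb] [qa qb]; split=> [|i]; last by rewrite coefD deg_leD.
by apply: leq_trans (size_polyD _ _) _; rewrite geq_max pa.
Qed.

Lemma bideg_leC n a b (p : {mpoly K[n]}) : deg_le b p -> bideg_le a b p%:P.
Proof.
move=> pb; split=> [|i]; first by rewrite size_polyC; case: eqP.
by rewrite coefC; case: eqP => // _; apply: deg_le0.
Qed.

Lemma bideg_le_sum n a b (I : Type) (r : seq I) (C : pred I)
    (F : I -> {poly {mpoly K[n]}}) :
  (forall i, C i -> bideg_le a b (F i)) -> bideg_le a b (\sum_(i <- r | C i) F i).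
Proof.
move=> h; elim/big_ind: _ => //; last exact: bideg_leD.
by rewrite -polyC0; apply: bideg_leC; apply: deg_le0.
Qed.

Lemma bideg_leM n a b c d (p q : {poly {mpoly K[n]}}) :
  bideg_le a b p -> bideg_le c d q -> bideg_le (a + c) (b + d) (p * q).
Proof.
move=> [pa pb] [qa qb]; split=> [|i]; last first.
  by rewrite coefM; apply: deg_le_sum => j _; apply: deg_leM.
by apply: leq_trans (size_polyMleq _ _) _; move: (size p) (size q) pa qa => x y; lia.
Qed.

Lemma bideg_leX n a b k (p : {poly {mpoly K[n]}}) :
  bideg_le a b p -> bideg_le (a * k) (b * k) (p ^+ k).
Proof.
move=> h; elim: k => [|k IH]; last by rewrite exprS !mulnS; apply: bideg_leM.
by rewrite !muln0 expr0 -polyC1; apply: bideg_leC; rewrite -mpolyC1 deg_leC.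
Qed.

Lemma bideg_le_Xn n k : bideg_le k 0 ('X^k : {poly {mpoly K[n]}}).
Proof.
split=> [|i]; first by rewrite size_polyXn.
by rewrite coefXn; case: eqP => _; [rewrite -mpolyC1 deg_leC | apply: deg_le0].
Qed.

(** After [row_unit_reduce] the remaining solutions have degree below [d] in the
    univariate variable. Their coefficients satisfy a linear system of [d + d]
    rows over the ring with one variable less. *)
Lemma row_poly n s d (f : 'rV[{poly {mpoly K[n]}}]_s) (v : 'cV_s) j0 u
    (b := iter (d + d) (row_bound n) d) :
  rows_bounded n -> (forall j, bideg_le d d (f 0 j)) ->
  u * lead_coef (f 0 j0) = 1 -> f *m v = 0 ->
  span (fun w => f *m w = 0 /\ forall j, bideg_le d b (w j 0)) v.
Proof.
move=> R fd fu fv.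
have db : (d <= b)%N := iter_row_bound_ge _ _ _.
have [r [fr rd kv]] := row_unit_reduce (fun j => (fd j).1) fu fv.
rewrite -(subrK r v); apply: span_add.
  apply: span_sub kv => w [j ->]; split=> [|i]; first exact: koszulK.
  rewrite !mxE -[_ && _]andbT -!/(nat_of_bool _); apply: bideg_leD.
    case: (_ && _); rewrite ?mulr1 ?mulr0; first exact: bideg_leW (fd j0).
    by rewrite -polyC0; apply: bideg_leC; apply: deg_le0.
  case: (_ && _); rewrite ?mulr1 ?mulr0 ?oppr0.
    rewrite -mulN1r -[d]add0n -[b]add0n; apply: bideg_leM (bideg_leW _ _ (fd j)) => //.
    by rewrite -polyC1 -polyCN; apply: bideg_leC; rewrite -mpolyC1 -mpolyCN deg_leC.
  by rewrite -polyC0; apply: bideg_leC; apply: deg_le0.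
(* The unknown with index [(j, l)] is the coefficient of [X^l] in the
   coordinate [j]. *)
pose I := ('I_s * 'I_d)%type; pose N := #|{: I}|.
pose F (k : 'I_N) := f 0 (enum_val k).1 * 'X^((enum_val k).2).
pose M : 'M[{mpoly K[n]}]_(d + d, N) := \matrix_(m, k) (F k)`_m.
pose X : 'M[{poly {mpoly K[n]}}]_(s, N) :=
  \matrix_(j < s, k < N) ('X^((enum_val k).2) *+ (j == (enum_val k).1)).
pose Psi (w : 'cV[{mpoly K[n]}]_N) := X *m map_mx polyC w.
have fX (w : 'cV_N) : f *m Psi w = \row_(j < 1) (\sum_k F k * (w k 0)%:P).
  apply/matrixP=> i j; rewrite !ord1 /Psi mulmxA !mxE; apply: eq_bigr => k _.
  rewrite !mxE (bigD1 (enum_val k).1) //= big1 ?addr0 => [|l /negbTE lk].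
    by rewrite mxE eqxx mulr1n.
  by rewrite mxE lk mulr0n mulr0.
have FM (w : 'cV_N) : M *m w = 0 <-> f *m Psi w = 0.
  rewrite fX; split=> [Mw|/matrixP/(_ 0 0)].
    apply/matrixP=> i j; rewrite !mxE; apply/polyP=> m; rewrite coef_sum coef0.
    have [md|md] := ltnP m (d + d).
      move/matrixP/(_ (Ordinal md) 0): Mw; rewrite !mxE => h; rewrite -[RHS]h.
      by apply: eq_bigr => k _; rewrite coefMC mxE.
    rewrite big1 // => k _; rewrite coefMC /F coefMXn.
    case: ifP => [_|km]; first by rewrite mul0r.
    rewrite nth_default ?mul0r //.
    apply: leq_trans (fd _).1 _; move: (ltn_ord (enum_val k).2) md; lia.
  rewrite !mxE => h; apply/matrixP=> m j; rewrite !ord1 !mxE.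
  rewrite -[RHS](coef0 _ m) -h coef_sum; apply: eq_bigr => k _.
  by rewrite coefMC mxE.
pose w0 : 'cV[{mpoly K[n]}]_N := \col_(k < N) (r (enum_val k).1 0)`_((enum_val k).2).
have rw : r = Psi w0.
  apply/matrixP=> j i; rewrite !ord1 !mxE.
  rewrite (reindex (fun x : I => enum_rank x)) /=; last first.
    by exists (fun k => enum_val k) => k _; [exact: enum_rankK | exact: enum_valK].
  under eq_bigr => x _ do rewrite !mxE enum_rankK.
  rewrite -(pair_bigA _ (fun (x : 'I_s) (y : 'I_d) => 'X^y *+ (j == x) * ((r x 0)`_y)%:P)) /=.
  rewrite (bigD1 j) //= [X in _ + X]big1 ?addr0 => [|l /negbTE lj].
    transitivity (\poly_(y < d) (r j 0)`_y).
      apply/polyP=> k; rewrite coef_poly; case: ltnP => // dk.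
      by rewrite nth_default // (leq_trans (rd j)).
    by rewrite poly_def; apply: eq_bigr => y _; rewrite eqxx mulr1n mulrC mul_polyC.
  by rewrite big1 // => y _; rewrite eq_sym lj mul0r.
have Md m k : deg_le d (M m k).
  by rewrite mxE /F coefMXn; case: ifP => _; [exact: deg_le0 | exact: (fd _).2].
have /R : M *m w0 = 0 by apply/FM; rewrite -rw.
move/(_ d Md) => Sw; rewrite rw.
apply: (@span_map _ _ _ _ polyC Psi _ _ _ _ _ _ Sw).
- by rewrite /Psi map_mx0 mulmx0.
- move=> a x y; rewrite /Psi map_mxD mulmxDr map_mxZ scalemxAr //.
move=> w [Mw wd]; apply: span_mem; split; first exact/FM.
move=> j; rewrite mxE; apply: bideg_le_sum => k _; rewrite !mxE.
apply: (@bideg_leW n (d + 0) (0 + b)); [by rewrite addn0 | by rewrite add0n | apply: bideg_leM].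
  case: (j == _); rewrite ?mulr1n ?mulr0n.
    by apply: bideg_leW (bideg_le_Xn _ _) => //; apply: ltnW.
  by rewrite -polyC0; apply: bideg_leC; apply: deg_le0.
apply: bideg_leC; apply: deg_leW (wd k).
by rewrite /b; lia.
Qed.

End Hermann.

(** * Nagata's change of variables and Hermann's bound *)

Section Nagata.
Variables (K : fieldType) (n N : nat).
Hypothesis N_gt0 : (0 < N)%N.

Lemma digits_inj k (a b : 'I_k -> nat) :
  (forall i, a i < N)%N -> (forall i, b i < N)%N ->
  (\sum_i a i * N ^ i = \sum_i b i * N ^ i)%N -> a =1 b.
Proof.
elim: k a b => [|k IH] a b aN bN; first by move=> _ [].
have E (x : 'I_k.+1 -> nat) : (\sum_i x i * N ^ i = (\sum_i x (lift ord0 i) * N ^ i) * N + x ord0)%N.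
  rewrite big_ord_recl muln1 addnC; congr addn.
  by rewrite big_distrl /=; apply: eq_bigr => i _; rewrite /bump /= add1n expnSr mulnA.
rewrite !E => h.
have h0 : a ord0 = b ord0.
  by have := congr1 (modn^~ N) h; rewrite !modnMDl !modn_small.
have hS : a \o lift ord0 =1 b \o lift ord0.
  apply: IH => [i|i|]; [exact: aN | exact: bN |].
  by have := congr1 (divn^~ N) h; rewrite !divnMDl // !divn_small // !addn0.
move=> i; case: (unliftP ord0 i) => [j ->|-> //]; exact: (hS j).
Qed.

(** Nagata's substitution [x_0 |-> X], [x_i |-> x_i + X^(N^i)]: every monomial
    becomes monic in [X], of degree its value in base [N], so that distinct
    monomials with exponents below [N] have images of distinct degrees. *)
Definition shear_var (i : 'I_n.+1) : {poly {mpoly K[n]}} :=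
  if unlift ord0 i is Some j then ('X_j)%:P + 'X^(N ^ i) else 'X.

Definition shear : {mpoly K[n.+1]} -> {poly {mpoly K[n]}} :=
  mmap (polyC \o @mpolyC n K) shear_var.

HB.instance Definition _ := GRing.RMorphism.on shear.

Definition unshear_coef : {mpoly K[n]} -> {mpoly K[n.+1]} :=
  mmap (@mpolyC n.+1 K) (fun j => 'X_(lift ord0 j) - 'X_ord0 ^+ (N ^ j.+1)).

HB.instance Definition _ := GRing.RMorphism.on unshear_coef.

Definition unshear : {poly {mpoly K[n]}} -> {mpoly K[n.+1]} :=
  horner_eval 'X_ord0 \o map_poly unshear_coef.

HB.instance Definition _ := GRing.RMorphism.on unshear.

Lemma unshear_var i : unshear (shear_var i) = 'X_i.
Proof.
rewrite /shear_var; case: unliftP => [j ->|->].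
  rewrite /unshear /= rmorphD /= map_polyC map_polyXn /horner_eval hornerD hornerC hornerXn.
  rewrite /= {1}/unshear_coef mmapX mmap1U /bump /= add1n; exact: subrK.
by rewrite /unshear /= map_polyX /horner_eval hornerX.
Qed.

Lemma shearE p : shear p = \sum_(m <- msupp p) (p@_m)%:MP%:P * mmap1 shear_var m.
Proof. by []. Qed.

Lemma shearK : cancel shear unshear.
Proof.
move=> p; rewrite shearE rmorph_sum [RHS]mpolyE; apply: eq_bigr => m _.
rewrite rmorphM -mul_mpolyC /mmap1 rmorph_prod mpolyXE_id; congr (_ * _).
  transitivity (unshear_coef (p@_m)%:MP).
    by rewrite -[LHS]/(unshear _) /unshear /= map_polyC /horner_eval hornerC.
  by rewrite /unshear_coef mmapC.
by apply: eq_bigr => i _; rewrite rmorphXn -[X in X ^+ _]/(unshear _) unshear_var.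
Qed.

Definition weight (m : 'X_{1..n.+1}) := (\sum_i m i * N ^ i)%N.

Lemma shear_mnm m : mmap1 shear_var m \is monic /\
  size (mmap1 shear_var m) = (weight m).+1.
Proof.
have vm i : shear_var i \is monic /\ size (shear_var i) = (N ^ i).+1.
  rewrite /shear_var; case: unliftP => [j ij|->]; last by rewrite monicX size_polyX.
  have s : (size (('X_j : {mpoly K[n]})%:P) < size ('X^(N ^ i) : {poly {mpoly K[n]}}))%N.
    rewrite size_polyXn size_polyC; case: eqP => //= _.
    by rewrite ltnS expn_gt0 N_gt0.
  split; last by rewrite addrC size_polyDl // size_polyXn.
  by apply/monicP; rewrite lead_coefDr // lead_coefXn.
have vX i k : shear_var i ^+ k \is monic /\ size (shear_var i ^+ k) = (k * N ^ i).+1.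
  have [mi si] := vm i; elim: k => [|k [mk sk]]; first by rewrite monic1 size_poly1.
  by rewrite exprS monicMl // size_monicM ?monic_neq0 // si sk addnS mulSn.
rewrite /mmap1 /weight; elim: (index_enum _) => [|i r [mr sr]].
  by rewrite !big_nil monic1 size_poly1.
have [mi si] := vX i (m i).
by rewrite !big_cons monicMl // size_monicM ?monic_neq0 // sr si addSn addnS.
Qed.

Lemma mnm_le_mdeg k (m : 'X_{1..k}) i : (m i <= mdeg m)%N.
Proof. by rewrite mdegE (bigD1 i) //= leq_addr. Qed.

(** The monomial of largest weight alone contributes to the leading coefficient. *)
Lemma lead_shear p d : p != 0 -> deg_le d p -> (d < N)%N ->
  exists2 c, c != 0 & lead_coef (shear p) = c%:MP.
Proof.
move=> p0 pd dN; pose m0 := mlead p; have m0p : m0 \in msupp p := mlead_supp p0.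
have [m mp mmax] : exists2 m, m \in msupp p & forall m', m' \in msupp p -> (weight m' <= weight m)%N.
  case: (@arg_maxnP (seq_sub (msupp p)) (SeqSub m0p) xpredT (fun x => weight (val x)) isT) => x _ h.
  by exists (val x); [exact: valP | move=> m' m'p; exact: (h (SeqSub m'p))].
have mN m' i : m' \in msupp p -> (m' i < N)%N.
  by move=> /(deg_le_supp pd) m'd; apply: leq_ltn_trans (mnm_le_mdeg _ _) _; apply: leq_ltn_trans m'd dN.
have wlt m' : m' \in msupp p -> m' != m -> (weight m' < weight m)%N.
  move=> m'p m'm; rewrite ltn_neqAle mmax // andbT; apply: contra m'm => /eqP e.
  by apply/eqP/mnmP=> i; apply: (digits_inj _ _ e) => j; apply: mN.
exists p@_m; first by rewrite mcoeff_eq0 negbK.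
rewrite shearE (bigD1_seq m mp (msupp_uniq p)) /=.
have c0 : (p@_m)%:MP_[n] != 0 by rewrite mpolyC_eq0 mcoeff_eq0 negbK.
have [mm sm] := shear_mnm m.
have ne : lead_coef (p@_m)%:MP_[n]%:P * lead_coef (mmap1 shear_var m) != 0.
  by rewrite (monicP mm) mulr1 lead_coefC.
rewrite lead_coefDl; first by rewrite lead_coef_proper_mul // (monicP mm) lead_coefC mulr1.
rewrite size_proper_mul // sm size_polyC c0 /= ltnS.
apply: (leq_trans (size_sum _ _ _)); apply/bigmax_leqP_seq => m' m'p m'm.
apply: leq_trans (size_polyMleq _ _) _; rewrite (shear_mnm m').2 addnS /=.
apply: leq_trans (leq_add (size_polyC_leq1 _) (leqnn _)) _.
by rewrite add1n wlt.
Qed.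

Lemma bideg_le_prod (I : Type) (r : seq I) (F : I -> {poly {mpoly K[n]}}) (a b : I -> nat) :
  (forall i, bideg_le (a i) (b i) (F i)) ->
  bideg_le (\sum_(i <- r) a i) (\sum_(i <- r) b i) (\prod_(i <- r) F i).
Proof.
move=> h; elim: r => [|i r IH]; last by rewrite !big_cons; apply: bideg_leM.
by rewrite !big_nil -polyC1; apply: bideg_leC; rewrite -mpolyC1 deg_leC.
Qed.

Lemma bideg_le_shear p d : deg_le d p -> bideg_le (d * N ^ n) d (shear p).
Proof.
have lei (i : 'I_n.+1) : (N ^ i <= N ^ n)%N by rewrite leq_pexp2l // -ltnS ltn_ord.
have vd i : bideg_le (N ^ n) 1 (shear_var i).
  rewrite /shear_var; case: unliftP => [j _|_]; last first.
    by have := bideg_le_Xn K n 1; rewrite expr1; apply: bideg_leW; rewrite // expn_gt0 N_gt0.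
  apply: bideg_leD; first by apply: bideg_leC; rewrite /deg_le msizeX mdeg1.
  by apply: bideg_leW (bideg_le_Xn _ _ _).
move=> pd; rewrite shearE big_seq; apply: bideg_le_sum => m /(deg_le_supp pd) md.
rewrite -[(d * _)%N]add0n -[d in bideg_le _ d]add0n; apply: bideg_leM.
  by apply: bideg_leC; apply: deg_leC.
have := @bideg_le_prod _ (index_enum 'I_n.+1) _ _ _ (fun i => bideg_leX (m i) (vd i)).
apply: bideg_leW; rewrite -big_distrr /= -mdegE.
  by rewrite mulnC leq_mul2r md orbT.
by rewrite mul1n.
Qed.

Lemma deg_le_unshear p a b : bideg_le a b p -> deg_le (b * N ^ n + a) (unshear p).
Proof.
move=> [pa pb]; rewrite /unshear /= /horner_eval.
rewrite (horner_coef_wide _ (leq_trans (size_poly _ _) pa)).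
apply: deg_le_sum => i _; rewrite coef_map; apply: deg_leM.
  rewrite /= /unshear_coef /mmap big_seq; apply: deg_le_sum => m /(deg_le_supp (pb i)) mb.
  rewrite -[(b * _)%N]add0n; apply: deg_leM; first exact: deg_leC.
  have vd (j : 'I_n) : deg_le (N ^ n) ('X_(lift ord0 j) - 'X_ord0 ^+ (N ^ j.+1) : {mpoly K[n.+1]}).
    apply: deg_leD; first by apply: deg_le_mnm; rewrite mdeg1 expn_gt0 N_gt0.
    apply: deg_leN; rewrite mpolyXn; apply: deg_le_mnm.
    by rewrite mdegMn mdeg1 mul1n leq_pexp2l.
  apply: deg_leW (deg_le_prod _ (fun j => deg_leX (m j) (vd j))).
  by rewrite -big_distrr /= -mdegE mulnC leq_mul2r mb orbT.
apply: (@deg_leW _ _ (1 * i)); first by rewrite mul1n -ltnS ltn_ord.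
by apply: deg_leX; apply: deg_le_mnm; rewrite mdeg1.
Qed.

End Nagata.

Section Hermann.
Variable K : fieldType.

(** If the row is nonzero, the substitution of [shear] gives one of its entries
    a unit as leading coefficient; solutions are carried back by [unshear]. *)
Lemma row_boundedS n : @rows_bounded K n -> @row_bounded K n.+1.
Proof.
move=> R s d f v fd fv.
have [f0|] := altP (f =P 0).
  apply: span_sub (span_delta v) => w [i ->]; split=> [|j]; first by rewrite f0 mul0mx.
  by rewrite mxE -mpolyC_nat deg_leC.
case/matrix0Pn => i0 [j0]; rewrite ord1 => fj0.
(* All exponents are at most [d], hence are digits in base [N]. *)
pose N := d.+1; pose c := (N ^ n)%N; pose d' := (d * c)%N.
have N0 : (0 < N)%N by [].
have c_gt0 : (0 < c)%N by rewrite expn_gt0.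
have [e e0 lf] := @lead_shear K n N N0 _ d fj0 (fd j0) (leqnn _).
have Sf j : bideg_le d' d' (map_mx (shear N) f 0 j).
  by rewrite mxE; apply: bideg_leW (bideg_le_shear N0 (fd j)) => //; rewrite leq_pmulr.
have Sv : map_mx (@shear K n N) f *m map_mx (shear N) v = 0 by rewrite -map_mxM fv map_mx0.
have ue : (e^-1)%:MP * lead_coef (map_mx (shear N) f 0 j0) = 1.
  by rewrite mxE lf -mpolyCM mulVf.
have shK k l (w : 'M_(k, l)) : w = map_mx (@unshear K n N) (map_mx (shear N) w).
  by apply/matrixP=> i j; rewrite !mxE shearK.
rewrite (shK _ _ v).
apply: (@span_map _ _ _ _ (unshear N) (map_mx (unshear N)) _ _ _ _ _ _ (row_poly R Sf ue Sv)).
- exact: map_mx0.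
- by move=> a x y; rewrite map_mxD map_mxZ.
move=> w [fw wd]; apply: span_mem; split.
  by rewrite (shK _ _ f) -map_mxM fw map_mx0.
move=> j; rewrite mxE; apply: deg_leW (deg_le_unshear N0 (wd j)).
rewrite /= -/N -/c -/d'; move: (iter _ _ _) => b; nia.
Qed.

(** Hermann's theorem, with a bound that does not depend on the number of
    columns. *)
Theorem kernel_degree_bound n : @rows_bounded K n.
Proof.
elim: n => [|n IH]; apply: rows_of_row; last exact: row_boundedS.
move=> s d f v _ fv; apply: span_mem; split=> // j.
by rewrite (nvar0_mpolyC (v j 0)) deg_leC.
Qed.

End Hermann.

(** * Frobenius and bases over a subfield *)

Section Frobenius.
Variables (R : comPzRingType) (p : nat).
Hypotheses (p_pr : prime p) (p0 : p%:R = 0 :> R).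

(** Stated for rings in which 1 may be 0, since the quotients and localizations
    to which it is applied may be trivial. *)
Lemma exprD_char (x y : R) : (x + y) ^+ p = x ^+ p + y ^+ p.
Proof.
rewrite exprDn; have p_gt0 := prime_gt0 p_pr.
rewrite -(prednK p_gt0) big_ord_recr big_ord_recl /= (prednK p_gt0).
rewrite subn0 bin0 subnn binn expr0 !mulr1n mul1r big1 ?addr0 ?mulr1 // => i _.
have : (p %| 'C(p, bump 0 i))%N.
  by apply: prime_dvd_bin; rewrite // /bump /= add1n; move: (ltn_ord i); lia.
by case/dvdnP=> k ->; rewrite -mulr_natr natrM p0 !mulr0.
Qed.

Lemma expr0_char : 0 ^+ p = 0 :> R.
Proof. by rewrite expr0n; case: p p_pr. Qed.

Lemma expr_sum_char (I : Type) (r : seq I) (C : pred I) (F : I -> R) :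
  (\sum_(i <- r | C i) F i) ^+ p = \sum_(i <- r | C i) F i ^+ p.
Proof. exact: (big_morph (fun x => x ^+ p) exprD_char expr0_char). Qed.

Lemma exprN_char (x : R) : (- x) ^+ p = - x ^+ p.
Proof. by apply/eqP; rewrite -addr_eq0 -exprD_char addNr expr0_char. Qed.

End Frobenius.

Section Subfield.
Variables (K : fieldType) (S : K -> Prop).

Definition subfield_pred := [/\ S 1, forall x y, S x -> S y -> S (x - y),
  forall x y, S x -> S y -> S (x * y) & forall x, S x -> S x^-1].

Hypothesis SF : subfield_pred.
Lemma sf1 : S 1. Proof. by case: SF. Qed.
Lemma sfB x y : S x -> S y -> S (x - y). Proof. by case: SF => _ h _ _; apply: h. Qed.
Lemma sfM x y : S x -> S y -> S (x * y). Proof. by case: SF => _ _ h _; apply: h. Qed.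
Lemma sfV x : S x -> S x^-1. Proof. by case: SF => _ _ _; apply. Qed.
Lemma sf0 : S 0. Proof. by rewrite -(subrr 1); apply: sfB sf1 sf1. Qed.
Lemma sfN x : S x -> S (- x). Proof. by rewrite -sub0r; apply: sfB sf0. Qed.
Lemma sfD x y : S x -> S y -> S (x + y).
Proof. by move=> Sx Sy; rewrite -[y]opprK; apply: sfB Sx (sfN Sy). Qed.

(** Being a linear combination of [b] with coefficients in [S], in the
    triangular form adapted to the incremental choice of a basis in
    [indep_extend]. *)
Fixpoint coords (b : seq K) (c : K) : Prop :=
  if b is x :: b' then exists2 a, S a & coords b' (c - a * x) else c = 0.

Fixpoint indep (b : seq K) : Prop :=
  if b is x :: b' then ~ coords b' x /\ indep b' else True.

Lemma coordsP b c : coords b c <->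
  exists2 l : nat -> K, forall i, S (l i) & c = \sum_(i < size b) l i * b`_i.
Proof.
elim: b c => [|x b IH] c /=.
  by split=> [->|[l _ ->]]; [exists (fun=> 0) => [i|]; [exact: sf0|]|]; rewrite big_ord0.
split=> [[a Sa /IH[l Sl cE]]|[l Sl ->]].
  exists (fun i => if i is j.+1 then l j else a) => [[|i] //|].
  by rewrite big_ord_recl /= -cE addrC subrK.
exists (l 0%N) => //; apply/IH; exists (l \o succn) => [i|]; first exact: Sl.
by rewrite big_ord_recl /= addrAC subrr add0r.
Qed.

Lemma indepP b (l : nat -> K) : indep b -> (forall i, S (l i)) ->
  \sum_(i < size b) l i * b`_i = 0 -> forall i, (i < size b)%N -> l i = 0.
Proof.
elim: b l => // x b IH l /= [nx ib] Sl; rewrite big_ord_recl /=.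
have [l0|l0] := eqVneq (l 0%N) 0.
  rewrite l0 mul0r add0r => h [|i] // ib'; apply: (IH (l \o succn)) => // j; exact: Sl.
move=> /eqP; rewrite addr_eq0 => /eqP h; case: nx; apply/coordsP.
exists (fun i => - (l 0%N)^-1 * l i.+1) => [i|].
  by apply: sfM (Sl _); apply/sfN/sfV.
rewrite -[LHS]mul1r -(mulVf l0) -mulrA h mulrN -mulNr mulr_sumr.
by apply: eq_bigr => i _; rewrite mulrA.
Qed.

Lemma coords_sub x b c : coords b c -> coords (x :: b) c.
Proof. by exists 0; [exact: sf0 | rewrite mul0r subr0]. Qed.

Lemma coords_head x b : coords (x :: b) x.
Proof.
exists 1; first exact: sf1.
by rewrite mul1r subrr; apply/coordsP; exists (fun=> 0) => [i|]; [exact: sf0 | rewrite big1 // => i _; rewrite mul0r].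
Qed.

(** Exchange: scan [l] and keep an element when it is not a combination of those
    kept so far. *)
Lemma indep_extend (l b0 : seq K) : indep b0 ->
  exists b1, [/\ indep (b1 ++ b0), (size b1 <= size l)%N,
    {subset b1 <= l} & forall x, x \in l -> coords (b1 ++ b0) x].
Proof.
move=> ib0; elim: l => [|x l [b1 [ib sb subb cb]]]; first by exists [::].
have [cx|ncx] := classic (coords (b1 ++ b0) x).
  exists b1; split=> // [|y /subb yl|y]; [exact: leqW | by rewrite inE yl orbT |].
  by rewrite inE => /predU1P[->|/cb].
exists (x :: b1); split=> //= [y|y].
  by rewrite !inE => /predU1P[->|/subb ->]; rewrite ?eqxx ?orbT.
by rewrite inE => /predU1P[->|/cb cy]; [exact: coords_head | exact: coords_sub].
Qed.

Lemma coords0 b : coords b 0.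
Proof. by apply/coordsP; exists (fun=> 0) => [i|]; [exact: sf0 | rewrite big1 // => i _; rewrite mul0r]. Qed.

Lemma coordsD b c1 c2 : coords b c1 -> coords b c2 -> coords b (c1 + c2).
Proof.
move=> /coordsP[l1 S1 ->] /coordsP[l2 S2 ->]; apply/coordsP.
exists (fun i => l1 i + l2 i) => [i|]; first exact: sfD.
by rewrite -big_split; apply: eq_bigr => i _; rewrite mulrDl.
Qed.

Lemma coordsZ b a c : S a -> coords b c -> coords b (a * c).
Proof.
move=> Sa /coordsP[l1 S1 ->]; apply/coordsP.
exists (fun i => a * l1 i) => [i|]; first exact: sfM.
by rewrite mulr_sumr; apply: eq_bigr => i _; rewrite mulrA.
Qed.

Lemma coords_mem b x : x \in b -> coords b x.
Proof.
elim: b => // y b IH; rewrite inE => /predU1P[->|/IH]; [exact: coords_head | exact: coords_sub].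
Qed.

Lemma coords_trans b b' c : (forall x, x \in b -> coords b' x) -> coords b c -> coords b' c.
Proof.
move=> bb' /coordsP[l Sl ->]; elim/big_ind: _ => [|x y|i _]; [exact: coords0 | exact: coordsD |].
by apply: coordsZ => //; apply: bb'; exact: mem_nth.
Qed.

Lemma mpoly_coords n b (f : {mpoly K[n]}) : (forall m, coords b f@_m) ->
  exists F : nat -> {mpoly K[n]}, [/\ forall i m, S (F i)@_m,
    forall i, {subset msupp (F i) <= msupp f} &
    f = \sum_(i < size b) b`_i *: F i].
Proof.
move=> fb; have /functional_choice[l lP] : forall m, exists l : nat -> K,
    (forall i, S (l i)) /\ f@_m = \sum_(i < size b) l i * b`_i.
  by move=> m; have /coordsP[l Sl fl] := fb m; exists l.
exists (fun i => \sum_(m <- msupp f) l m i *: 'X_[m]); split=> [i m|i m|].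
  rewrite raddf_sum /=; elim/big_ind: _ => [|x y|m' _]; [exact: sf0 | exact: sfD |].
  rewrite mcoeffZ mcoeffX; case: eqP => _; rewrite ?mulr1 ?mulr0; [exact: (lP _).1 | exact: sf0].
  apply: contraLR => mf; rewrite -mcoeff_eq0 raddf_sum /= big_seq big1 // => m' m'f.
  by rewrite mcoeffZ mcoeffX; case: eqP m'f => [->|_ _]; rewrite ?(negbTE mf) ?mulr0.
rewrite {1}[f]mpolyE; under [RHS]eq_bigr do rewrite scaler_sumr.
rewrite exchange_big /=; apply: eq_bigr => m _.
by rewrite (lP m).2 scaler_suml; apply: eq_bigr => i _; rewrite scalerA mulrC.
Qed.

End Subfield.

(** * Below, rows and columns are indexed by pairs and by sums of types. *)

(** Below, rows and columns are indexed by pairs and by sums of types. *)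
Lemma kernel_degree_bound_fin (K : fieldType) n d (R C : finType) (M : R -> C -> {mpoly K[n]})
    (v : C -> {mpoly K[n]}) :
  (forall r c, deg_le d (M r c)) -> (forall r, \sum_c M r c * v c = 0) ->
  exists g (G : 'I_g -> C -> {mpoly K[n]}) (u : 'I_g -> {mpoly K[n]}),
  [/\ forall k c, deg_le (iter #|R| (row_bound n) d - d) (G k c),
      forall k r, \sum_c M r c * G k c = 0 & forall c, v c = \sum_k u k * G k c].
Proof.
move=> Md Mv; pose Mx := \matrix_(r < #|R|, c < #|C|) M (enum_val r) (enum_val c).
pose vx : 'cV[{mpoly K[n]}]_#|C| := \col_(c < #|C|) v (enum_val c).
have sumC (F : C -> {mpoly K[n]}) : \sum_c F c = \sum_(c < #|C|) F (enum_val c).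
  rewrite (reindex (fun c : 'I_#|C| => enum_val c)) //=.
  by exists enum_rank => c _; [exact: enum_valK | exact: enum_rankK].
have Mxv : Mx *m vx = 0.
  apply/matrixP=> r i; rewrite !mxE -[RHS](Mv (enum_val r)) sumC.
  by apply: eq_bigr => c _; rewrite !mxE.
have Mxd r c : deg_le d (Mx r c) by rewrite mxE.
have [g [G [u [vE GP]]]] := span_colP (kernel_degree_bound Mxd Mxv).
exists g, (fun k c => G (enum_rank c) k), (fun k => u k 0); split=> [k c|k r|c].
- by have [_ /(_ (enum_rank c))] := GP k; rewrite mxE.
- have [/matrixP/(_ (enum_rank r) 0) + _] := GP k; rewrite !mxE => h.
  rewrite -[RHS]h sumC; apply: eq_bigr => c _.
  by rewrite !mxE !enum_rankK enum_valK.
have /matrixP/(_ (enum_rank c) 0) := vE; rewrite !mxE enum_rankK => ->.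
by apply: eq_bigr => k _; rewrite mulrC.
Qed.

Section PLinear.
Variables (K : fieldType) (p : nat).
Hypothesis (char_p : p \in [pchar K]).
Let p_pr : prime p := pcharf_prime char_p.
Let p_gt0 : (0 < p)%N := prime_gt0 p_pr.

Lemma mpoly_char n : p%:R = 0 :> {mpoly K[n]}.
Proof. by rewrite -mpolyC_nat (pcharf0 char_p) mpolyC0. Qed.

Definition pth_power (x : K) := exists y, x = y ^+ p.

Lemma pth_power_subfield : subfield_pred pth_power.
Proof.
split=> [|x y [a ->] [b ->]|x y [a ->] [b ->]|x [a ->]].
- by exists 1; rewrite expr1n.
- exists (a - b); rewrite (exprD_char p_pr) ?(pcharf0 char_p) //.
  by rewrite (exprN_char p_pr) // (pcharf0 char_p).
- by exists (a * b); rewrite exprMn.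
by exists a^-1; rewrite exprVn.
Qed.

Section Monomials.
Variable n : nat.
Implicit Types (m : 'X_{1..n}) (a : {mpoly K[n]}) (s : {ffun 'I_n -> 'I_p}).

Definition low m : {ffun 'I_n -> 'I_p} := [ffun i => Ordinal (ltn_pmod (m i) p_gt0)].
Definition high m : 'X_{1..n} := [multinom (m i %/ p)%N | i < n].
Definition mlow s : 'X_{1..n} := [multinom (s i : nat) | i < n].

(** The exponents of a monomial are divided by [p]: up to the remainder, a
    monomial is a p-th power. *)
Lemma high_low m : m = (high m *+ p + mlow (low m))%MM.
Proof. by apply/mnmP=> i; rewrite mnmDE mulmnE !mnmE ffunE /= {1}(divn_eq (m i) p). Qed.

Lemma high_low_eq m m' s s' :
  ((m *+ p + mlow s)%MM == (m' *+ p + mlow s')%MM) = (m == m') && (s == s').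
Proof.
apply/eqP/andP=> [/mnmP h|[/eqP-> /eqP->]] //.
have E i : (m i * p + s i = m' i * p + s' i)%N.
  by have := h i; rewrite !mnmDE !mulmnE !mnmE.
split; apply/eqP; [apply/mnmP=> i | apply/ffunP=> i; apply: val_inj => /=].
  by have := congr1 (divn^~ p) (E i); rewrite !divnMDl // !divn_small // !addn0.
by have := congr1 (modn^~ p) (E i); rewrite !modnMDl !modn_small.
Qed.

Lemma high_deg m : (mdeg (high m) <= mdeg m)%N.
Proof. by rewrite !mdegE; apply: leq_sum => i _; rewrite mnmE leq_div. Qed.

Lemma mpoly_expp a : a ^+ p = \sum_(m <- msupp a) a@_m ^+ p *: 'X_[m *+ p].
Proof.
rewrite {1}[a]mpolyE (expr_sum_char p_pr (mpoly_char n)); apply: eq_bigr => m _.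
by rewrite exprZn mpolyXn.
Qed.

Lemma coeff_expp a m s s' :
  (a ^+ p * 'X_[mlow s])@_(m *+ p + mlow s') = (a@_m ^+ p) *+ (s == s').
Proof.
rewrite mpoly_expp mulr_suml raddf_sum /=.
under eq_bigr => m' _ do rewrite -scalerAl -mpolyXD mcoeffZ mcoeffX high_low_eq.
have [ss|ss] := eqVneq s s'; last first.
  by rewrite big1 // => m' _; rewrite andbF mulr0.
under eq_bigr => m' _ do rewrite andbT.
have [mp|mp] := boolP (m \in msupp a).
  rewrite (bigD1_seq m mp (msupp_uniq a)) /= eqxx mulr1 big1 ?addr0 // => m' /negbTE->.
  by rewrite mulr0.
rewrite (memN_msupp_eq0 mp) expr0n eqn0Ngt p_gt0 /=.
rewrite big_seq big1 // => m' m'p; case: eqP m'p mp => [-> ->|_ _ _] //.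
by rewrite mulr0.
Qed.

Variables (b : seq K).
Hypothesis b_indep : indep pth_power b.
Let rowT := ('I_(size b) * {ffun 'I_n -> 'I_p})%type.
(** When [b] is a basis of a field over the p-th powers of [K], these
    polynomials are a basis of the polynomials over this field, seen as a module
    over the ring of p-th powers of polynomials. *)
Definition pbasis (r : rowT) : {mpoly K[n]} := b`_(r.1) *: 'X_[mlow r.2].

(** Different residues of exponents modulo [p] do not interact, and for a given
    one the coefficients are combinations of [b] over the p-th powers. *)
Lemma pbasis_indep (a : rowT -> {mpoly K[n]}) :
  \sum_r a r ^+ p * pbasis r = 0 -> forall r, a r = 0.
Proof.
move=> h [i s]; apply/mpolyP=> m; rewrite mcoeff0.
pose l (j : nat) := if insub j is Some j' then (a (j', s))@_m ^+ p else 0.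
have l0 : l i = 0.
  apply: (indepP pth_power_subfield b_indep _ _ (ltn_ord i)) => [j|].
    by rewrite /l; case: insub => [j'|]; [exists (a (j', s))@_m | exact: (sf0 pth_power_subfield)].
  rewrite -[RHS](mcoeff0 _ (m *+ p + mlow s)%MM) -h raddf_sum /=.
  transitivity (\sum_i' \sum_s' (a (i', s') ^+ p * pbasis (i', s'))@_(m *+ p + mlow s)); last first.
    by rewrite pair_bigA /=; apply: eq_bigr => -[].
  apply: eq_bigr => j _; rewrite (bigD1 s) //= [X in _ + X]big1 ?addr0 => [|s' s's].
    by rewrite /pbasis -scalerAr mcoeffZ coeff_expp eqxx mulr1n mulrC /l valK.
  by rewrite /pbasis -scalerAr mcoeffZ coeff_expp (negbTE s's) mulr0n mulr0.
by move/eqP: l0; rewrite /l valK expf_eq0 => /andP[_ /eqP].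
Qed.

Lemma pbasis_span d (f : {mpoly K[n]}) : (forall m, coords pth_power b f@_m) -> deg_le d f ->
  exists2 a : rowT -> {mpoly K[n]}, forall r, deg_le d (a r) & f = \sum_r a r ^+ p * pbasis r.
Proof.
move=> fb fd; have [F [Fp Fs fE]] := mpoly_coords pth_power_subfield fb.
have /functional_choice[mu muP] : forall im : nat * 'X_{1..n}, exists y, (F im.1)@_im.2 = y ^+ p.
  by move=> im; exact: Fp.
pose a (r : rowT) := \sum_(m <- msupp (F r.1) | low m == r.2) mu (val r.1, m) *: 'X_[high m].
have expand i : F i = \sum_s (\sum_(m <- msupp (F i) | low m == s) mu (i, m) *: 'X_[high m]) ^+ p * 'X_[mlow s].
  rewrite {1}[F i]mpolyE (partition_big low predT) //=; apply: eq_bigr => s _.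
  rewrite (expr_sum_char p_pr (mpoly_char n)) mulr_suml; apply: eq_bigr => m /eqP <-.
  by rewrite exprZn mpolyXn -scalerAl -mpolyXD -high_low (muP (i, m)).
exists a => [r|].
  rewrite /a big_seq_cond; apply: deg_le_sum => m /andP[mF _]; apply: deg_leZ.
  by apply: deg_le_mnm; apply: leq_trans (high_deg m) _; apply: deg_le_supp fd (Fs _ _ mF).
transitivity (\sum_i \sum_s a (i, s) ^+ p * pbasis (i, s)); last first.
  by rewrite pair_bigA /=; apply: eq_bigr => -[].
rewrite fE.
apply: eq_bigr => i _; rewrite {1}expand scaler_sumr; apply: eq_bigr => s _.
by rewrite /pbasis -scalerAr.
Qed.

(** An equation [sum_c v_c^p Phi_c = 0] is linear in [v] once the [Phi_c] are
    expanded along [pbasis]: comparing coordinates and taking p-th roots gives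
    one linear equation over the polynomial ring for each element of [pbasis]. *)
Lemma p_kernel d (C : finType) (Phi v : C -> {mpoly K[n]}) :
  (forall c m, coords pth_power b (Phi c)@_m) -> (forall c, deg_le d (Phi c)) ->
  \sum_c v c ^+ p * Phi c = 0 ->
  exists g (G : 'I_g -> C -> {mpoly K[n]}) (u : 'I_g -> {mpoly K[n]}),
  [/\ forall k c, deg_le (iter (size b * p ^ n) (row_bound n) d - d) (G k c),
      forall k, \sum_c G k c ^+ p * Phi c = 0 & forall c, v c = \sum_k u k * G k c].
Proof.
move=> Phib Phid.
have /functional_choice[M MP] : forall c, exists a : rowT -> {mpoly K[n]},
    (forall r, deg_le d (a r)) /\ Phi c = \sum_r a r ^+ p * pbasis r.
  by move=> c; have [a ad aE] := pbasis_span (Phib c) (Phid c); exists a.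
have sumE w : \sum_c w c ^+ p * Phi c = \sum_r (\sum_c M c r * w c) ^+ p * pbasis r.
  under eq_bigr => c _ do rewrite (MP c).2 mulr_sumr.
  rewrite exchange_big /=; apply: eq_bigr => r _.
  rewrite (expr_sum_char p_pr (mpoly_char n)) mulr_suml; apply: eq_bigr => c _.
  by rewrite mulrA exprMn [_ ^+ p * _ ^+ p]mulrC.
rewrite sumE => /pbasis_indep Mv.
have [g [G [u [Gd MG vE]]]] := kernel_degree_bound_fin (fun r c => (MP c).1 r) Mv.
exists g, G, u; split=> // [k c|k].
  by move: (Gd k c); rewrite card_prod card_ffun !card_ord.
rewrite sumE big1 // => r _.
by rewrite MG (expr0_char _ p_pr) mul0r.
Qed.

End Monomials.
End PLinear.

(** * Degree bounds for roots of ideals *)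

Section Adjunction.
Variables (K : fieldType) (p : nat).
Hypothesis (char_p : p \in [pchar K]).
Let p_pr : prime p := pcharf_prime char_p.
Let p_gt0 : (0 < p)%N := prime_gt0 p_pr.

(** Polynomial expressions in [cs] with p-th powers as coefficients; their
    values form the field generated by [cs] over the p-th powers. *)
Definition pfield_eval (cs : seq K) : {mpoly K[size cs]} -> K :=
  mmap (pFrobenius_aut char_p) (fun i => cs`_i).
HB.instance Definition _ cs := GRing.RMorphism.on (@pfield_eval cs).

Definition pfield (cs : seq K) (c : K) := exists q, c = @pfield_eval cs q.

Lemma pfield_pth cs c : pth_power p c -> pfield cs c.
Proof. by case=> y ->; exists y%:MP; rewrite /pfield_eval mmapC. Qed.

Lemma pfield_mem cs c : c \in cs -> pfield cs c.
Proof.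
move=> ccs; have ic : (index c cs < size cs)%N by rewrite index_mem.
exists 'X_(Ordinal ic); rewrite /pfield_eval mmapX mmap1U /=.
by rewrite nth_index.
Qed.

(** A subring containing the p-th powers is a field, since [1/x = x^(p-1)
    (1/x)^p]. *)
Lemma pfield_subfield cs : subfield_pred (pfield cs).
Proof.
have mul x y : pfield cs x -> pfield cs y -> pfield cs (x * y).
  by move=> [a ->] [b ->]; exists (a * b); rewrite rmorphM.
split=> // [|x y [a ->] [b ->]|x Sx].
- by exists 1; rewrite rmorph1.
- by exists (a - b); rewrite rmorphB.
have [->|x0] := eqVneq x 0; first by exists 0; rewrite invr0 rmorph0.
have -> : x^-1 = x ^+ p.-1 * (x^-1) ^+ p.
  by rewrite -{2}(prednK p_gt0) exprSr mulrA -exprMn mulfV // expr1n mul1r.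
apply: (mul); last by apply: pfield_pth; exists x^-1.
elim: p.-1 => [|k IH]; last by rewrite exprS; exact: mul.
by exists 1; rewrite rmorph1.
Qed.

Definition monomials (cs : seq K) : seq K :=
  [seq \prod_(i < size cs) cs`_i ^+ s i | s : {ffun 'I_(size cs) -> 'I_p}].

Lemma size_monomials cs : size (monomials cs) = (p ^ size cs)%N.
Proof. by rewrite size_map -cardE card_ffun !card_ord. Qed.

Lemma pfield_monomials cs c : c \in monomials cs -> pfield cs c.
Proof.
case/mapP=> s _ ->; exists 'X_[[multinom (s i : nat) | i < size cs]].
rewrite /pfield_eval mmapX /mmap1; apply: eq_bigr => i _.
by rewrite mnmE.
Qed.

(** Exponents can be reduced modulo [p], because [c^p] is a scalar. *)
Lemma pfield_coords cs c : pfield cs c -> coords (pth_power p) (monomials cs) c.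
Proof.
case=> q ->; have SF := pth_power_subfield char_p.
rewrite /pfield_eval /mmap; elim/big_ind: _ => [|x y|m _].
- exact: coords0.
- exact: coordsD.
rewrite /mmap1 (high_low char_p m).
have -> : \prod_(i < size cs) cs`_i ^+ (high p m *+ p + mlow (low char_p m))%MM i =
    (\prod_(i < size cs) cs`_i ^+ high p m i) ^+ p * \prod_(i < size cs) cs`_i ^+ low char_p m i.
  rewrite -prodrXl -big_split /=; apply: eq_bigr => i _.
  by rewrite mnmDE mulmnE exprD exprM [mlow _ _]mnmE.
rewrite mulrA -(high_low char_p m) -exprMn; apply: coordsZ => //; first by eexists.
by apply: coords_mem => //; apply: map_f; rewrite mem_enum.
Qed.

End Adjunction.

Definition ideal_le (K : fieldType) n B (gs : seq {mpoly K[n]}) (g : {mpoly K[n]}) :=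
  exists2 c : 'I_(size gs) -> {mpoly K[n]}, forall i, deg_le B (c i) &
    g = \sum_i c i * gs`_i.

Section Generation.
Variables (K : fieldType) (p n : nat).
Hypothesis (char_p : p \in [pchar K]).
Let p_pr : prime p := pcharf_prime char_p.
Let p_gt0 : (0 < p)%N := prime_gt0 p_pr.
Variables (d : nat) (G J : seq {mpoly K[n]}) (cs : seq K).
Hypotheses (Gd : forall f, f \in G -> deg_le d f) (Jd : forall f, f \in J -> deg_le d f).
Let S := pfield char_p cs.
Let SF : subfield_pred S := pfield_subfield char_p cs.
Hypothesis JS : forall f, f \in J -> forall m, S f@_m.

Let B := root_bound p n d (size cs).

Let over (f : {mpoly K[n]}) := forall m, S f@_m.

Lemma overM f g : over f -> over g -> over (f * g).
Proof.
move=> Sf Sg m; rewrite mcoeffM; elim/big_ind: _ => [|x y|k _].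
- exact: (sf0 SF).
- exact: (sfD SF).
exact: (sfM SF).
Qed.

Lemma over_sum (I : Type) (r : seq I) (F : I -> {mpoly K[n]}) :
  (forall i, over (F i)) -> over (\sum_(i <- r) F i).
Proof.
move=> h m; rewrite raddf_sum /=; elim/big_ind: _ => [|x y|k _].
- exact: (sf0 SF).
- exact: (sfD SF).
exact: h.
Qed.

Lemma over_expp g : over (g ^+ p).
Proof.
rewrite (mpoly_expp char_p); apply: over_sum => m k.
rewrite mcoeffZ mcoeffX; case: eqP => _; rewrite ?mulr0 ?mulr1; last exact: (sf0 SF).
by apply: pfield_pth; eexists.
Qed.

(** Solvability of a linear system does not depend on the field: expand the
    solution along a basis which contains 1 and compare the coefficients of 1. *)
Lemma descend f (h : 'I_(size J) -> {mpoly K[n]}) : over f -> f = \sum_i h i * J`_i ->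
  exists2 h' : 'I_(size J) -> {mpoly K[n]}, forall i, over (h' i) & f = \sum_i h' i * J`_i.
Proof.
move=> Sf fE; pose l := flatten [seq [seq (h i)@_m | m <- msupp (h i)] | i : 'I_(size J)].
(* The element 1 comes last in the list, at index [t = size b]. *)
have i1 : indep S [:: 1] by split=> //=; apply/eqP/oner_neq0.
have [b [ib _ _ bl]] := indep_extend SF l i1; set e := b ++ _ in ib bl.
have /functional_choice[F FP] : forall i, exists F : nat -> {mpoly K[n]},
    (forall j, over (F j)) /\ h i = \sum_(j < size e) e`_j *: F j.
  move=> i; have [m|F [SFj _ hE]] := @mpoly_coords _ S SF n e (h i); last by exists F.
  have [mh|mh] := boolP (m \in msupp (h i)); last first.
    by rewrite (memN_msupp_eq0 mh); apply: coords0.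
  apply: bl; apply/flatten_mapP; exists i; first by rewrite mem_enum.
  by apply: map_f.
pose U j := \sum_i F i j * J`_i; pose t := size b.
have te : (t < size e)%N by rewrite size_cat addn1.
have SU j : over (U j).
  by apply: over_sum => i; apply: overM; [exact: (FP i).1 | apply: JS; exact: mem_nth].
have fU : f = \sum_(j < size e) e`_j *: U j.
  rewrite fE; under eq_bigr => i _ do rewrite (FP i).2 mulr_suml.
  rewrite exchange_big; apply: eq_bigr => j _; rewrite scaler_sumr.
  by apply: eq_bigr => i _; rewrite scalerAl.
exists (fun i => F i t) => [i|]; first exact: (FP i).1.
apply/mpolyP=> m; pose c j := (U j)@_m - f@_m *+ (j == t).
have c0 : c t = 0.
  apply: (indepP SF ib _ _ te) => [j|].
    apply: (sfB SF); first exact: SU.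
    by case: eqP => _; [exact: Sf | exact: (sf0 SF)].
  under eq_bigr => j _ do rewrite mulrBl.
  rewrite sumrB [X in _ - X](bigD1 (Ordinal te)) //= eqxx mulr1n.
  rewrite [X in _ - (_ + X)]big1 ?addr0 => [|j /negbTE jt]; last first.
    by rewrite -val_eqE /= in jt; rewrite jt mulr0n mul0r.
  rewrite nth_cat ltnn subnn mulr1 -/e; apply/eqP; rewrite subr_eq0; apply/eqP.
  by rewrite fU raddf_sum /=; apply: eq_bigr => j _; rewrite mcoeffZ mulrC.
by move/eqP: c0; rewrite /c eqxx mulr1n subr_eq0 => /eqP.
Qed.

(** After [descend], the multipliers of [J] have coefficients in the field
    generated by [cs] over the p-th powers, and [p_kernel] applies to the family
    made of the [G_j^p] and of the products of the [J_i] with the elements of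
    [pbasis]. Each of the solutions of bounded degree that it provides yields
    one of the [g'], and [g] is a combination of these. *)
Theorem bounded_generation g : in_ideal G g -> in_ideal J (g ^+ p) ->
  span (fun g' : {mpoly K[n]}^o => ideal_le B G g' /\ ideal_le B J (g' ^+ p)) g.
Proof.
move=> [a gE] [h0 /(descend (@over_expp g))[h Sh gpE]].
have PF := pth_power_subfield char_p.
have [b [ib sb subb cb]] := indep_extend PF (monomials p cs) (I : indep (pth_power p) [::]).
rewrite cats0 in ib cb.
have Sb c : S c -> coords (pth_power p) b c.
  by move/pfield_coords; apply: coords_trans.
pose R := ('I_(size b) * {ffun 'I_n -> 'I_p})%type.
have Spb (r : R) : over (pbasis r).
  move=> m; rewrite mcoeffZ mcoeffX; apply: (sfM SF).
    by apply: pfield_monomials; apply: subb; exact: mem_nth.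
  by case: eqP => _; [exact: (sf1 SF) | exact: (sf0 SF)].
have dpb (r : R) : deg_le (n * p) (pbasis r).
  apply: deg_leZ; apply: deg_le_mnm; rewrite mdegE.
  apply: (@leq_trans (\sum_(i < n) p)); last by rewrite sum_nat_const card_ord.
  by apply: leq_sum => i _; rewrite mnmE ltnW.
have /functional_choice[eta etaP] : forall i, exists c : R -> {mpoly K[n]},
    h i = \sum_r c r ^+ p * pbasis r.
  move=> i; have hd : deg_le (msize (h i)) (h i) by apply: leqnSn.
  by have [c _ hE] := pbasis_span char_p (fun m => Sb _ (Sh i m)) hd; exists c.
pose C := ('I_(size G) + 'I_(size J) * R)%type.
pose Phi (c : C) := match c with
  | inl j => G`_j ^+ p
  | inr (i, r) => - (pbasis r * J`_i)
  end.
pose v (c : C) := match c with inl j => a j | inr (i, r) => eta i r end.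
have PhiS c : over (Phi c).
  case: c => [j|[i r]] /=; first exact: over_expp.
  move=> m; rewrite mcoeffN; apply: (sfN SF); apply: overM => //.
  by apply: JS; exact: mem_nth.
have Phid c : deg_le (p * d + n * p) (Phi c).
  case: c => [j|[i r]] /=.
    apply: (@deg_leW _ _ (d * p)); first by rewrite mulnC leq_addr.
    by apply: deg_leX; apply: Gd; exact: mem_nth.
  apply: deg_leN; apply: (@deg_leW _ _ (n * p + d)); first by nia.
  by apply: deg_leM => //; apply: Jd; exact: mem_nth.
have sumPhi w : \sum_c w c ^+ p * Phi c =
    (\sum_j w (inl j) * G`_j) ^+ p - \sum_i (\sum_r w (inr (i, r)) ^+ p * pbasis r) * J`_i.
  rewrite big_sumType /= (expr_sum_char p_pr (mpoly_char char_p n)); congr (_ + _).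
    by apply: eq_bigr => j _; rewrite exprMn.
  transitivity (\sum_i \sum_r w (inr (i, r)) ^+ p * Phi (inr (i, r))).
    by rewrite pair_bigA /=; apply: eq_bigr => -[].
  rewrite -sumrN; apply: eq_bigr => i _; rewrite mulr_suml -sumrN; apply: eq_bigr => r _.
  by rewrite mulrN mulrA.
have vPhi : \sum_c v c ^+ p * Phi c = 0.
  rewrite sumPhi /= -gE gpE -sumrB big1 // => i _.
  by rewrite -etaP subrr.
have [k [U [u [Ud UPhi vE]]]] := p_kernel char_p ib (fun c m => Sb _ (PhiS c m)) Phid vPhi.
have Ub l c : deg_le (iter (p ^ size cs * p ^ n) (row_bound n) (p * d + n * p)) (U l c).
  apply: deg_leW (Ud l c); apply: leq_trans (leq_subr _ _) _.
  have : (size b * p ^ n <= p ^ size cs * p ^ n)%N.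
    by rewrite leq_mul2r -(size_monomials p cs) sb orbT.
  by move=> /subnK <-; rewrite iterD iter_row_bound_ge.
rewrite gE; have -> : \sum_i a i * G`_i = \sum_l u l *: ((\sum_j U l (inl j) * G`_j) : {mpoly K[n]}^o).
  under eq_bigr => j _ do rewrite [a j](vE (inl j)) mulr_suml.
  rewrite exchange_big; apply: eq_bigr => l _; rewrite scaler_sumr.
  by apply: eq_bigr => j _; rewrite -mulrA.
apply: span_sum => l _; apply: span_scale; apply: span_mem; split.
  exists (fun j => U l (inl j)) => // j; apply: deg_leW (Ub _ _).
  by rewrite /B /root_bound -{1}[iter _ _ _]mul1n; apply: leq_trans (leq_mul p_gt0 (leqnn _)) (leq_addr _ _).
exists (fun i => \sum_r U l (inr (i, r)) ^+ p * pbasis r) => [i|].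
  apply: deg_le_sum => r _; apply: deg_leM => //.
  by rewrite [X in deg_le X]mulnC; apply: deg_leX.
by apply/eqP; rewrite -subr_eq0 -sumPhi UPhi.
Qed.

End Generation.

(** * Noetherian rings *)

Section Ideals.
Variable R : comPzRingType.
Implicit Types (I : R -> Prop) (gs : seq R).

Definition ideal I := I 0 /\ forall a x y, I x -> I y -> I (a * x + y).

Lemma ideal_in I gs r : ideal I -> (forall g, g \in gs -> I g) -> in_ideal gs r -> I r.
Proof. by move=> [I0 ID] gI /in_idealP; elim=> // a u v /gI Iu _ Iv; exact: ID. Qed.

Lemma in_ideal_ideal gs : ideal (in_ideal gs).
Proof.
split=> [|a x y /in_idealP xg /in_idealP yg]; apply/in_idealP; first exact: span0.
by apply: span_add => //; apply: (@span_scale R R^o).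
Qed.

Lemma in_ideal_mem gs g : g \in gs -> in_ideal gs g.
Proof. by move=> gg; apply/in_idealP; exact: span_mem. Qed.

Definition noetherian := forall I, ideal I -> exists gs, forall r, I r <-> in_ideal gs r.

(** The union of the chain is finitely generated, and its generators occur at
    some stage. *)
Lemma noetherian_chain (J : nat -> R -> Prop) : noetherian -> (forall k, ideal (J k)) ->
  (forall k r, J k r -> J k.+1 r) -> exists k, forall j r, J j r -> J k r.
Proof.
move=> RN Jid JS; have Jmono i j r : (i <= j)%N -> J i r -> J j r.
  by move=> /subnK <- Jr; elim: (j - i)%N => // k; exact: JS.
have uid : ideal (fun r => exists k, J k r).
  split=> [|a x y [i Jx] [j Jy]]; first by exists 0%N; exact: (Jid 0%N).1.
  exists (maxn i j); apply: (Jid _).2.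
    exact: Jmono (leq_maxl i j) Jx.
  exact: Jmono (leq_maxr i j) Jy.
have [gs gsP] := RN _ uid.
have [k kP] : exists k, forall g, g \in gs -> J k g.
  have : forall g, g \in gs -> exists k, J k g by move=> g gg; apply/gsP; exact: in_ideal_mem.
  elim: gs {gsP} => [|g gs IH] h; first by exists 0%N.
  have [i Ji] := h g (mem_head _ _); have [|j Jj] := IH; first by move=> x xg; apply: h; rewrite inE xg orbT.
  exists (maxn i j) => x; rewrite inE => /predU1P[->|/Jj Jx].
    exact: Jmono (leq_maxl i j) Ji.
  exact: Jmono (leq_maxr i j) Jx.
exists k => j r Jr; apply: (ideal_in (Jid k) kP); apply/gsP.
by exists j.
Qed.

Lemma noetherian_sequence (r : nat -> R) : noetherian ->
  exists k (c : nat -> R), r k = \sum_(i < k) c i * r i.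
Proof.
move=> RN; have [|k r' Jr|k kP] := @noetherian_chain (fun k => in_ideal (mkseq r k)) RN.
- by move=> k; exact: in_ideal_ideal.
- apply: ideal_in Jr => [|g /mapP[i ik ->]]; first exact: in_ideal_ideal.
  apply: in_ideal_mem; apply: map_f; move: ik; rewrite !mem_iota /= !add0n => ik.
  exact: ltnW.
have /kP[c cE] : in_ideal (mkseq r k.+1) (r k).
  by apply: in_ideal_mem; apply: map_f; rewrite mem_iota add0n /=.
exists k, (fun i => if insub i is Some j then c j else 0); rewrite cE.
have sk : size (mkseq r k) = k by rewrite size_mkseq.
rewrite (reindex (cast_ord (esym sk))) /=; last first.
  by exists (cast_ord sk) => j _; rewrite ?cast_ordK ?cast_ordKV.
apply: eq_bigr => j _; rewrite nth_mkseq //.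
by rewrite insubT /= ?size_mkseq // => js; congr (c _ * _); apply: val_inj.
Qed.

End Ideals.

Lemma noetherian_image (R S : comPzRingType) (h : {rmorphism R -> S}) :
  surjective h -> noetherian R -> noetherian S.
Proof.
move=> surj RN I [I0 ID]; have [|gs gsP] := RN (fun r => I (h r)).
  by split=> [|a x y Ix Iy]; [rewrite rmorph0 | rewrite rmorphD rmorphM; exact: ID].
exists [seq h g | g <- gs] => s; split=> [|]; last first.
  apply: ideal_in => // _ /mapP[g gg ->]; apply/gsP; exact: in_ideal_mem.
have [r <-] := surj s => /gsP/in_idealP Sr; apply/in_idealP.
apply: (@span_map _ _ R^o S^o h h _ _ r _ _ _ Sr); first exact: rmorph0.
  by move=> a x y; rewrite rmorphD -[a *: x]/(a * x) rmorphM.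
by move=> x xin; apply: span_mem; exact: map_f.
Qed.

Lemma noetherian_field (K : fieldType) : noetherian K.
Proof.
move=> I [I0 ID]; have [[x [Ix x0]]|nI] := classic (exists x, I x /\ x != 0).
  exists [:: x] => r; split=> [_|].
    by exists (fun=> r / x); rewrite big_ord1 /= divfK.
  by apply: ideal_in => // g; rewrite inE => /eqP ->.
exists [::] => r; split=> [Ir|[c ->]]; last by rewrite big_ord0.
exists (fun=> 0); rewrite big_ord0; apply/eqP; apply/negP => /negP r0; apply: nI.
by exists r.
Qed.

Lemma least (P : nat -> Prop) : (exists n, P n) -> exists n, P n /\ forall m, P m -> (n <= m)%N.
Proof.
move=> [n]; elim/ltn_ind: n => n IH Pn.
have [[m [Pm mn]]|h] := classic (exists m, P m /\ (m < n)%N); first exact: IH mn Pm.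
exists n; split=> // m Pm; rewrite leqNgt; apply/negP => mn; apply: h; by exists m.
Qed.

(** Hilbert's basis theorem: if [I] is not finitely generated, choose
    successively elements of least degree outside the ideal generated by the
    previous ones. Some leading coefficient is a combination of the previous
    ones, which allows a decrease of the degree. *)
Lemma noetherian_poly (A : comNzRingType) : noetherian A -> noetherian {poly A}.
Proof.
move=> AN I Iid; apply: NNPP => nfg.
have /functional_choice[nx nxP] : forall s : seq {poly A}, exists f, (forall g, g \in s -> I g) ->
    [/\ I f, ~ in_ideal s f & forall g, I g -> ~ in_ideal s g -> (size f <= size g)%N].
  move=> s; have [sI|] := classic (forall g, g \in s -> I g); last by exists 0.
  have [|k [[f [If nf <-]] kmin]] := @least (fun k => exists f, [/\ I f, ~ in_ideal s f & size f = k]).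
    apply: NNPP => h; apply: nfg; exists s => f; split=> [If|]; last exact: ideal_in.
    by apply: NNPP => nf; apply: h; exists (size f), f.
  by exists f => _; split=> // g Ig ng; apply: kmin; exists g.
pose s k := iter k (fun s => nx s :: s) [::].
have sI k g : g \in s k -> I g.
  elim: k g => //= k IH g; rewrite inE => /predU1P[->|/IH //].
  by have [] := nxP _ IH.
have sS k g : in_ideal (s k) g -> in_ideal (s k.+1) g.
  apply: ideal_in; first exact: in_ideal_ideal.
  by move=> x xs; apply: in_ideal_mem; rewrite /= inE xs orbT.
have s_size k x : x \in s k -> (size x <= size (nx (s k)))%N.
  elim: k x => //= k IH x xs; have [Ik nk _] := nxP _ (sI k.+1).
  have [_ _ mink] := nxP _ (sI k); have le := mink _ Ik (fun h => nk (sS _ _ h)).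
  by move: xs; rewrite inE => /predU1P[-> //|/IH h]; apply: leq_trans h le.
pose J k := in_ideal [seq lead_coef x | x <- s k].
have [|k r|k kP] := @noetherian_chain _ J AN; first by move=> k; exact: in_ideal_ideal.
  apply: ideal_in; first exact: in_ideal_ideal.
  by move=> x xs; apply: in_ideal_mem; rewrite /= inE xs orbT.
set f := nx (s k); have [If nf fmin] := nxP _ (sI k).
have /in_idealP lf : J k (lead_coef f).
  by apply: (kP k.+1); apply: in_ideal_mem; rewrite /= inE eqxx.
have f0 : f != 0.
  by apply/eqP => f0; apply: nf; rewrite -/f f0; exact: (in_ideal_ideal _).1.
have fs : (0 < size f)%N by rewrite size_poly_gt0.
suff [h [hs hf hc]] : exists h, [/\ in_ideal (s k) h, (size h <= size f)%N & h`_(size f).-1 = lead_coef f].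
  have : (size f <= size (f - h)%R)%N.
    apply: fmin => [|fh].
      rewrite addrC -mulN1r; apply: Iid.2 => //; exact: (ideal_in Iid (sI k)).
    apply: nf; rewrite -/f -[f](subrK h) -[f - h]mul1r.
    exact: (in_ideal_ideal _).2.
  apply/negP; rewrite -ltnNge -(prednK fs) ltnS; apply/leq_sizeP => j.
  rewrite leq_eqVlt => /predU1P[<-|]; first by rewrite coefB hc subrr.
  rewrite prednK // => fj; rewrite coefB !nth_default ?subrr //.
  exact: leq_trans hf fj.
elim: lf => [|a _ v /mapP[x xs ->] _ [h [hs hf hc]]].
  by exists 0; split; [exact: (in_ideal_ideal _).1 | rewrite size_poly0 | rewrite coef0].
have xf := s_size _ _ xs; rewrite -/f in xf.
exists ((a%:P * 'X^(size f - size x)) * x + h); split.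
- by apply: (in_ideal_ideal _).2 => //; exact: in_ideal_mem.
- apply: leq_trans (size_polyD _ _) _; rewrite geq_max hf andbT -mulrA.
  apply: leq_trans (size_polyMleq _ _) _; rewrite mulrC.
  have [->|x0] := eqVneq x 0; first by rewrite mul0r size_poly0 addn0; apply: leq_trans (leq_pred _) (leq_trans (size_polyC_leq1 _) fs).
  rewrite size_mulXn // subnK //; move: (size_polyC_leq1 a); move: (size a%:P) (size f) => u w; lia.
rewrite coefD hc -mulrA coefCM coefXnM; congr (a * _ + _).
have [->|x0] := eqVneq x 0; first by rewrite lead_coef0 coef0; case: ifP.
have xs0 : (0 < size x)%N by rewrite size_poly_gt0.
case: ifP => [|_]; first by move: xf xs0; lia.
by rewrite lead_coefE; congr (x`_ _); move: xf xs0; lia.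
Qed.

(** Adding a variable amounts to [noetherian_poly], up to the surjection
    [unshear]. *)
Lemma noetherian_mpoly (K : fieldType) n : noetherian {mpoly K[n]}.
Proof.
elim: n => [|n IH].
  pose h : {rmorphism K -> {mpoly K[0]}} := @mpolyC 0 K.
  apply: (@noetherian_image K {mpoly K[0]} h _ (@noetherian_field K)) => q.
  by exists (q@_0%MM); apply/esym/nvar0_mpolyC.
pose h : {rmorphism {poly {mpoly K[n]}} -> {mpoly K[n.+1]}} := @unshear K n 1.
apply: (@noetherian_image {poly {mpoly K[n]}} {mpoly K[n.+1]} h _ (noetherian_poly IH)) => q.
by exists (shear 1 q); exact: shearK.
Qed.

(** * The descending chain *)

Section FrobeniusChain.
Variables (p : nat) (R Q : comPzRingType) (iota : {rmorphism R -> Q}) (D : R).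
Hypotheses (p_pr : prime p) (R_char : p%:R = 0 :> R) (RN : noetherian R)
  (Q_tot : total_ring_of_fractions iota) (D_reg : nonzerodivisor D)
  (D_cond : in_conductor iota D).
Let p_gt0 : (0 < p)%N := prime_gt0 p_pr.
Let Q_char : p%:R = 0 :> Q.
Proof. by rewrite -(rmorph_nat iota) R_char rmorph0. Qed.
Let frobD := exprD_char p_pr Q_char.

Notation V := (V iota p D).

Definition submodule (M : Q -> Prop) := M 0 /\ forall a x y, M x -> M y -> M (iota a * x + y).

Lemma submoduleZ M a x : submodule M -> M x -> M (iota a * x).
Proof. by move=> [M0 MD] Mx; rewrite -[_ * _]addr0; exact: MD. Qed.

Lemma submoduleD M x y : submodule M -> M x -> M y -> M (x + y).
Proof. by move=> [M0 MD] Mx My; rewrite -[x]mul1r -(rmorph1 iota); exact: MD. Qed.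

Lemma submodule_sum M (I : Type) (r : seq I) (C : pred I) (c : I -> R) (x : I -> Q) :
  submodule M -> (forall i, C i -> M (iota (c i) * x i)) -> M (\sum_(i <- r | C i) iota (c i) * x i).
Proof.
move=> sM h; elim/big_ind: _ => [|y z My Mz|i Ci]; [exact: sM.1 | exact: submoduleD | exact: h].
Qed.

Lemma V_submodule e : submodule (V e).
Proof.
elim: e => [|e [V0 VD]] /=.
  split=> [|a x y [r xr] [s ys]]; first by exists 0; rewrite /is_frac mul0r rmorph0.
  by exists (a * r + s); rewrite /is_frac mulrDl -mulrA xr ys rmorphD rmorphM.
split=> [|a x y [Vx Vxp] [Vy Vyp]]; first by split; rewrite ?(expr0_char _ p_pr).
by split; [exact: VD | rewrite frobD exprMn -rmorphXn; exact: VD].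
Qed.

Lemma V_mono e e' f : (e <= e')%N -> V e' f -> V e f.
Proof. by move=> /subnK <-; elim: (e' - e)%N => //= k IH [/IH]. Qed.

(** The intersection of the chain. *)
Definition stable f := forall e, V e f.

Lemma stable_submodule : submodule stable.
Proof.
split=> [e|a x y sx sy e]; first exact: (V_submodule e).1.
exact: (V_submodule e).2.
Qed.

Lemma stable_exp f : stable f -> stable (f ^+ p).
Proof. by move=> sf e; exact: (sf e.+1).2. Qed.

(** The ascending chain condition in [(1/D) R], which is isomorphic to [R] as a
    module. *)
Lemma frac_sequence (x : nat -> Q) : (forall i, V 0 (x i)) ->
  exists k (c : nat -> R), x k = \sum_(i < k) iota (c i) * x i.
Proof.
move=> /functional_choice[r rP]; have [_ units _] := Q_tot.
have [u uD] := units _ D_reg; have [k [c rk]] := noetherian_sequence r RN.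
exists k, c; have xE i : x i = u * iota (r i) by rewrite -(rP i) mulrCA uD mulr1.
rewrite xE rk rmorph_sum mulr_sumr; apply: eq_bigr => i _.
by rewrite rmorphM xE mulrCA.
Qed.

(** The exponents [p^i] with [i < k] are distinct and smaller than [p^k], so the
    relation is a monic equation. *)
Lemma integral_of_relation h k (c : nat -> R) :
  h ^+ (p ^ k) = \sum_(i < k) iota (c i) * h ^+ (p ^ i) -> integral iota h.
Proof.
move=> hE; exists (p ^ k)%N, (fun j : 'I_(p ^ k) => \sum_(i < k | (p ^ i)%N == j) - c i).
rewrite hE; under [X in _ + X]eq_bigr => j _ do rewrite rmorph_sum mulr_suml.
rewrite (exchange_big_dep predT) //= -big_split /= big1 // => i _.
have pik : (p ^ i < p ^ k)%N by rewrite ltn_exp2l ?prime_gt1.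
rewrite (big_pred1 (Ordinal pik)) => [|j]; last by rewrite eq_sym.
by rewrite rmorphN mulNr addrN.
Qed.

Lemma integral_exp f : integral iota f -> integral iota (f ^+ p).
Proof.
move=> [n [c fE]]; exists n, (fun i => c i ^+ p).
have e m : (f ^+ p) ^+ m = (f ^+ m) ^+ p by rewrite -!exprM mulnC.
rewrite -[RHS](expr0_char Q p_pr) -[X in _ = X ^+ p]fE frobD (expr_sum_char p_pr Q_char).
by rewrite e; congr (_ + _); apply: eq_bigr => i _; rewrite rmorphXn exprMn e.
Qed.

(** An integral element has integral p-th powers, all of which the conductor
    sends into [R]. Conversely the powers [f^(p^i)] of a stable element satisfy
    a relation by [frac_sequence]. *)
Lemma integral_stable f : integral iota f <-> stable f.
Proof.
split=> [fi e|fs].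
  elim: e f fi => [|e IH] f fi /=; last by split; apply: IH => //; exact: integral_exp.
  by have [r fr] := D_cond fi; exists r; rewrite /is_frac mulrC.
have [|k [c fE]] := @frac_sequence (fun i => f ^+ (p ^ i)); last exact: integral_of_relation fE.
move=> i; suff : stable (f ^+ (p ^ i)) by apply.
elim: i => [|i IH]; first by rewrite expn0 expr1.
by rewrite expnSr exprM; exact: stable_exp.
Qed.

Lemma V_stationary e : (forall f, V e f <-> V e.+1 f) -> forall f, V e f <-> integral iota f.
Proof.
move=> Ve f; rewrite integral_stable; split=> [Vf e'|]; last exact.
have [e'e|ee'] := leqP e' e; first exact: V_mono Vf.
rewrite -(subnK (ltnW ee')); elim: (e' - e)%N f Vf => // k IH f Vf.
split; first exact: IH.
by apply: IH; have /Ve[] := Vf.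
Qed.

Section NotStable.
Hypothesis never : forall e, exists f, V e f /\ ~ stable f.

(** The elements [r] of [R] such that [r t V_e] is contained in the intersection
    of the chain for large [e]. As [e] grows this is an increasing union of
    ideals. *)
Definition eventual_ann t r := exists e, forall f, V e f -> stable (iota (r * t) * f).

Lemma eventual_ann_ideal t : ideal (eventual_ann t).
Proof.
split=> [|a x y [e ex] [e' ey]].
  by exists 0%N => f _; rewrite mul0r rmorph0 mul0r; exact: stable_submodule.1.
exists (maxn e e') => f Vf; rewrite mulrDl rmorphD mulrDl -mulrA rmorphM -mulrA.
apply: stable_submodule.2; [apply: ex | apply: ey]; apply: V_mono Vf.
  exact: leq_maxl.
exact: leq_maxr.
Qed.

Lemma eventual_ann_mul t y r : eventual_ann t r -> eventual_ann (t * y) r.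
Proof.
move=> [e er]; exists e => f Vf.
have -> : iota (r * (t * y)) * f = iota y * (iota (r * t) * f).
  by rewrite [RHS]mulrA -rmorphM mulrA [y * _]mulrC.
exact: submoduleZ stable_submodule (er f Vf).
Qed.

(** Among the proper ideals of this form there is one, attached to some [t],
    which is maximal, since [R] is noetherian. Replacing [t] by [t y] enlarges
    the ideal, and keeps it proper as long as [y] is not in it; maximality then
    says that the ideal is prime. The proof is by contradiction: it builds a
    strictly increasing chain. *)
Lemma prime_eventual_ann : exists t, ~ eventual_ann t 1 /\
  forall x y, eventual_ann t (x * y) -> eventual_ann t x \/ eventual_ann t y.
Proof.
apply: NNPP => nex.
have next t : ~ eventual_ann t 1 -> exists y, ~ eventual_ann (t * y) 1 /\ exists r, eventual_ann (t * y) r /\ ~ eventual_ann t r.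
  move=> nt; apply: NNPP => h; apply: nex; exists t; split=> // x y txy.
  have [ty|nty] := classic (eventual_ann t y); [by right | left].
  apply: NNPP => ntx; apply: h; exists y; split=> [[e eP]|].
    by apply: nty; exists e => f /eP; rewrite mul1r [t * y]mulrC.
  exists x; split=> //; case: txy => e eP; exists e => f /eP.
  by rewrite -mulrA [y * t]mulrC.
have /functional_choice[nx nxP] : forall t, exists y, ~ eventual_ann t 1 -> ~ eventual_ann (t * y) 1 /\
    exists r, eventual_ann (t * y) r /\ ~ eventual_ann t r.
  move=> t; have [kt|/next[y yP]] := classic (eventual_ann t 1); [by exists 0 | by exists y].
pose t := fix t k := if k is j.+1 then t j * nx (t j) else 1.
have tP k : ~ eventual_ann (t k) 1.
  elim: k => [[e eP]|k /nxP[] //]; have [f [Vf nf]] := never e.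
  by apply: nf; have := eP f Vf; rewrite mulr1 rmorph1 mul1r.
have [k|k r|k kP] := @noetherian_chain R (fun k => eventual_ann (t k)) RN.
- exact: eventual_ann_ideal.
- exact: eventual_ann_mul.
by have [_ [r [/(kP k.+1) kr nkr]]] := nxP _ (tP k).
Qed.

Lemma fracI r u u' : is_frac iota D r u -> is_frac iota D r u' -> u = u'.
Proof.
rewrite /is_frac => <- e; have [_ units _] := Q_tot; have [v vD] := units _ D_reg.
by rewrite -[u]mulr1 -[u']mulr1 -vD ![v * _]mulrC !mulrA e.
Qed.

(** The argument with the prime [P] attached to [t] that is sketched at the top,
    carried out for [U e = t V_e + stable]. *)
Lemma unstable_chain_absurd : False.
Proof.
have [t [nt1 tprime]] := prime_eventual_ann; pose P := eventual_ann t.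
have Pid : ideal P := eventual_ann_ideal t.
(* From the index [e1] on, [P] itself carries [t V_e] into the intersection. *)
have [|e r er f Vf|e1 e1P] := @noetherian_chain R (fun e r => forall f, V e f -> stable (iota (r * t) * f)) RN.
- move=> e; split=> [f _|a x y ex ey f Vf].
    by rewrite mul0r rmorph0 mul0r; exact: stable_submodule.1.
  rewrite mulrDl rmorphD mulrDl -mulrA rmorphM -mulrA.
  by apply: stable_submodule.2; [exact: ex | exact: ey].
- by apply: er; exact: V_mono Vf.
pose U e g := exists f b, [/\ V e f, stable b & g = iota t * f + b].
have U_sub e : submodule (U e).
  split=> [|a _ _ [f [b [Vf sb ->]]] [f' [b' [Vf' sb' ->]]]].
    exists 0, 0; rewrite mulr0 addr0; split=> //; [exact: (V_submodule e).1 | exact: stable_submodule.1].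
  exists (iota a * f + f'), (iota a * b + b'); split.
  - exact: (V_submodule e).2.
  - exact: stable_submodule.2.
  by rewrite !mulrDr addrACA [iota a * (_ * _)]mulrCA.
have U_mono e e' g : (e <= e')%N -> U e' g -> U e g.
  by move=> ee' [f [b [Vf sb ->]]]; exists f, b; split=> //; exact: V_mono Vf.
have U_stable e b : stable b -> U e b.
  by move=> sb; exists 0, b; rewrite mulr0 add0r; split=> //; exact: (V_submodule e).1.
have U_V0 e g : U e g -> V 0 g.
  move=> [f [b [Vf sb ->]]]; apply: (V_submodule 0).2; last exact: (sb 0%N).
  exact: V_mono (leq0n e) Vf.
have U_kill e r g : (e1 <= e)%N -> P r -> U e g -> stable (iota r * g).
  move=> e1e [e' er] [f [b [Vf sb ->]]]; rewrite mulrDr mulrA -rmorphM.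
  apply: (submoduleD stable_submodule) (submoduleZ _ stable_submodule sb).
  exact: (e1P e' r er f (V_mono e1e Vf)).
have U_exp e g : U e.+1 g -> U e (g ^+ p).
  move=> [f [b [[_ Vfp] sb ->]]]; exists (iota (t ^+ p.-1) * f ^+ p), (b ^+ p); split.
  - exact: submoduleZ (V_submodule e) Vfp.
  - exact: stable_exp.
  by rewrite frobD exprMn mulrA -rmorphM -exprS (prednK p_gt0) rmorphXn.
(* Otherwise every [U e] would contain a [u] none of whose multiples by an
   element outside of [P] is in [U e.+1]. *)
have [e [y [ny yU]]] : exists e y, ~ P y /\ forall g, U e g -> U e.+1 (iota y * g).
  apply: NNPP => nc.
  have bad e : exists u, U e u /\ forall y, ~ P y -> ~ U e.+1 (iota y * u).
    apply: NNPP => nb; apply: nc; exists e.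
    have good u : U e u -> exists y, ~ P y /\ U e.+1 (iota y * u).
      move=> Uu; apply: NNPP => h; apply: nb; exists u; split=> // y ny Uy; apply: h; by exists y.
    have Iid : ideal (fun r => exists u, U e u /\ is_frac iota D r u).
      split=> [|a r s [u [Uu ru]] [v [Uv sv]]].
        by exists 0; split; [exact: (U_sub e).1 | rewrite /is_frac mul0r rmorph0].
      exists (iota a * u + v); split; first exact: (U_sub e).2.
      by rewrite /is_frac mulrDl -mulrA ru sv rmorphD rmorphM.
    (* The module [U e] is finitely generated; a product of elements that suit
       the generators suits all of [U e], and is not in the prime [P]. *)
    have [gs gsP] := RN Iid.
    have [y [ny yP]] : exists y, ~ P y /\ forall r, r \in gs ->
        exists u, is_frac iota D r u /\ U e.+1 (iota y * u).
      have : forall r, r \in gs -> exists u, U e u /\ is_frac iota D r u.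
        by move=> r rg; apply/gsP; exact: in_ideal_mem.
      elim: gs {gsP} => [|r gs IH] h; first by exists 1.
      have [u [Uu ru]] := h r (mem_head _ _); have [y [ny Uy]] := good u Uu.
      have [|y' [ny' y'P]] := IH; first by move=> x xg; apply: h; rewrite inE xg orbT.
      exists (y * y'); split=> [/tprime[]//|x]; rewrite inE => /predU1P[->|/y'P[v [xv Uv]]].
        by exists u; split=> //; rewrite [y * y']mulrC rmorphM -mulrA; exact: submoduleZ Uy.
      by exists v; split=> //; rewrite rmorphM -mulrA; exact: submoduleZ Uv.
    exists y; split=> // g Ug; have [r rg] := U_V0 _ _ Ug.
    have /gsP rI : exists u, U e u /\ is_frac iota D r u by exists g.
    have [u [ru Uu]] : exists u, is_frac iota D r u /\ U e.+1 (iota y * u).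
      apply: (ideal_in (I := fun r => exists u, is_frac iota D r u /\ U e.+1 (iota y * u)) _ yP rI).
      split=> [|a x z [u [xu Uu]] [v [zv Uv]]].
        by exists 0; rewrite /is_frac mul0r rmorph0 mulr0; split=> //; exact: (U_sub _).1.
      exists (iota a * u + v); rewrite /is_frac mulrDl -mulrA xu zv rmorphD rmorphM; split=> //.
      by rewrite mulrDr mulrCA; exact: (U_sub _).2.
    by rewrite (fracI rg ru).
  have /functional_choice[u uP] : forall i, exists u, U (e1 + i)%N u /\
      forall y, ~ P y -> ~ U (e1 + i).+1 (iota y * u) by move=> i; exact: bad.
  have [i|k [c uk]] := @frac_sequence u; first exact: U_V0 (uP i).1.
  (* A relation among [u 0, ..., u k] in which the last coefficient is -1. *)
  pose c' i := if i == k then -1 else c i.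
  have rel : \sum_(i < k.+1) iota (c' i) * u i = 0.
    rewrite big_ord_recr /= /c' eqxx rmorphN1 mulN1r uk; apply/eqP; rewrite subr_eq0; apply/eqP.
    by apply: eq_bigr => i _; rewrite ltn_eqF.
  (* The coefficients are in [P] one after the other: the terms before [j] are
     stable as their coefficients are in [P], and those after [j] are in [U (e1
     + j).+1]. *)
  suff cP j : (j < k.+1)%N -> P (c' j).
    apply: nt1; have := cP k (leqnn _); rewrite /c' eqxx => h.
    by have := Pid.2 (-1) _ _ h Pid.1; rewrite mulrNN mulr1 addr0.
  elim/ltn_ind: j => j IH jk; apply: NNPP => ncj; apply: ((uP j).2 _ ncj).
  have -> : iota (c' j) * u j = \sum_(i < k.+1 | i != Ordinal jk) iota (- c' i) * u i.
    under eq_bigr => i _ do rewrite rmorphN mulNr.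
    by rewrite sumrN; apply/eqP; rewrite -addr_eq0; apply/eqP; rewrite -[RHS]rel [RHS](bigD1 (Ordinal jk)).
  apply: submodule_sum => [|i ij]; first exact: U_sub.
  have [ilj|jli|ije] := ltngtP i j.
  - apply: U_stable; apply: (U_kill (e1 + i)%N) (uP i).1; first exact: leq_addr.
    have := Pid.2 (-1) _ _ (IH _ ilj (ltn_ord i)) Pid.1.
    by rewrite mulN1r addr0.
  - apply: submoduleZ; first exact: U_sub.
    by apply: U_mono (uP i).1; rewrite -addnS leq_add2l.
  by move: ij; rewrite -val_eqE /= ije eqxx.
have killU g : U e g -> stable (iota (y ^+ 2) * g).
  move=> Ug; apply/integral_stable.
  (* By [hz] below, [z i] is [y^2 g] raised to [p^i], up to a power of [y]; the
     exponent [delta i] of [y] that is left is nondecreasing because it starts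
     at 2. *)
  pose z i := iter i (fun x => (iota y * x) ^+ p) g.
  pose delta i := iter i (fun d => p * d.-1)%N 2.
  have zU i : U e (z i) by elim: i => //= i IH; apply: U_exp; exact: yU.
  have delta_ge i : (2 <= delta i)%N.
    by elim: i => //= i IH; have := prime_gt1 p_pr; move: IH; rewrite -/(delta i); nia.
  have delta_mono i j : (i <= j)%N -> (delta i <= delta j)%N.
    move=> /subnK <-; elim: (j - i)%N => // l IH; apply: leq_trans IH _.
    by rewrite addSn /=; have := prime_gt1 p_pr; have := delta_ge (l + i)%N; rewrite -/(delta (l + i)); nia.
  have hz i : (iota (y ^+ 2) * g) ^+ (p ^ i) = iota (y ^+ delta i) * z i.
    elim: i => [|i IH]; first by rewrite expn0 expr1.
    rewrite expnSr exprM IH /= -/(z i) -/(delta i).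
    rewrite -{1}(prednK (ltnW (delta_ge i))) exprSr rmorphM -mulrA exprMn mulnC exprM.
    by rewrite -rmorphXn.
  have [i|k [c zk]] := @frac_sequence z; first exact: U_V0 (zU i).
  apply: (@integral_of_relation _ k (fun i => c i * y ^+ (delta k - delta i))).
  rewrite hz zk mulr_sumr; apply: eq_bigr => i _.
  have dik : (delta i <= delta k)%N by apply: delta_mono; exact: ltnW.
  by rewrite hz [RHS]mulrA -rmorphM -mulrA -exprD (subnK dik) rmorphM mulrCA mulrA.
have : P (y ^+ 2).
  exists e => f Vf; rewrite rmorphM -mulrA; apply: killU.
  by exists f, 0; rewrite addr0; split=> //; exact: stable_submodule.1.
by rewrite expr2 => /tprime[].
Qed.

End NotStable.

Lemma V_stabilizes : exists e0, forall e, (e0 <= e)%N -> forall f, V e f <-> V e0 f.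
Proof.
apply: NNPP => ns; apply: unstable_chain_absurd => e; apply: NNPP => ne; apply: ns.
exists e => e' ee' f; split=> [|Vf]; first exact: V_mono.
by apply: NNPP => nVf; apply: ne; exists f; split=> // sf; apply: nVf; exact: sf.
Qed.

End FrobeniusChain.

(** * Computable functions *)

(** Programs act on binary trees; an encoding transports computability to
    functions between other types. *)
Class Code (T : Type) := enc : T -> data.
#[export] Instance code_data : Code data := id.
#[export] Instance code_nat : Code nat := data_of_nat.
#[export] Instance code_unit : Code unit := fun=> DNil.
#[export] Instance code_bool : Code bool := data_of_bool.
#[export] Instance code_prod (A B : Type) `{Code A} `{Code B} : Code (A * B) :=
  fun x => DCons (enc x.1) (enc x.2).
#[export] Instance code_seq (A : Type) `{Code A} : Code (seq A) :=
  foldr (fun a => DCons (enc a)) DNil.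

Definition computable {X Y : Type} `{Code X} `{Code Y} (f : X -> Y) : Prop :=
  exists P, forall x, eval P (enc x) (enc (f x)).

Section Comp.
Context {X : Type} `{CX : Code X}.

Lemma comp_ext {Y} `{Code Y} (f g : X -> Y) : f =1 g -> computable f -> computable g.
Proof. by move=> fg [P HP]; exists P => x; rewrite -fg. Qed.

Lemma comp_id : computable (fun x : X => x).
Proof. by exists PId => x; apply: EvId. Qed.

Lemma comp_const {Y} `{Code Y} (c : Y) : computable (fun _ : X => c).
Proof.
suff S (d : data) : exists P, forall x, eval P x d.
  by have [P HP] := S (enc c); exists P => x; exact: HP.
elim: d => [|a [P HP] b [Q HQ]]; first by exists PNil => x; apply: EvNil.
by exists (PCons P Q) => x; apply: EvCons.
Qed.

Lemma comp_comp {Y Z} `{Code Y} `{Code Z} (g : Y -> Z) (f : X -> Y) :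
  computable g -> computable f -> computable (fun x => g (f x)).
Proof. by move=> [P HP] [Q HQ]; exists (PComp P Q) => x; apply: EvComp (HQ x) (HP _). Qed.

Lemma comp_pair {Y Z} `{Code Y} `{Code Z} (f : X -> Y) (g : X -> Z) :
  computable f -> computable g -> computable (fun x => (f x, g x)).
Proof. by move=> [P HP] [Q HQ]; exists (PCons P Q) => x; apply: EvCons. Qed.

Lemma comp_fst {Y Z} `{Code Y} `{Code Z} (f : X -> Y * Z) :
  computable f -> computable (fun x => (f x).1).
Proof. by move=> [P HP]; exists (PComp PHd P) => x; apply: EvComp (HP x) (EvHd _). Qed.

Lemma comp_snd {Y Z} `{Code Y} `{Code Z} (f : X -> Y * Z) :
  computable f -> computable (fun x => (f x).2).
Proof. by move=> [P HP]; exists (PComp PTl P) => x; apply: EvComp (HP x) (EvTl _). Qed.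

Lemma comp_hd (f : X -> data) : computable f -> computable (fun x => hd (f x)).
Proof. by move=> [P HP]; exists (PComp PHd P) => x; apply: EvComp (HP x) (EvHd _). Qed.

Lemma comp_tl (f : X -> data) : computable f -> computable (fun x => tl (f x)).
Proof. by move=> [P HP]; exists (PComp PTl P) => x; apply: EvComp (HP x) (EvTl _). Qed.

Lemma comp_dcons (f g : X -> data) : computable f -> computable g -> computable (fun x => DCons (f x) (g x)).
Proof. by move=> [P HP] [Q HQ]; exists (PCons P Q) => x; apply: EvCons. Qed.

Lemma comp_cons {Y} `{Code Y} (f : X -> Y) (g : X -> seq Y) :
  computable f -> computable g -> computable (fun x => f x :: g x).
Proof. by move=> [P HP] [Q HQ]; exists (PCons P Q) => x; apply: EvCons. Qed.

Lemma comp_items (f : X -> data) : computable f -> computable (fun x => items (f x)).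
Proof.
move=> [P HP]; exists P => x; have -> : enc (items (f x)) = f x; last exact: HP.
by elim: (f x) => //= a _ b IH; rewrite -[in RHS]IH.
Qed.

Lemma comp_if {Y} `{Code Y} (c : X -> bool) (f g : X -> Y) :
  computable c -> computable f -> computable g -> computable (fun x => if c x then f x else g x).
Proof.
move=> [C HC] [P HP] [Q HQ]; exists (PIf C P Q) => x; have := HC x.
by case: (c x) => h; [apply: EvIfT h (HP x) | apply: EvIfF h (HQ x)].
Qed.

Lemma comp_S (f : X -> nat) : computable f -> computable (fun x => (f x).+1).
Proof. by move=> [P HP]; exists (PCons PNil P) => x; apply: EvCons (EvNil _) (HP x). Qed.

Lemma comp_pred (f : X -> nat) : computable f -> computable (fun x => (f x).-1).
Proof.
move=> [P HP]; exists (PComp PTl P) => x; have := EvComp (HP x) (EvTl _).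
by case: (f x).
Qed.

Lemma comp_eq0 (f : X -> nat) : computable f -> computable (fun x => f x == 0%N).
Proof.
move=> [P HP]; exists (PIf P PNil (PCons PNil PNil)) => x; have := HP x.
case: (f x) => [|k] h; first by apply: EvIfF h _; apply: EvCons; apply: EvNil.
by apply: EvIfT h _; apply: EvNil.
Qed.

Lemma comp_nilp {Y} `{Code Y} (f : X -> seq Y) : computable f -> computable (fun x => nilp (f x)).
Proof.
move=> [P HP]; exists (PIf P PNil (PCons PNil PNil)) => x; have := HP x.
case: (f x) => [|a l] h; first by apply: EvIfF h _; apply: EvCons; apply: EvNil.
by apply: EvIfT h _; apply: EvNil.
Qed.

Lemma comp_behead {Y} `{Code Y} (f : X -> seq Y) : computable f -> computable (fun x => behead (f x)).
Proof.
move=> [P HP]; exists (PComp PTl P) => x; have := EvComp (HP x) (EvTl _).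
by case: (f x).
Qed.

Lemma comp_head {Y} `{Code Y} (d : X -> Y) (f : X -> seq Y) : computable d -> computable f ->
  computable (fun x => head (d x) (f x)).
Proof.
move=> [D HD] [P HP]; exists (PIf P (PComp PHd P) D) => x; have := HP x.
case: (f x) => [|a l] h; first by apply: EvIfF h (HD x).
have h' : eval P (enc x) (DCons (enc a) (enc l)) := h.
exact: (EvIfT _ h' (EvComp h' (EvHd _))).
Qed.

(** The number [k] of iterations only has to exist. *)
Lemma comp_while {S} `{Code S} (cond : S -> bool) (step : S -> S) (a : X -> S) (k : X -> nat) :
  computable cond -> computable step -> computable a ->
  (forall x, ~~ cond (iter (k x) step (a x))) ->
  (forall x j, (j < k x)%N -> cond (iter j step (a x))) ->
  computable (fun x => iter (k x) step (a x)).
Proof.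
move=> [C HC] [P HP] [A HA] kend klt; exists (PComp (PWhile C P) A) => x.
apply: EvComp (HA x) _; move: (kend x) (klt x).
elim: (k x) (a x) => [|j IH] s hend hlt.
  by apply: EvWhileF; have := HC s; rewrite (negbTE hend).
rewrite iterSr; apply: (@EvWhileT _ _ _ DNil DNil _ _ _ (HP s)).
  by have := HC s; rewrite (hlt 0%N isT).
by apply: IH => [|i ij]; rewrite -iterSr //; apply: hlt.
Qed.

End Comp.

Ltac comp_basic := repeat lazymatch goal with
  | |- @computable _ _ _ _ (fun x => x) => exact: comp_id
  | |- @computable _ _ _ _ (fun x => (@?f x).1) => apply: comp_fst
  | |- @computable _ _ _ _ (fun x => (@?f x).2) => apply: comp_snd
  | |- @computable _ _ _ _ (fun x => (@?f x, @?g x)) => apply: comp_pair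
  | |- @computable _ _ _ _ (fun x => @?f x :: @?g x) => apply: comp_cons
  | |- @computable _ _ _ _ (fun _ => ?c) => exact: comp_const
  | |- @computable _ _ _ _ (fun x => _) => fail
  | |- @computable ?X _ _ _ ?g => change (computable (fun x : X => g x))
  end.

Lemma comp_case {X I Y} `{Code X} `{Code I} `{Code Y} (l : X -> seq I)
    (f : X -> I -> seq I -> Y) (g : X -> Y) :
  computable l -> computable (fun z : X * (I * seq I) => f z.1 z.2.1 z.2.2) -> computable g ->
  computable (fun x => if l x is i :: l' then f x i l' else g x).
Proof.
move=> [L HL] [F HF] [G HG]; exists (PIf L (PComp F (PCons PId L)) G) => x.
have := HL x; case: (l x) => [|i l'] h; first by apply: EvIfF h (HG x).
have h' : eval L (enc x) (DCons (enc i) (enc l')) := h.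
by apply: (EvIfT _ h'); apply: EvComp (EvCons (EvId _) h') (HF (x, (i, l'))).
Qed.

(** The loop carries the environment, the accumulator and the rest of the list. *)
Lemma comp_foldl {X A I} `{Code X} `{Code A} `{Code I} (f : X -> A -> I -> A)
    (a : X -> A) (l : X -> seq I) :
  computable l -> computable a -> computable (fun z : X * (A * I) => f z.1 z.2.1 z.2.2) ->
  computable (fun x => foldl (f x) (a x) (l x)).
Proof.
move=> cl ca cf.
pose step (s : X * (A * seq I)) :=
  if s.2.2 is i :: l' then (s.1, (f s.1 s.2.1 i, l')) else s.
have cstep : computable step.
  apply: (@comp_case _ _ _ _ _ _ (fun s : X * (A * seq I) => s.2.2)
     (fun s i l' => (s.1, (f s.1 s.2.1 i, l'))) id).
  - by comp_basic.
  - apply: comp_pair; first by comp_basic.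
    apply: comp_pair; last by comp_basic.
    apply: (comp_comp (f := fun z => (z.1.1, (z.1.2.1, z.2.1))) cf); apply: comp_pair; first by comp_basic.
    apply: comp_pair; first by comp_basic.
    by comp_basic.
  exact: comp_id.
have iterE j x b k : (j <= size k)%N ->
    iter j step (x, (b, k)) = (x, (foldl (f x) b (take j k), drop j k)).
  elim: j b k => [|j IH] b k; first by rewrite take0 drop0.
  case: k => // i k jk; rewrite iterSr /= [step _]/= -/(step _).
  by rewrite -IH.
have : computable (fun x => iter (size (l x)) step (x, (a x, l x))).
  apply: (@comp_while _ _ _ _ (fun s => ~~ nilp s.2.2) step).
  - apply: comp_if; [|exact: comp_const..].
    by apply: comp_nilp; comp_basic.
  - exact: cstep.
  - by apply: comp_pair; [exact: comp_id | exact: comp_pair].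
  - by move=> x; rewrite iterE //= drop_size.
  move=> x j jl; rewrite iterE 1?ltnW //= /nilp size_drop subn_eq0 -ltnNge.
  exact: jl.
move=> h; have := comp_fst (comp_snd h); apply: comp_ext => x.
by rewrite iterE // take_size.
Qed.

Lemma comp_rev {X} `{Code X} {I} `{Code I} (l : X -> seq I) : computable l -> computable (fun x => rev (l x)).
Proof.
move=> cl; apply: (@comp_ext _ _ _ _ (fun x => foldl (fun s i => i :: s) [::] (l x))) => [x|].
  by rewrite -[l x in LHS]revK foldl_rev; elim: (rev _) => //= i s ->.
apply: comp_foldl => //; first exact: comp_const.
by apply: comp_cons; [comp_basic | comp_basic].
Qed.

Lemma comp_foldr {X} `{Code X} {A I} `{Code A} `{Code I} (f : X -> I -> A -> A) (a : X -> A) (l : X -> seq I) :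
  computable l -> computable a -> computable (fun z : X * (I * A) => f z.1 z.2.1 z.2.2) ->
  computable (fun x => foldr (f x) (a x) (l x)).
Proof.
move=> cl ca cf.
apply: (@comp_ext _ _ _ _ (fun x => foldl (fun s i => f x i s) (a x) (rev (l x)))) => [x|].
  by rewrite foldl_rev.
apply: comp_foldl => //; first exact: comp_rev.
apply: (comp_comp (f := fun z => (z.1, (z.2.2, z.2.1))) cf); apply: comp_pair; first by comp_basic.
by apply: comp_pair; [comp_basic | comp_basic].
Qed.

Lemma comp_map {X} `{Code X} {I J} `{Code I} `{Code J} (f : X -> I -> J) (l : X -> seq I) :
  computable l -> computable (fun z : X * I => f z.1 z.2) -> computable (fun x => map (f x) (l x)).
Proof.
move=> cl cf; apply: (@comp_ext _ _ _ _ (fun x => foldr (fun i s => f x i :: s) [::] (l x))) => [x|].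
  by elim: (l x) => //= i s ->.
apply: comp_foldr => //; first exact: comp_const.
apply: comp_cons; last by comp_basic.
apply: (comp_comp (f := fun z => (z.1, z.2.1)) cf); apply: comp_pair; first by comp_basic.
by comp_basic.
Qed.

Lemma comp_cat {X} `{Code X} {I} `{Code I} (k l : X -> seq I) :
  computable k -> computable l -> computable (fun x => k x ++ l x).
Proof.
move=> ck cl; apply: (@comp_ext _ _ _ _ (fun x => foldr cons (l x) (k x))) => [x|].
  by elim: (k x) => //= i s ->.
apply: (@comp_foldr _ _ _ _ _ _ (fun _ => cons)) => //.
by apply: comp_cons; [comp_basic | comp_basic].
Qed.

Lemma comp_flatten {X} `{Code X} {I} `{Code I} (l : X -> seq (seq I)) :
  computable l -> computable (fun x => flatten (l x)).
Proof.
move=> cl; apply: (@comp_foldr _ _ _ _ _ _ (fun _ => cat) (fun _ => [::]) l) => //; first exact: comp_const.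
by apply: comp_cat; comp_basic.
Qed.

Lemma comp_filter {X} `{Code X} {I} `{Code I} (f : X -> I -> bool) (l : X -> seq I) :
  computable l -> computable (fun z : X * I => f z.1 z.2) -> computable (fun x => filter (f x) (l x)).
Proof.
move=> cl cf; apply: (@comp_ext _ _ _ _ (fun x => foldr (fun i s => if f x i then i :: s else s) [::] (l x))) => [x|].
  by elim: (l x) => //= i s ->.
apply: comp_foldr => //; first exact: comp_const.
apply: comp_if; [|apply: comp_cons|].
- apply: (comp_comp (f := fun z => (z.1, z.2.1)) cf); apply: comp_pair; first by comp_basic.
  by comp_basic.
- by comp_basic.
- by comp_basic.
by comp_basic.
Qed.

Lemma comp_andb {X} `{Code X} (f g : X -> bool) : computable f -> computable g -> computable (fun x => f x && g x).
Proof. by move=> cf cg; apply: comp_if => //; exact: comp_const. Qed.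

Lemma comp_orb {X} `{Code X} (f g : X -> bool) : computable f -> computable g -> computable (fun x => f x || g x).
Proof. by move=> cf cg; apply: comp_if => //; exact: comp_const. Qed.

Lemma comp_negb {X} `{Code X} (f : X -> bool) : computable f -> computable (fun x => ~~ f x).
Proof. by move=> cf; apply: comp_if => //; exact: comp_const. Qed.

Lemma comp_all {X} `{Code X} {I} `{Code I} (f : X -> I -> bool) (l : X -> seq I) :
  computable l -> computable (fun z : X * I => f z.1 z.2) -> computable (fun x => all (f x) (l x)).
Proof.
move=> cl cf; apply: (@comp_foldr _ _ _ _ _ _ (fun x i b => f x i && b) (fun=> true)) => //; first exact: comp_const.
apply: comp_andb; last by comp_basic.
apply: (comp_comp (f := fun z => (z.1, z.2.1)) cf); apply: comp_pair; first by comp_basic.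
by comp_basic.
Qed.

Lemma comp_has {X} `{Code X} {I} `{Code I} (f : X -> I -> bool) (l : X -> seq I) :
  computable l -> computable (fun z : X * I => f z.1 z.2) -> computable (fun x => has (f x) (l x)).
Proof.
move=> cl cf; apply: (@comp_foldr _ _ _ _ _ _ (fun x i b => f x i || b) (fun=> false)) => //; first exact: comp_const.
apply: comp_orb; last by comp_basic.
apply: (comp_comp (f := fun z => (z.1, z.2.1)) cf); apply: comp_pair; first by comp_basic.
by comp_basic.
Qed.

Lemma comp_size {X} `{Code X} {I} `{Code I} (l : X -> seq I) : computable l -> computable (fun x => size (l x)).
Proof.
move=> cl; apply: (@comp_ext _ _ _ _ (fun x => foldr (fun _ => succn) 0%N (l x))) => [x|].
  by elim: (l x) => //= i s ->.
apply: (@comp_foldr _ _ _ _ _ _ (fun _ _ => succn)) => //; first exact: comp_const.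
by apply: comp_S; comp_basic.
Qed.

Lemma comp_nat_of_data {X} `{Code X} (f : X -> data) : computable f -> computable (fun x => nat_of_data (f x)).
Proof. by move=> cf; apply/comp_size/comp_items. Qed.

(** The unary encoding of a number is also the encoding of a list of that
    length; loops over lists thus give loops over numbers. *)
Lemma comp_units {X} `{Code X} (n : X -> nat) : computable n -> computable (fun x => nseq (n x) tt).
Proof.
move=> [P HP]; exists P => x; have -> : enc (nseq (n x) tt) = enc (n x) by elim: (n x) => //= k IH; congr DCons; exact: IH.
exact: HP.
Qed.

Lemma comp_iter {X} `{Code X} {A} `{Code A} (n : X -> nat) (f : X -> A -> A) (a : X -> A) :
  computable n -> computable a -> computable (fun z : X * A => f z.1 z.2) ->
  computable (fun x => iter (n x) (f x) (a x)).
Proof.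
move=> cn ca cf; apply: (@comp_ext _ _ _ _ (fun x => foldr (fun _ => f x) (a x) (nseq (n x) tt))) => [x|].
  by elim: (n x) => //= k ->.
apply: (@comp_foldr _ _ _ _ _ _ (fun x _ => f x)) => //; first exact: comp_units.
by apply: (comp_comp (f := fun z => (z.1, z.2.2)) cf); apply: comp_pair; [comp_basic | comp_basic].
Qed.

Lemma comp_addn {X} `{Code X} (m n : X -> nat) : computable m -> computable n -> computable (fun x => m x + n x)%N.
Proof.
move=> cm cn; apply: (@comp_ext _ _ _ _ (fun x => iter (m x) succn (n x))) => [x|]; first by rewrite iter_succn addnC.
by apply: (@comp_iter _ _ _ _ _ (fun=> succn)) => //; apply: comp_S; comp_basic.
Qed.

Lemma comp_subn {X} `{Code X} (m n : X -> nat) : computable m -> computable n -> computable (fun x => m x - n x)%N.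
Proof.
move=> cm cn; apply: (@comp_ext _ _ _ _ (fun x => iter (n x) predn (m x))) => [x|]; first by rewrite iter_predn.
by apply: (@comp_iter _ _ _ _ _ (fun=> predn)) => //; apply: comp_pred; comp_basic.
Qed.

Lemma comp_muln {X} `{Code X} (m n : X -> nat) : computable m -> computable n -> computable (fun x => m x * n x)%N.
Proof.
move=> cm cn; apply: (@comp_ext _ _ _ _ (fun x => iter (m x) (addn (n x)) 0%N)) => [x|]; first by rewrite iter_addn_0 mulnC.
apply: (@comp_iter _ _ _ _ _ (fun x => addn (n x))) => //; first exact: comp_const.
by apply: comp_addn; [apply: (comp_comp (f := fun z => z.1) cn); comp_basic | comp_basic].
Qed.

Lemma comp_expn {X} `{Code X} (m n : X -> nat) : computable m -> computable n -> computable (fun x => m x ^ n x)%N.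
Proof.
move=> cm cn; apply: (@comp_ext _ _ _ _ (fun x => iter (n x) (muln (m x)) 1%N)) => [x|].
  by elim: (n x) => //= k ->; rewrite expnS.
apply: (@comp_iter _ _ _ _ _ (fun x => muln (m x))) => //; first exact: comp_const.
by apply: comp_muln; [apply: (comp_comp (f := fun z => z.1) cm); comp_basic | comp_basic].
Qed.

Lemma comp_eqn {X} `{Code X} (m n : X -> nat) : computable m -> computable n -> computable (fun x => m x == n x).
Proof.
move=> cm cn; apply: (@comp_ext _ _ _ _ (fun x => (m x - n x) + (n x - m x) == 0)%N) => [x|].
  by rewrite addn_eq0 !subn_eq0 -eqn_leq.
by apply: comp_eq0; apply: comp_addn; apply: comp_subn.
Qed.

Lemma comp_nth {X} `{Code X} {I} `{Code I} (d : I) (l : X -> seq I) (n : X -> nat) :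
  computable l -> computable n -> computable (fun x => nth d (l x) (n x)).
Proof.
move=> cl cn; apply: (@comp_ext _ _ _ _ (fun x => head d (iter (n x) behead (l x)))) => [x|].
  by elim: (n x) (l x) => [|k IH] [|i s] //; rewrite iterSr IH //= nth_nil.
apply: comp_head; first exact: comp_const.
by apply: (@comp_iter _ _ _ _ _ (fun=> behead)) => //; apply: comp_behead; comp_basic.
Qed.

Lemma comp_iota {X} `{Code X} (m n : X -> nat) : computable m -> computable n -> computable (fun x => iota (m x) (n x)).
Proof.
move=> cm cn; apply: (@comp_ext _ _ _ _ (fun x => map (addn (m x)) (iter (n x) (fun s => 0%N :: map succn s) [::]))) => [x|].
  rewrite -[m x in RHS]addn0 iotaDl; congr map.
  by elim: (n x) => //= k ->; rewrite -[1%N]/(1 + 0)%N iotaDl; congr cons; apply: eq_map.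
apply: (@comp_map _ _ _ _ _ _ (fun x => addn (m x))); last first.
  by apply: comp_addn; [apply: (comp_comp (f := fun z => z.1) cm); comp_basic | comp_basic].
apply: comp_iter => //; first exact: comp_const.
apply: comp_cons; first exact: comp_const.
apply: (@comp_map _ _ _ _ _ _ (fun=> succn)); first by comp_basic.
by apply: comp_S; comp_basic.
Qed.

Lemma comp_sumn {X} `{Code X} (l : X -> seq nat) : computable l -> computable (fun x => sumn (l x)).
Proof.
move=> cl; apply: (@comp_foldr _ _ _ _ _ _ (fun _ => addn)) => //; first exact: comp_const.
by apply: comp_addn; [comp_basic | comp_basic].
Qed.

Ltac comp_user := fail.
(** Computability is proved by following the syntax of the function. The hook
    [comp_user] is redefined as new functions are shown to be computable. *)
Ltac comp_one :=
  lazymatch goal with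
  | |- @computable _ _ _ _ (fun x => x) => exact: comp_id
  | |- @computable _ _ _ _ (fun _ => ?c) => exact: comp_const
  | |- @computable _ _ _ _ (fun x => (@?f x).1) => apply: comp_fst
  | |- @computable _ _ _ _ (fun x => (@?f x).2) => apply: comp_snd
  | |- @computable _ _ _ _ (fun x => (@?f x, @?g x)) => apply: comp_pair
  | |- @computable _ _ _ _ (fun x => @?f x :: @?g x) => apply: comp_cons
  | |- @computable _ _ _ _ (fun x => DCons (@?f x) (@?g x)) => apply: comp_dcons
  | |- @computable _ _ _ _ (fun x => hd (@?f x)) => apply: comp_hd
  | |- @computable _ _ _ _ (fun x => tl (@?f x)) => apply: comp_tl
  | |- @computable _ _ _ _ (fun x => items (@?f x)) => apply: comp_items
  | |- @computable _ _ _ _ (fun x => nat_of_data (@?f x)) => apply: comp_nat_of_data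
  | |- @computable _ _ _ _ (fun x => if _ then _ else _) => apply: comp_if
  | |- @computable _ _ _ _ (fun x => ~~ @?f x) => apply: comp_negb
  | |- @computable _ _ _ _ (fun x => @?f x && @?g x) => apply: comp_andb
  | |- @computable _ _ _ _ (fun x => @?f x || @?g x) => apply: comp_orb
  | |- @computable _ _ _ _ (fun x => foldl (@?f x) (@?a x) (@?l x)) => apply: (@comp_foldl _ _ _ _ _ _ f a l)
  | |- @computable _ _ _ _ (fun x => foldr (@?f x) (@?a x) (@?l x)) => apply: (@comp_foldr _ _ _ _ _ _ f a l)
  | |- @computable _ _ _ _ (fun x => map (@?f x) (@?l x)) => apply: (@comp_map _ _ _ _ _ _ f l)
  | |- @computable _ _ _ _ (fun x => filter (@?f x) (@?l x)) => apply: (@comp_filter _ _ _ _ f l)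
  | |- @computable _ _ _ _ (fun x => all (@?f x) (@?l x)) => apply: (@comp_all _ _ _ _ f l)
  | |- @computable _ _ _ _ (fun x => has (@?f x) (@?l x)) => apply: (@comp_has _ _ _ _ f l)
  | |- @computable _ _ _ _ (fun x => iter (@?n x) (@?f x) (@?a x)) => apply: (@comp_iter _ _ _ _ n f a)
  | |- @computable _ _ _ _ (fun x => @?f x ++ @?g x) => apply: comp_cat
  | |- @computable _ _ _ _ (fun x => flatten (@?f x)) => apply: comp_flatten
  | |- @computable _ _ _ _ (fun x => size (@?f x)) => apply: comp_size
  | |- @computable _ _ _ _ (fun x => sumn (@?f x)) => apply: comp_sumn
  | |- @computable _ _ _ _ (fun x => iota (@?f x) (@?g x)) => apply: comp_iota
  | |- @computable _ _ _ _ (fun x => nth ?d (@?f x) (@?g x)) => apply: comp_nth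
  | |- @computable _ _ _ _ (fun x => nilp (@?f x)) => apply: comp_nilp
  | |- @computable _ _ _ _ (fun x => behead (@?f x)) => apply: comp_behead
  | |- @computable _ _ _ _ (fun x => head (@?d x) (@?f x)) => apply: comp_head
  | |- @computable _ _ _ _ (fun x => (@?f x).+1) => apply: comp_S
  | |- @computable _ _ _ _ (fun x => (@?f x + @?g x)%N) => apply: comp_addn
  | |- @computable _ _ _ _ (fun x => (@?f x - @?g x)%N) => apply: comp_subn
  | |- @computable _ _ _ _ (fun x => (@?f x * @?g x)%N) => apply: comp_muln
  | |- @computable _ _ _ _ (fun x => (@?f x ^ @?g x)%N) => apply: comp_expn
  | |- @computable _ nat _ _ (fun x => (@?f x).-1) => apply: comp_pred
  | |- @computable _ _ _ _ (fun x => @eq_op _ (@?f x) (@?g x)) => apply: comp_eqn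
  | |- @computable _ _ _ _ (fun x => _) => fail
  | |- @computable ?X _ _ _ ?g => change (computable (fun x : X => g x))
  end.
Ltac comp_hyp :=
  match goal with
  | H : @computable _ _ _ _ ?g |- @computable _ _ _ _ (fun x => ?g (@?f x)) => apply: (comp_comp (f := f) H)
  | H : @computable _ _ _ _ ?g |- @computable _ _ _ _ ?g => exact: H
  | H : @computable _ _ _ _ (fun z => ?g (@fst _ _ z) (@snd _ _ z)) |- @computable _ _ _ _ (fun x => ?g (@?a x) (@?b x)) =>
      let T := fresh in have T := comp_comp (f := fun x => (a x, b x)) H; apply: T
  end.
Ltac comp_auto := repeat (cbn beta zeta; first [comp_hyp | comp_user | comp_one]).

(** * Unbounded search *)

Section Search.
Context {X : Type} `{CX : Code X}.

(** Iterated on the empty list, this enumerates the trees by increasing depth. *)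
Definition deeper (l : seq data) : seq data :=
  DNil :: flatten [seq [seq DCons a b | b <- l] | a <- l].

Lemma deeper_complete d : exists j, forall i, (j <= i)%N -> List.In d (iter i deeper [::]).
Proof.
have inE (T : Type) (f : data -> T) l x : List.In x l -> List.In (f x) (map f l).
  by elim: l => //= y l IH [->|/IH]; [left | right].
elim: d => [|a [j1 IH1] b [j2 IH2]].
  by exists 1%N => -[//|i _]; left.
exists (maxn j1 j2).+1 => -[//|i]; rewrite ltnS geq_max => /andP[/IH1 ha /IH2 hb] /=.
right; move: ha; elim: {1 3}(iter i deeper [::]) => //= x l IH [->|/IH h].
  by apply: List.in_or_app; left; exact: inE.
by apply: List.in_or_app; right.
Qed.

Lemma hasIn (P : data -> bool) l d : List.In d l -> P d -> has P l.
Proof. by elim: l => //= x l IH [->|/IH h] Pd; rewrite ?Pd ?h ?orbT. Qed.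

(** Unbounded search. It is computable since the loop terminates for every [x]. *)
Lemma comp_search (Q : X -> data -> bool) :
  computable (fun z : X * data => Q z.1 z.2) -> (forall x, exists d, Q x d) ->
  exists s : X -> data, computable s /\ forall x, Q x (s x).
Proof.
move=> cQ exQ; have exk x : exists k, has (Q x) (iter k deeper [::]).
  have [d Qd] := exQ x; have [j jP] := deeper_complete d.
  by exists j; apply: hasIn (jP j (leqnn j)) Qd.
pose k x := ex_minn (exk x).
pose step (s : X * seq data) := (s.1, deeper s.2).
have stepE x j : iter j step (x, [::]) = (x, iter j deeper [::]).
  by elim: j => //= j ->.
pose s x := head DNil (filter (Q x) (iter (k x) step (x, [::])).2).
exists s; split=> [|x]; last first.
  rewrite /s stepE /= /k; case: ex_minnP => m + _.
  by elim: (iter m _ _) => //= d l IH; case: ifP.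
have ci : computable (fun x => iter (k x) step (x, [::])).
  apply: (@comp_while _ _ _ _ (fun s => ~~ has (Q s.1) s.2) step).
  - by comp_auto.
  - by rewrite /step /deeper; comp_auto.
  - by comp_auto.
  - by move=> x; rewrite stepE /= /k negbK; case: ex_minnP.
  move=> x j; rewrite stepE /= /k; case: ex_minnP => m _ mmin; apply: contraTN => /mmin.
  by rewrite -leqNgt.
rewrite /s; comp_auto.
Qed.

End Search.

(** * Computing the degree bound *)

Section Stack.

(** The recursion for [row_bound] is not primitive: the bound in [k + 1]
    variables iterates the bound in [k] variables a number of times which
    depends on the argument. It is evaluated with a stack of pending operations.
    The entry [(0, c)] stands for [y |-> (y + 1) c], and [(k + 1, _)] stands for
    [row_bound (k + 1)], which is replaced by the operations of its definition. *)
Definition unwind (s : seq (nat * nat) * nat) : seq (nat * nat) * nat :=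
  let k := (head (0, 0) s.1).1 in
  if k == 0%N then (behead s.1, s.2.+1 * (head (0, 0) s.1).2)%N
  else let c := (s.2.+1 ^ k.-1)%N in let d := (s.2 * c)%N in
    (iter (d + d) (cons (k.-1, 1%N)) ((0, c + d + d + s.2 + 1)%N :: behead s.1), d).

(** The condition on the intermediate states is what [comp_while] asks of a loop
    that runs while the stack is not empty. *)
Definition leads s s' := exists2 j, iter j unwind s = s' &
  forall i, (i < j)%N -> ~~ nilp (iter i unwind s).1.

Lemma leads_refl s : leads s s. Proof. by exists 0%N. Qed.

Lemma leads_trans s1 s2 s3 : leads s1 s2 -> leads s2 s3 -> leads s1 s3.
Proof.
move=> [j1 <- h1] [j2 <- h2]; exists (j2 + j1)%N; first by rewrite iterD.
move=> i ij; have [/h1 //|ji] := ltnP i j1.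
by rewrite -(subnK ji) iterD; apply: h2; rewrite ltn_subLR // addnC.
Qed.

Lemma leads_step s : ~~ nilp s.1 -> leads s (unwind s).
Proof. by move=> h; exists 1%N => // -[]. Qed.

Lemma leads_bound k y s : leads ((k, 1%N) :: s, y) (s, row_bound k y).
Proof.
elim: k y s => [|k IH] y s.
  by have := @leads_step ((0, 1)%N :: s, y) isT; rewrite /unwind /= muln1.
have h := @leads_step ((k.+1, 1%N) :: s, y) isT.
apply: (leads_trans h); rewrite /unwind /= {h}.
set c := (_ ^ k)%N; set d := (y * c)%N.
have it t z s' : leads (iter t (cons (k, 1%N)) s', z) (s', iter t (row_bound k) z).
  elim: t z => [|t IHt] z; first exact: leads_refl.
  by apply: (leads_trans (IH _ _)); rewrite iterSr.
apply: (leads_trans (it _ _ _)).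
exact: (@leads_step ((0, _)%N :: s, _) isT).
Qed.

Lemma comp_iter_row_bound {X} `{Code X} (t n y : X -> nat) : computable t -> computable n -> computable y ->
  computable (fun x => iter (t x) (row_bound (n x)) (y x)).
Proof.
move=> ct cn cy; pose a x := (iter (t x) (cons (n x, 1%N)) [::], y x).
have la x : leads (a x) ([::], iter (t x) (row_bound (n x)) (y x)).
  rewrite /a; elim: (t x) (y x) => [|j IH] z; first exact: leads_refl.
  by apply: (leads_trans (leads_bound _ _ _)); rewrite iterSr.
have /functional_choice[k kP] : forall x, exists k, iter k unwind (a x) = ([::], iter (t x) (row_bound (n x)) (y x)) /\
    forall i, (i < k)%N -> ~~ nilp (iter i unwind (a x)).1.
  by move=> x; have [k] := la x; exists k.
have ck : computable (fun x => iter (k x) unwind (a x)).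
  apply: (@comp_while _ _ _ _ (fun s => ~~ nilp s.1) unwind).
  - comp_auto.
  - by rewrite /unwind; comp_auto.
  - by rewrite /a; comp_auto.
  - by move=> x; rewrite (kP x).1.
  by move=> x; exact: (kP x).2.
by apply: comp_ext (comp_snd ck) => x; rewrite (kP x).1.
Qed.

End Stack.

(** * The algorithm *)

(** A sparse polynomial: a list of terms, each made of a representation of the
    coefficient and of the list of exponents. Monomials may be repeated,
    coefficients may represent 0, and exponents may be missing or in excess. *)
Notation tpoly := (seq (data * seq nat)).

Section Algorithm.
Variables (p : nat) (fadd fmul : data -> data -> data) (fopp finv : data -> data).
Variables (feq : data -> data -> bool) (dep : seq data -> bool) (fzero fone : data).
Variable (find : nat * (seq nat * ((tpoly * tpoly) * seq (tpoly * tpoly))) -> data).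

Definition eqmon n (m m' : seq nat) := all (fun i => nth 0%N m i == nth 0%N m' i) (iota 0 n).
Definition madd n (m m' : seq nat) := [seq (nth 0%N m i + nth 0%N m' i)%N | i <- iota 0 n].
Definition coef n (q : tpoly) (m : seq nat) : data :=
  foldr (fun t acc => if eqmon n t.2 m then fadd t.1 acc else acc) fzero q.
Definition pscale c (q : tpoly) : tpoly := [seq (fmul c t.1, t.2) | t <- q].
Definition pmul n (q q' : tpoly) : tpoly :=
  foldr (fun t acc => [seq (fmul t.1 t'.1, madd n t.2 t'.2) | t' <- q'] ++ acc) [::] q.
Definition pone : tpoly := [:: (fone, [::])].
Definition ppow n q k : tpoly := iter k (pmul n q) pone.
Definition fpow c : data := iter p (fmul c) fone.

(** The pair [gw + sum_i (nu_i g_i, nu_i^p w_i)], where the [(g_i, w_i)] are the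
    elements of [ind] and the [nu_i] are represented by the entries of [d]. *)
Definition comb (d : data) (gw : tpoly * tpoly) (ind : seq (tpoly * tpoly)) : tpoly * tpoly :=
  (foldl (fun st hv => (tl st.1, (st.2.1 ++ pscale (hd st.1) hv.1,
                                  st.2.2 ++ pscale (fpow (hd st.1)) hv.2))) (d, gw) ind).2.

Definition coefs n m (ws : seq (tpoly * tpoly)) := [seq coef n hv.2 m | hv <- ws].

(** The property required of the outcome [d] of a search for a relation: if the
    coefficients of the monomial become dependent over the p-th powers when that
    of the new pair is added to the others, which are independent, then [d] is
    such a relation, normalized at the new pair. It holds trivially in the other
    cases, so that the search always succeeds. *)
Definition relation (x : nat * (seq nat * ((tpoly * tpoly) * seq (tpoly * tpoly)))) (d : data) :=
  ~~ dep (coefs x.1 x.2.1 (x.2.2.1 :: x.2.2.2)) || dep (coefs x.1 x.2.1 x.2.2.2) ||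
  feq (coef x.1 (comb d x.2.2.1 x.2.2.2).2 x.2.1) fzero.

(** The first component collects pairs with independent coefficients, and the
    second one pairs in which the coefficient vanishes. *)
Definition kernel_step n m (st : seq (tpoly * tpoly) * seq (tpoly * tpoly)) gw :=
  if dep (coefs n m (gw :: st.1)) then (st.1, comb (find (n, (m, (gw, st.1)))) gw st.1 :: st.2)
  else (gw :: st.1, st.2).
Definition kernel n m (ws : seq (tpoly * tpoly)) :=
  (foldl (kernel_step n m) ([::], [::]) ws).2.

(** Cancels the monomial [m] in [w] by means of the pivot [u]. *)
Definition red n m (u w : tpoly) : tpoly :=
  w ++ pscale (fopp (fmul (coef n w m) (finv (coef n u m)))) u.

Definition pivots n m (us : seq tpoly) := [seq u <- us | ~~ feq (coef n u m) fzero].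

(** Eliminates the monomial [m] from the linear problem given by a list of pairs
    [(g, w)] and a list of vectors [u]. Solutions are the combinations of the
    [g] for which the corresponding combination of the [w], with p-th powers of
    the coefficients, is in the span of the [u]. *)
Definition eliminate n (st : seq (tpoly * tpoly) * seq tpoly) (m : seq nat) :=
  if nilp (pivots n m st.2) then (kernel n m st.1, st.2)
  else ([seq (gw.1, red n m (head [::] (pivots n m st.2)) gw.2) | gw <- st.1],
        [seq red n m (head [::] (pivots n m st.2)) u | u <- st.2]).

Definition box n B : seq (seq nat) :=
  iter n (fun l => flatten [seq [seq k :: m | m <- l] | k <- iota 0 B.+1]) [:: [::]].

Definition multiples n B (gs : seq tpoly) : seq tpoly :=
  flatten [seq [seq pmul n [:: (fone, m)] g | m <- box n B] | g <- gs].

Definition degree (gs : seq tpoly) := sumn [seq sumn t.2 | t <- flatten gs].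

Definition start n B (G J : seq tpoly) :=
  ([seq (g, ppow n g p) | g <- multiples n B G], multiples n B J).

Definition support (st : seq (tpoly * tpoly) * seq tpoly) : seq (seq nat) :=
  [seq t.2 | t <- flatten [seq gw.2 | gw <- st.1] ++ flatten st.2].

(** Once all monomials are eliminated, all combinations are solutions. *)
Definition frobenius_kernel n B (G J : seq tpoly) : seq tpoly :=
  [seq gw.1 | gw <- (foldl (eliminate n) (start n B G J) (support (start n B G J))).1].

(** Generators of [D^(p-1) I_e] together with the relations of [R], if [G]
    generates the lift of [I_e]. *)
Definition twist n (fs : seq tpoly) (d : tpoly) (G : seq tpoly) :=
  fs ++ [seq pmul n (ppow n d p.-1) g | g <- G].

(** One step of the chain. The bound uses the number of terms of [J] as a bound
    for the number of its coefficients. *)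
Definition next n fs d G : seq tpoly :=
  frobenius_kernel n (root_bound p n (degree (G ++ twist n fs d G)) (size (flatten (twist n fs d G))))
    G (twist n fs d G).

Definition parse (d : data) : tpoly :=
  [seq (hd t, [seq nat_of_data k | k <- items (tl t)]) | t <- items d].

(** Starts from the unit ideal, which is [D V_0]. *)
Definition algorithm n fs d e : seq tpoly :=
  iter e (next n [seq parse f | f <- items fs] (parse d)) [:: pone].

Hypotheses (c_add : computable (fun z : data * data => fadd z.1 z.2))
  (c_mul : computable (fun z : data * data => fmul z.1 z.2)) (c_opp : computable fopp) (c_inv : computable finv)
  (c_eq : computable (fun z : data * data => feq z.1 z.2)) (c_dep : computable dep).

Section Comp.
Context {X : Type} `{CX : Code X}.

Lemma comp_eqmon n m m' : computable n -> computable m -> computable m' ->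
  computable (fun x : X => eqmon (n x) (m x) (m' x)).
Proof. by move=> cn cm cm'; rewrite /eqmon; comp_auto. Qed.

Lemma comp_madd n m m' : computable n -> computable m -> computable m' ->
  computable (fun x : X => madd (n x) (m x) (m' x)).
Proof. by move=> cn cm cm'; rewrite /madd; comp_auto. Qed.

Lemma comp_fpow c : computable c -> computable (fun x : X => fpow (c x)).
Proof. by move=> cc; rewrite /fpow; comp_auto. Qed.

End Comp.

Ltac comp_user ::= lazymatch goal with
  | |- @computable _ _ _ _ (fun x => eqmon (@?a x) (@?b x) (@?c x)) => apply: comp_eqmon
  | |- @computable _ _ _ _ (fun x => madd (@?a x) (@?b x) (@?c x)) => apply: comp_madd
  | |- @computable _ _ _ _ (fun x => fpow (@?c x)) => apply: comp_fpow
  end.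

Lemma comp_coef {X} `{Code X} n q m : computable n -> computable q -> computable m ->
  computable (fun x : X => coef (n x) (q x) (m x)).
Proof. by move=> cn cq cm; rewrite /coef; comp_auto. Qed.

Lemma comp_pscale {X} `{Code X} c q : computable c -> computable q -> computable (fun x : X => pscale (c x) (q x)).
Proof. by move=> cc cq; rewrite /pscale; comp_auto. Qed.

Lemma comp_pmul {X} `{Code X} n q q' : computable n -> computable q -> computable q' ->
  computable (fun x : X => pmul (n x) (q x) (q' x)).
Proof. by move=> cn cq cq'; rewrite /pmul; comp_auto. Qed.

Ltac comp_user ::= lazymatch goal with
  | |- @computable _ _ _ _ (fun x => eqmon (@?a x) (@?b x) (@?c x)) => apply: comp_eqmon
  | |- @computable _ _ _ _ (fun x => madd (@?a x) (@?b x) (@?c x)) => apply: comp_madd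
  | |- @computable _ _ _ _ (fun x => fpow (@?c x)) => apply: comp_fpow
  | |- @computable _ _ _ _ (fun x => coef (@?a x) (@?b x) (@?c x)) => apply: comp_coef
  | |- @computable _ _ _ _ (fun x => pscale (@?a x) (@?b x)) => apply: comp_pscale
  | |- @computable _ _ _ _ (fun x => pmul (@?a x) (@?b x) (@?c x)) => apply: comp_pmul
  end.

Lemma comp_ppow {X} `{Code X} n q k : computable n -> computable q -> computable k ->
  computable (fun x : X => ppow (n x) (q x) (k x)).
Proof. by move=> cn cq ck; rewrite /ppow; comp_auto. Qed.

Lemma comp_comb {X} `{Code X} d gw ind : computable d -> computable gw -> computable ind ->
  computable (fun x : X => comb (d x) (gw x) (ind x)).
Proof. by move=> cd cg ci; rewrite /comb; comp_auto. Qed.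

Lemma comp_coefs {X} `{Code X} n m ws : computable n -> computable m -> computable ws ->
  computable (fun x : X => coefs (n x) (m x) (ws x)).
Proof. by move=> cn cm cw; rewrite /coefs; comp_auto. Qed.

Lemma comp_red {X} `{Code X} n m u w : computable n -> computable m -> computable u -> computable w ->
  computable (fun x : X => red (n x) (m x) (u x) (w x)).
Proof. by move=> cn cm cu cw; rewrite /red; comp_auto. Qed.

Lemma comp_pivots {X} `{Code X} n m us : computable n -> computable m -> computable us ->
  computable (fun x : X => pivots (n x) (m x) (us x)).
Proof. by move=> cn cm cu; rewrite /pivots; comp_auto. Qed.

Lemma comp_box {X} `{Code X} n B : computable n -> computable B -> computable (fun x : X => box (n x) (B x)).
Proof. by move=> cn cB; rewrite /box; comp_auto. Qed.

Lemma comp_degree {X} `{Code X} gs : computable gs -> computable (fun x : X => degree (gs x)).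
Proof. by move=> cg; rewrite /degree; comp_auto. Qed.

Lemma comp_parse {X} `{Code X} d : computable d -> computable (fun x : X => parse (d x)).
Proof. by move=> cd; rewrite /parse; comp_auto. Qed.

Ltac comp_user ::= lazymatch goal with
  | |- @computable _ _ _ _ (fun x => coef (@?a x) (@?b x) (@?c x)) => apply: comp_coef
  | |- @computable _ _ _ _ (fun x => pscale (@?a x) (@?b x)) => apply: comp_pscale
  | |- @computable _ _ _ _ (fun x => pmul (@?a x) (@?b x) (@?c x)) => apply: comp_pmul
  | |- @computable _ _ _ _ (fun x => ppow (@?a x) (@?b x) (@?c x)) => apply: comp_ppow
  | |- @computable _ _ _ _ (fun x => comb (@?a x) (@?b x) (@?c x)) => apply: comp_comb
  | |- @computable _ _ _ _ (fun x => coefs (@?a x) (@?b x) (@?c x)) => apply: comp_coefs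
  | |- @computable _ _ _ _ (fun x => red (@?a x) (@?b x) (@?c x) (@?d x)) => apply: comp_red
  | |- @computable _ _ _ _ (fun x => pivots (@?a x) (@?b x) (@?c x)) => apply: comp_pivots
  | |- @computable _ _ _ _ (fun x => box (@?a x) (@?b x)) => apply: comp_box
  | |- @computable _ _ _ _ (fun x => degree (@?a x)) => apply: comp_degree
  | |- @computable _ _ _ _ (fun x => parse (@?a x)) => apply: comp_parse
  | |- @computable _ _ _ _ (fun x => iter (@?t x) (row_bound (@?n x)) (@?y x)) => apply: comp_iter_row_bound
  end.

Lemma comp_relation : computable (fun z => relation z.1 z.2).
Proof. by rewrite /relation; comp_auto. Qed.

Hypothesis c_find : computable find.

Lemma comp_kernel {X} `{Code X} n m ws : computable n -> computable m -> computable ws ->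
  computable (fun x : X => kernel (n x) (m x) (ws x)).
Proof. by move=> cn cm cw; rewrite /kernel /kernel_step; comp_auto. Qed.

Lemma comp_eliminate {X} `{Code X} n st m : computable n -> computable st -> computable m ->
  computable (fun x : X => eliminate (n x) (st x) (m x)).
Proof.
move=> cn cs cm; rewrite /eliminate.
have ck := comp_kernel cn cm (comp_fst cs).
by comp_auto.
Qed.

Lemma comp_multiples {X} `{Code X} n B gs : computable n -> computable B -> computable gs ->
  computable (fun x : X => multiples (n x) (B x) (gs x)).
Proof. by move=> cn cB cg; rewrite /multiples; comp_auto. Qed.

Ltac comp_user ::= lazymatch goal with
  | |- @computable _ _ _ _ (fun x => pmul (@?a x) (@?b x) (@?c x)) => apply: comp_pmul
  | |- @computable _ _ _ _ (fun x => ppow (@?a x) (@?b x) (@?c x)) => apply: comp_ppow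
  | |- @computable _ _ _ _ (fun x => multiples (@?a x) (@?b x) (@?c x)) => apply: comp_multiples
  | |- @computable _ _ _ _ (fun x => degree (@?a x)) => apply: comp_degree
  | |- @computable _ _ _ _ (fun x => parse (@?a x)) => apply: comp_parse
  | |- @computable _ _ _ _ (fun x => eliminate (@?a x) (@?b x) (@?c x)) => apply: comp_eliminate
  | |- @computable _ _ _ _ (fun x => iter (@?t x) (row_bound (@?n x)) (@?y x)) => apply: comp_iter_row_bound
  end.

Lemma comp_start {X} `{Code X} n B G J : computable n -> computable B -> computable G -> computable J ->
  computable (fun x : X => start (n x) (B x) (G x) (J x)).
Proof. by move=> cn cB cG cJ; rewrite /start; comp_auto. Qed.

Lemma comp_support {X} `{Code X} st : computable st -> computable (fun x : X => support (st x)).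
Proof. by move=> cs; rewrite /support; comp_auto. Qed.

Lemma comp_frobenius_kernel {X} `{Code X} n B G J : computable n -> computable B -> computable G -> computable J ->
  computable (fun x : X => frobenius_kernel (n x) (B x) (G x) (J x)).
Proof.
move=> cn cB cG cJ; rewrite /frobenius_kernel.
have cst := comp_start cn cB cG cJ; have csu := comp_support cst.
have : computable (fun x => foldl (eliminate (n x)) (start (n x) (B x) (G x) (J x))
    (support (start (n x) (B x) (G x) (J x)))).
  by apply: comp_foldl => //; comp_auto.
by move=> cf; comp_auto.
Qed.

Lemma comp_root_bound {X} `{Code X} n d k : computable n -> computable d -> computable k ->
  computable (fun x : X => root_bound p (n x) (d x) (k x)).
Proof.
move=> cn cd ck; rewrite /root_bound.
have : computable (fun x => iter (p ^ k x * p ^ n x) (row_bound (n x)) (p * d x + n x * p))%N.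
  by apply: comp_iter_row_bound; comp_auto.
by move=> cb; comp_auto.
Qed.

Lemma comp_twist {X} `{Code X} n fs d G : computable n -> computable fs -> computable d -> computable G ->
  computable (fun x : X => twist (n x) (fs x) (d x) (G x)).
Proof. by move=> cn cf cd cG; rewrite /twist; comp_auto. Qed.

Lemma comp_next {X} `{Code X} n fs d G : computable n -> computable fs -> computable d -> computable G ->
  computable (fun x : X => next (n x) (fs x) (d x) (G x)).
Proof.
move=> cn cf cd cG; rewrite /next; have ct := comp_twist cn cf cd cG.
by apply: comp_frobenius_kernel => //; apply: comp_root_bound; comp_auto.
Qed.

Lemma comp_algorithm :
  computable (fun z : nat * (data * (data * nat)) => algorithm z.1 z.2.1 z.2.2.1 z.2.2.2).
Proof.
rewrite /algorithm; apply: comp_iter; [by comp_auto | by comp_auto |].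
by apply: comp_next; comp_auto.
Qed.

End Algorithm.

(** * Elimination *)

Section PSpan.
Variables (K : fieldType) (p : nat) (V : lmodType K).
Implicit Types (W : seq (V * V)) (U : seq V) (phi psi : {scalar V}).

(** Combinations of pairs in which the second components are multiplied by the
    p-th powers of the coefficients. *)
Inductive pspan W : V -> V -> Prop :=
  | pspan0 : pspan W 0 0
  | pspanD a gw g w : gw \in W -> pspan W g w ->
      pspan W (a *: gw.1 + g) (a ^+ p *: gw.2 + w).

Lemma pspan_add W g w g' w' : pspan W g w -> pspan W g' w' -> pspan W (g + g') (w + w').
Proof.
move=> + h'; elim=> [|a x y z xW _ IH]; first by rewrite !add0r.
by rewrite -!addrA; apply: pspanD.
Qed.

Lemma pspan_scale W a g w : pspan W g w -> pspan W (a *: g) (a ^+ p *: w).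
Proof.
elim=> [|b x y z xW _ IH]; first by rewrite !scaler0; apply: pspan0.
by rewrite !scalerDr !scalerA -exprMn; apply: pspanD.
Qed.

Lemma pspan_mem W gw : gw \in W -> pspan W gw.1 gw.2.
Proof.
move=> gwW; have := pspanD 1 gwW (pspan0 W).
by rewrite expr1n !scale1r !addr0.
Qed.

Lemma pspan_trans W W' g w : (forall gw, gw \in W -> pspan W' gw.1 gw.2) ->
  pspan W g w -> pspan W' g w.
Proof.
move=> WW'; elim=> [|a x y z /WW' xW _ IH]; first exact: pspan0.
by apply: pspan_add IH; apply: pspan_scale.
Qed.

Lemma pspan_zero W phi g w : (forall gw, gw \in W -> phi gw.2 = 0) -> pspan W g w -> phi w = 0.
Proof.
move=> W0; elim=> [|a x y z xW _ IH]; first by rewrite linear0.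
by rewrite linearD linearZ /= W0 // IH mulr0 addr0.
Qed.

Definition uspan U : V -> Prop := span (fun u => u \in U).
(** The first components of the combinations whose second component is in the
    span of [U]. Elimination preserves this set. *)
Definition solvable W U g := exists2 w, pspan W g w & uspan U w.

Lemma uspan_zero U phi w : (forall u, u \in U -> phi u = 0) -> uspan U w -> phi w = 0.
Proof.
move=> U0; elim=> [|a x y xU _ IH]; first by rewrite linear0.
by rewrite linearD linearZ /= U0 // IH mulr0 addr0.
Qed.

Section Gauss.
Variables (W : seq (V * V)) (U : seq V) (phi : {scalar V}) (u0 : V).
Hypotheses (u0U : u0 \in U).
Definition reduce w := w - (phi w / phi u0) *: u0.

Lemma reduceD a x y : reduce (a *: x + y) = a *: reduce x + reduce y.
Proof.
rewrite /reduce linearP /= scalerBr addrACA -opprD scalerA -scalerDl.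
by rewrite mulrDl mulrA.
Qed.

Lemma reduce_sub w : uspan U (w - reduce w).
Proof. by rewrite /reduce opprB addrC subrK; apply: span_scale; apply: span_mem. Qed.

(** Reduction along a pivot [u0] changes second components by multiples of [u0],
    which is in the span of [U]. *)
Lemma gauss_solvable g :
  solvable [seq (gw.1, reduce gw.2) | gw <- W] [seq reduce u | u <- U] g <-> solvable W U g.
Proof.
have r0 : reduce 0 = 0 by rewrite /reduce linear0 mul0r scale0r subrr.
split=> -[w gw uw].
  have [w1 gw1 w1w] : exists2 w1, pspan W g w1 & uspan U (w1 - w).
    elim: gw => {uw} [|a x y z /mapP[x' x'W ->] _ [w1 h1 h2]].
      by exists 0; [exact: pspan0 | rewrite subrr; exact: span0].
    exists (a ^+ p *: x'.2 + w1); first exact: (pspanD a x'W h1).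
    rewrite opprD addrACA -scalerBr; apply: span_add => //.
    by apply: span_scale; exact: reduce_sub.
  exists w1 => //; rewrite -(subrK w w1); apply: span_add => //.
  apply: span_trans uw => _ /mapP[u uU ->]; rewrite -[reduce u](subrK u) -opprB.
  by apply: span_add (span_mem uU); apply/span_opp/reduce_sub.
exists (reduce w); last first.
  by apply: (@span_map _ _ _ _ id reduce _ _ _ r0 reduceD _ uw) => u uU; apply: span_mem; apply: map_f.
elim: gw => {uw} [|a x y z xW _ IH]; first by rewrite r0; apply: pspan0.
rewrite reduceD; have h : (x.1, reduce x.2) \in [seq (gw.1, reduce gw.2) | gw <- W].
  exact: (map_f (fun gw => (gw.1, reduce gw.2)) xW).
exact: (pspanD a h IH).
Qed.

Lemma reduce_zero (psi : {scalar V}) w : psi w = 0 -> psi u0 = 0 -> psi (reduce w) = 0.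
Proof. by rewrite /reduce linearB linearZ /= => -> ->; rewrite mulr0 subrr. Qed.

Lemma reduce_pivot w : phi u0 != 0 -> phi (reduce w) = 0.
Proof. by move=> h; rewrite /reduce linearB linearZ /= divfK // subrr. Qed.

End Gauss.

Lemma pspan_cat W1 W2 g w : pspan (W1 ++ W2) g w ->
  exists g1 w1 g2 w2, [/\ pspan W1 g1 w1, pspan W2 g2 w2, g = g1 + g2 & w = w1 + w2].
Proof.
elim=> [|a x y z xW _ [g1 [w1 [g2 [w2 [h1 h2 -> ->]]]]]].
  by exists 0, 0, 0, 0; rewrite !addr0; split=> //; exact: pspan0.
move: xW; rewrite mem_cat => /orP[xW|xW].
  exists (a *: x.1 + g1), (a ^+ p *: x.2 + w1), g2, w2; split=> //; rewrite -?addrA //.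
  exact: pspanD.
exists g1, w1, (a *: x.1 + g2), (a ^+ p *: x.2 + w2); split=> //; last 2 first.
- by rewrite addrCA.
- by rewrite addrCA.
exact: pspanD.
Qed.

(** The vanishing of [phi] on a combination of [W] is a relation over the p-th
    powers between the values of [phi] on [W]. *)
Lemma pspan_indep W phi g w : (p > 0)%N ->
  (forall x y : K, (x + y) ^+ p = x ^+ p + y ^+ p) ->
  ~ pth_power_dependent p [seq phi gw.2 | gw <- W] ->
  pspan W g w -> phi w = 0 -> g = 0 /\ w = 0.
Proof.
move=> p_gt0 pD nd gw.
have [l [gE wE]] : exists l : 'I_(size W) -> K,
  g = \sum_i l i *: (nth 0 W i).1 /\ w = \sum_i l i ^+ p *: (nth 0 W i).2.
  elim: gw => [|a x y z xW _ [l [-> ->]]].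
    exists (fun=> 0); split; rewrite big1 // => i _; rewrite ?expr0n ?eqn0Ngt ?p_gt0 scale0r //.
  have ix : (index x W < size W)%N by rewrite index_mem.
  exists (fun i => (if i == Ordinal ix then a else 0) + l i); split.
    under [RHS]eq_bigr do rewrite scalerDl.
    rewrite big_split /=; congr (_ + _); rewrite (bigD1 (Ordinal ix)) //= eqxx nth_index //.
    by rewrite big1 ?addr0 // => i /negbTE ->; rewrite scale0r.
  under [RHS]eq_bigr do rewrite pD scalerDl.
  rewrite big_split /=; congr (_ + _); rewrite (bigD1 (Ordinal ix)) //= eqxx nth_index //.
  by rewrite big1 ?addr0 // => i /negbTE ->; rewrite expr0n eqn0Ngt p_gt0 scale0r.
move=> w0; suff l0 i : l i = 0.
  by rewrite gE wE !big1 // => i _; rewrite l0 ?expr0n ?eqn0Ngt ?p_gt0 scale0r.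
apply/eqP; apply/negP => /negP li; apply: nd.
have sW : size [seq phi gw.2 | gw <- W] = size W by rewrite size_map.
exists (fun j => l (cast_ord sW j)); split.
  by exists (cast_ord (esym sW) i); rewrite cast_ordKV.
rewrite -[RHS]w0 wE linear_sum (reindex (cast_ord (esym sW))) /=; last first.
  by exists (cast_ord sW) => j _; rewrite ?cast_ordK ?cast_ordKV.
apply: eq_bigr => j _; rewrite linearZ /= cast_ordKV (nth_map 0) //.
Qed.

(** A solution is a combination of [ind] and [out]. Since [phi] vanishes on [U]
    and on [out], it vanishes on the part in [ind], which is therefore trivial. *)
Lemma kernel_solvable W U ind out phi g : (p > 0)%N ->
  (forall x y : K, (x + y) ^+ p = x ^+ p + y ^+ p) ->
  (forall u, u \in U -> phi u = 0) ->
  (forall gw, gw \in out -> pspan W gw.1 gw.2 /\ phi gw.2 = 0) ->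
  (forall gw, gw \in W -> pspan (ind ++ out) gw.1 gw.2) ->
  ~ pth_power_dependent p [seq phi gw.2 | gw <- ind] ->
  solvable out U g <-> solvable W U g.
Proof.
move=> p_gt0 pD U0 outP Wio nd; split=> -[w gw uw].
  by exists w => //; apply: pspan_trans gw => x /outP[].
have [g1 [w1 [g2 [w2 [h1 h2 gE wE]]]]] := pspan_cat (pspan_trans Wio gw).
have w20 : phi w2 = 0 by apply: pspan_zero h2 => x /outP[].
have w10 : phi w1 = 0.
  by have := uspan_zero U0 uw; rewrite wE linearD /= w20 addr0.
have [g10 w1z] := pspan_indep p_gt0 pD nd h1 w10.
by exists w => //; rewrite gE wE g10 w1z !add0r.
Qed.

End PSpan.

(** * Correctness of the algorithm *)

Lemma pth_power_dependentP (K : fieldType) p (cs : seq K) : pth_power_dependent p cs <->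
  exists l : nat -> K, (exists2 i, (i < size cs)%N & l i != 0) /\
    \sum_(i < size cs) l i ^+ p * cs`_i = 0.
Proof.
split=> [[l [[i li] lE]]|[l [[i ics li] lE]]]; last by exists l; split=> //; exists (Ordinal ics).
exists (fun j => if insub j is Some j' then l j' else 0); split.
  by exists i => //; rewrite valK.
by rewrite -[RHS]lE; apply: eq_bigr => j _; rewrite valK.
Qed.

Section Correct.
Variables (K : fieldType) (rep : data -> K) (p : nat).
Hypothesis char_p : p \in [pchar K].
Let p_pr : prime p := pcharf_prime char_p.
Let p_gt0 : (0 < p)%N := prime_gt0 p_pr.

Variables (fadd fmul : data -> data -> data) (fopp finv : data -> data).
Variables (feq : data -> data -> bool) (dep : seq data -> bool) (fzero fone : data).
Hypotheses (rep_surjective : forall x, exists d, rep d = x)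
  (radd : forall a b, rep (fadd a b) = rep a + rep b)
  (rmul : forall a b, rep (fmul a b) = rep a * rep b)
  (ropp : forall a, rep (fopp a) = - rep a)
  (rinv : forall a, rep a != 0 -> rep (finv a) = (rep a)^-1)
  (req : forall a b, feq a b = (rep a == rep b))
  (rdep : forall l, dep l <-> pth_power_dependent p [seq rep c | c <- l])
  (rzero : rep fzero = 0) (rone : rep fone = 1).

Section Eval.
Variable n : nat.

Definition mon (m : seq nat) : 'X_{1..n} := [multinom nth 0%N m i | i < n].
Definition ev (q : tpoly) : {mpoly K[n]} := \sum_(t <- q) rep t.1 *: 'X_[mon t.2].

Lemma eqmonP m m' : eqmon n m m' = (mon m == mon m').
Proof.
apply/allP/eqP => [h|/mnmP h i].
  apply/mnmP=> i; rewrite !mnmE; apply/eqP/h.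
  by rewrite mem_iota /= add0n ltn_ord.
rewrite mem_iota /= add0n => ni; apply/eqP.
by have := h (Ordinal ni); rewrite !mnmE.
Qed.

Lemma mon_madd m m' : mon (madd n m m') = (mon m + mon m')%MM.
Proof.
apply/mnmP=> i; rewrite mnmDE !mnmE (nth_map 0%N) ?size_iota //.
by rewrite nth_iota // add0n.
Qed.

Lemma ev_nil : ev [::] = 0. Proof. exact: big_nil. Qed.

Lemma ev_cat q q' : ev (q ++ q') = ev q + ev q'.
Proof. exact: big_cat. Qed.

Lemma ev_pscale c q : ev (pscale fmul c q) = rep c *: ev q.
Proof.
rewrite /ev big_map scaler_sumr; apply: eq_bigr => t _ /=.
by rewrite rmul scalerA.
Qed.

Lemma ev_coef q m : rep (coef fadd fzero n q m) = (ev q)@_(mon m).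
Proof.
elim: q => [|t q IH]; first by rewrite ev_nil mcoeff0.
rewrite /= /ev big_cons mcoeffD -/(ev q) -IH mcoeffZ mcoeffX eqmonP.
by case: eqP => _; rewrite ?radd ?mulr1 // mulr0 add0r.
Qed.

Lemma ev_pmul q q' : ev (pmul fmul n q q') = ev q * ev q'.
Proof.
elim: q => [|t q IH]; first by rewrite ev_nil mul0r.
rewrite /= ev_cat IH [ev (t :: q)]big_cons mulrDl -/(ev q); congr (_ + _).
rewrite {1}/ev big_map mulr_sumr; apply: eq_bigr => t' _ /=.
by rewrite rmul mon_madd mpolyXD -scalerAl -scalerAr scalerA.
Qed.

Lemma mon_nil : mon [::] = 0%MM.
Proof. by apply/mnmP=> i; rewrite mnmE nth_nil mnm0E. Qed.

Lemma ev_pone : ev (pone fone) = 1.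
Proof. by rewrite /ev big_seq1 /= rone scale1r mon_nil mpolyX0. Qed.

Lemma ev_ppow q k : ev (ppow fmul fone n q k) = ev q ^+ k.
Proof.
elim: k => [|k IH]; first exact: ev_pone.
by rewrite [ppow _ _ _ _ _]iterS ev_pmul IH exprS.
Qed.

Lemma rep_fpow c : rep (fpow p fmul fone c) = rep c ^+ p.
Proof.
rewrite /fpow; elim: p => [|k IH]; first by rewrite rone expr0.
by rewrite iterS rmul IH exprS.
Qed.

Definition evp (gw : tpoly * tpoly) := (ev gw.1, ev gw.2).

Lemma char_add (x y : K) : (x + y) ^+ p = x ^+ p + y ^+ p.
Proof. by apply: (exprD_char p_pr); apply: pcharf0 char_p. Qed.

Notation combE := (comb p fmul fone).
Notation pspanE := (pspan p (V := {mpoly K[n]})).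

Lemma comb_pspan d gw ind : exists a b, [/\ pspanE [seq evp x | x <- ind] a b,
  ev (combE d gw ind).1 = ev gw.1 + a & ev (combE d gw ind).2 = ev gw.2 + b].
Proof.
rewrite /comb; elim: ind d gw => [|x ind IH] d gw.
  by exists 0, 0; rewrite !addr0; split=> //; apply: pspan0.
rewrite /=; have [a [b [ab -> ->]]] := IH (tl d) (gw.1 ++ pscale fmul (hd d) x.1, gw.2 ++ pscale fmul (fpow p fmul fone (hd d)) x.2).
exists (rep (hd d) *: ev x.1 + a), (rep (hd d) ^+ p *: ev x.2 + b); split.
- apply: (pspanD (rep (hd d)) (gw := evp x)); first by rewrite inE eqxx.
  by apply: pspan_trans ab => y yi; apply: pspan_mem; rewrite inE yi orbT.
- by rewrite /= ev_cat ev_pscale addrA.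
by rewrite /= ev_cat ev_pscale rep_fpow addrA.
Qed.

(** Every element of [K] is represented, so that the entries of [d] can be
    chosen one by one. *)
Lemma comb_coef (nu : nat -> K) gw ind k : exists d,
  (ev (combE d gw ind).2)@_k = (ev gw.2)@_k +
    \sum_(i < size ind) nu i ^+ p * (nth 0 [seq (ev x.2)@_k | x <- ind] i).
Proof.
rewrite /comb; elim: ind nu gw => [|x ind IH] nu gw; first by exists DNil; rewrite big_ord0 addr0.
have [c0 c0E] := rep_surjective (nu 0%N).
have [d dE] := IH (nu \o succn) (gw.1 ++ pscale fmul c0 x.1, gw.2 ++ pscale fmul (fpow p fmul fone c0) x.2).
exists (DCons c0 d); rewrite /= in dE *; rewrite dE ev_cat ev_pscale rep_fpow c0E.
by rewrite mcoeffD mcoeffZ big_ord_recl /= addrA.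
Qed.

End Eval.

Notation relationE := (relation p fadd fmul feq dep fzero fone).

(** The coefficient of the new pair in a dependence relation is not 0, for
    otherwise the relation would concern the others only; dividing by it gives
    the required entries. *)
Lemma relation_exists x : exists d, relationE x d.
Proof.
rewrite /relation; case: (boolP (dep _)) => [/rdep dx|_]; last by exists DNil.
case: (boolP (dep (coefs _ _ _ _ x.2.2.2))) => [_|ndx]; first by exists DNil; rewrite orbT.
rewrite orbF /=; case: x dx ndx => n [m [gw ind]] /= dx /negP ndx.
pose v := [seq (ev n y.2)@_(mon n m) | y <- ind].
have vE : [seq rep c | c <- coefs fadd fzero n m ind] = v.
  by rewrite -map_comp; apply: eq_map => y /=; rewrite ev_coef.
have sz : size v = size ind by rewrite size_map.
have /pth_power_dependentP[l [[i ics li]]] := dx.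
rewrite /= -/(coefs _ _ _ _ _) vE ev_coef /= in ics *.
rewrite big_ord_recl /= => lE.
have l00 : l 0%N != 0.
  apply/eqP => l0; apply: ndx; apply/rdep; rewrite vE; apply/pth_power_dependentP.
  exists (l \o succn); split; last first.
    by rewrite -[RHS]lE l0 expr0n eqn0Ngt p_gt0 mul0r add0r.
  by case: i ics li => [|i ics li]; [rewrite l0 eqxx | exists i].
have [d dE] := comb_coef (fun i => l i.+1 / l 0%N) gw ind (mon n m); exists d.
rewrite req ev_coef rzero dE -/v; apply/eqP.
apply: (mulfI (expf_neq0 p l00)); rewrite mulr0 -[RHS]lE mulrDr; congr (_ + _).
rewrite mulr_sumr sz; apply: eq_bigr => j _.
by rewrite exprMn exprVn mulrA mulrCA mulfV ?mulr1 ?expf_neq0.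
Qed.

Variable find : nat * (seq nat * ((tpoly * tpoly) * seq (tpoly * tpoly))) -> data.
Hypothesis find_relation : forall x, relationE x (find x).

Section Elimination.
Variable n : nat.
Notation pspanE := (pspan p (V := {mpoly K[n]})).
Notation L := (map (evp n)).

Lemma pspan_sub (W W' : seq ({mpoly K[n]} * {mpoly K[n]})) g w : {subset W <= W'} ->
  pspanE W g w -> pspanE W' g w.
Proof. by move=> WW'; apply: pspan_trans => x /WW'; exact: pspan_mem. Qed.

Lemma coefsE m ws : [seq rep c | c <- coefs fadd fzero n m ws] = [seq gw.2@_(mon n m) | gw <- L ws].
Proof. by rewrite -!map_comp; apply: eq_map => y /=; rewrite ev_coef. Qed.

(** What [kernel_solvable] asks of the two lists produced by the loop,
    relatively to the pairs [W] that have been scanned. *)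
Definition kernel_invariant m (st : seq (tpoly * tpoly) * seq (tpoly * tpoly)) W :=
  [/\ forall gw, gw \in L st.1 -> pspanE W gw.1 gw.2,
      forall gw, gw \in L st.2 -> pspanE W gw.1 gw.2 /\ gw.2@_(mon n m) = 0,
      forall gw, gw \in W -> pspanE (L st.1 ++ L st.2) gw.1 gw.2 &
      ~ pth_power_dependent p [seq gw.2@_(mon n m) | gw <- L st.1]].

Lemma kernel_step_invariant m st W gw : kernel_invariant m st W ->
  kernel_invariant m (kernel_step p fadd fmul dep fzero fone find n m st gw) (rcons W (evp n gw)).
Proof.
case: st => ind out [/= iW oW Wio nd].
have subW : {subset W <= rcons W (evp n gw)} by move=> x xW; rewrite mem_rcons inE xW orbT.
have gwW : pspanE (rcons W (evp n gw)) (ev n gw.1) (ev n gw.2).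
  by apply: (@pspan_mem _ _ _ _ (evp n gw)); rewrite mem_rcons inE eqxx.
rewrite /kernel_step /=; case: ifP => [dep1|/negP ndep].
  set d := find _; have [a [b [ab e1 e2]]] := comb_pspan n d gw ind.
  split=> //= [x xi|x|x].
  - by apply: pspan_sub (iW _ xi).
  - rewrite inE => /predU1P[->|xo]; last by have [h1 h2] := oW _ xo; split=> //; apply: pspan_sub h1.
    split; first rewrite /= e1 e2.
      by apply: pspan_add gwW _; apply: pspan_trans ab => y yi; apply: pspan_sub (iW _ yi).
    have := find_relation (n, (m, (gw, ind))).
    rewrite /relation /= -/(coefs _ _ _ _ _) dep1 /= req rzero ev_coef => /orP[/rdep|/eqP //].
    by rewrite coefsE.
  - rewrite mem_rcons inE => /predU1P[->|xW]; last first.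
      by apply: pspan_sub (Wio _ xW) => y; rewrite !mem_cat inE => /orP[->|->]; rewrite ?orbT.
    have -> : (evp n gw).1 = ev n (comb p fmul fone d gw ind).1 - a by rewrite e1 addrK.
    have -> : (evp n gw).2 = ev n (comb p fmul fone d gw ind).2 - b by rewrite e2 addrK.
    apply: pspan_add.
      by apply: (@pspan_mem _ _ _ _ (evp n _)); rewrite mem_cat inE eqxx orbT.
    rewrite -[- a]scaleN1r.
    have -> : - b = (-1) ^+ p *: b.
      by rewrite (exprN_char p_pr) ?expr1n ?scaleN1r // (pcharf0 char_p).
    apply: pspan_scale; apply: pspan_sub ab => y yi; by rewrite mem_cat yi.
split=> //= [x|x xo|x|].
- by rewrite inE => /predU1P[->|xi] //; apply: pspan_sub (iW _ xi).
- by have [h1 h2] := oW _ xo; split=> //; apply: pspan_sub h1.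
- rewrite mem_rcons inE => /predU1P[->|xW].
    by apply: pspan_mem; rewrite inE eqxx.
  by apply: pspan_sub (Wio _ xW) => y; rewrite inE orbC => ->.
move=> pd; apply: ndep; apply/rdep.
by have := coefsE m (gw :: ind); rewrite /= => ->.
Qed.

Notation kernelE := (kernel p fadd fmul dep fzero fone find n).
Notation elimE := (eliminate p fadd fmul fopp finv feq dep fzero fone find n).

Lemma kernelP m ws : exists ind, kernel_invariant m (ind, kernelE m ws) (L ws).
Proof.
rewrite /kernel; set step := kernel_step _ _ _ _ _ _ _ _ _.
have : kernel_invariant m ([::], [::]) [::].
  split=> //; move/pth_power_dependentP => [l [[i]]]; by rewrite ltn0.
rewrite -[L ws]cat0s; move: ([::], [::]) => st; move: {1 2}[::] => W.
elim: ws st W => [|gw ws IH] st W h /=.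
  by rewrite cats0; exists st.1; rewrite -surjective_pairing.
by rewrite -cat_rcons; apply: IH; apply: kernel_step_invariant.
Qed.

Notation U_of := (map (ev n)).

Definition zero_at k (st : seq (tpoly * tpoly) * seq tpoly) :=
  (forall gw, gw \in L st.1 -> gw.2@_k = 0) /\ forall u, u \in U_of st.2 -> u@_k = 0.

Lemma ev_red m u w : rep (coef fadd fzero n u m) != 0 ->
  ev n (red fadd fmul fopp finv fzero n m u w) = reduce (mcoeff (mon n m)) (ev n u) (ev n w).
Proof.
move=> h; rewrite ev_cat ev_pscale ropp rmul rinv // !ev_coef scaleNr.
by [].
Qed.

Lemma eliminate_correct m st : [/\ forall g, solvable p (L (elimE st m).1) (U_of (elimE st m).2) g <->
    solvable p (L st.1) (U_of st.2) g,
  zero_at (mon n m) (elimE st m) &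
  forall k, zero_at k st -> zero_at k (elimE st m)].
Proof.
case: st => ws us; rewrite /eliminate /=.
case P : (pivots _ _ _ _ _ us) => [|u piv] /=.
  have u0 u : u \in U_of us -> u@_(mon n m) = 0.
    move: P; rewrite /pivots; elim: us => //= v us IH; case: ifP => //.
    by rewrite req ev_coef rzero inE => /negbFE/eqP v0 /IH h /predU1P[->|/h].
  have [ind [iW oW Wio nd]] := kernelP m ws.
  split=> [g||k [/= wk uk]].
  - exact: (@kernel_solvable K p _ (L ws) (U_of us) (L ind) _ (mcoeff (mon n m)) g p_gt0 char_add u0 oW Wio nd).
  - by split=> //= gw /oW[].
  by split=> //= gw /oW[h _]; apply: (pspan_zero (phi := mcoeff k)) h.
have [uU nz] : ev n u \in U_of us /\ (ev n u)@_(mon n m) != 0.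
  move: P; rewrite /pivots; elim: us => //= v us IH; case: ifP.
    by rewrite req ev_coef rzero => h [<- _]; rewrite inE eqxx.
  by move=> _ /IH[h1 h2]; rewrite inE h1 orbT.
have nz' : rep (coef fadd fzero n u m) != 0 by rewrite ev_coef.
set r := red _ _ _ _ _ n m u.
have LE : L [seq (gw.1, r gw.2) | gw <- ws] =
    [seq (gw.1, reduce (mcoeff (mon n m)) (ev n u) gw.2) | gw <- L ws].
  by rewrite -!map_comp; apply: eq_map => gw; rewrite /= /evp /= ev_red.
have UE : U_of [seq r w | w <- us] = [seq reduce (mcoeff (mon n m)) (ev n u) w | w <- U_of us].
  by rewrite -!map_comp; apply: eq_map => w; rewrite /= ev_red.
split=> [g||k [/= wk uk]]; rewrite ?/zero_at /= LE UE.
- exact: gauss_solvable.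
- by split=> [gw|w] /mapP[x _ ->]; exact: (reduce_pivot (phi := mcoeff (mon n m))).
split=> [gw|w] /mapP[x xin ->]; apply: (reduce_zero _ (psi := mcoeff k)) => //=.
- exact: wk.
- exact: uk.
- exact: uk.
exact: uk.
Qed.

(** Later eliminations do not bring back a monomial that has been eliminated. *)
Lemma foldl_eliminate_correct ms st (st' := foldl elimE st ms) :
  [/\ forall g, solvable p (L st'.1) (U_of st'.2) g <-> solvable p (L st.1) (U_of st.2) g,
     forall m, m \in ms -> zero_at (mon n m) st' & forall k, zero_at k st -> zero_at k st'].
Proof.
rewrite /st'; elim: ms st {st'} => [|m ms IH] st //=.
have [s1 z1 k1] := eliminate_correct m st; have [s2 z2 k2] := IH (elimE st m).
split=> [g|m'|k /k1/k2 //]; first by rewrite s2.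
by rewrite inE => /predU1P[->|/z2 //]; apply: k2.
Qed.

Lemma ev_coef0 (qs : seq tpoly) k : k \notin [seq mon n t.2 | t <- flatten qs] ->
  forall u, u \in U_of qs -> u@_k = 0.
Proof.
elim: qs => //= q qs IH; rewrite map_cat mem_cat negb_or => /andP[kq /IH h] u.
rewrite inE => /predU1P[->|/h //]; elim: q kq => [|t q IHq]; first by rewrite ev_nil mcoeff0.
rewrite /= inE negb_or /ev big_cons mcoeffD mcoeffZ mcoeffX eq_sym => /andP[/negbTE-> /IHq].
by rewrite -/(ev n q) => ->; rewrite mulr0 addr0.
Qed.

Lemma zero_at_support st k : k \notin [seq mon n m | m <- support st] -> zero_at k st.
Proof.
rewrite /support -map_comp map_cat mem_cat negb_or => /andP[/ev_coef0 h1 /ev_coef0 h2].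
have e : [seq x.2 | x <- L st.1] = U_of [seq gw.2 | gw <- st.1] by rewrite -!map_comp.
by split=> // gw gwL; apply: h1; rewrite -e; exact: map_f.
Qed.

(** When all second components vanish, every combination is a solution. *)
Lemma solvable_zero (W : seq ({mpoly K[n]} * {mpoly K[n]})) U g :
  (forall gw, gw \in W -> gw.2 = 0) -> (forall u, u \in U -> u = 0) ->
  solvable p W U g <-> uspan [seq gw.1 | gw <- W] g.
Proof.
move=> W0 U0; split=> [[w gw _]|].
  elim: gw => [|a x y z xW _ IH]; first exact: span0.
  by apply: spanD => //; exact: map_f.
elim=> [|a u v /mapP[x xW ->] _ [w vw w0]]; first by exists 0; [exact: pspan0 | exact: span0].
exists (a ^+ p *: x.2 + w); first exact: pspanD.
by rewrite W0 // scaler0 add0r.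
Qed.

Definition ppairs (F : seq {mpoly K[n]}) := [seq (f, f ^+ p) | f <- F].

(** Additivity of Frobenius: a combination of the pairs [(f, f^p)] is again of
    this form. *)
Lemma pspan_ppairs F g w : pspanE (ppairs F) g w <-> uspan F g /\ w = g ^+ p.
Proof.
have D := exprD_char p_pr (mpoly_char char_p n).
split=> [|[Fg ->]].
  elim=> [|a x y z /mapP[f fF ->] _ [Fy ->]].
    by split; [exact: span0 | rewrite (expr0_char _ p_pr)].
  by split; [exact: spanD | rewrite D exprZn].
elim: Fg => [|a u v uF _ IH]; first by rewrite (expr0_char _ p_pr); exact: pspan0.
by rewrite D exprZn; apply: (pspanD a (gw := (u, u ^+ p))) => //; exact: (map_f (fun f => (f, f ^+ p))).
Qed.

Lemma box_mem B m : all (fun k => k <= B)%N m -> m \in box (size m) B.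
Proof.
elim: m => [|k m IH] //= /andP[kB /IH mB].
change (k :: m \in flatten [seq [seq i :: l | l <- box (size m) B] | i <- iota 0 B.+1]).
apply/flatten_mapP; exists k; first by rewrite mem_iota /= add0n ltnS.
exact: map_f.
Qed.

Lemma mon_box B (k : 'X_{1..n}) : (mdeg k <= B)%N -> exists2 m, m \in box n B & mon n m = k.
Proof.
move=> kB; exists (k : seq nat); last by apply/mnmP=> i; rewrite mnmE -mnm_nth.
have := @box_mem B k; rewrite size_tuple; apply; apply/allP=> x /tnthP[i ->].
by apply: leq_trans kB; rewrite mdegE (bigD1 i) //= -[tnth _ i]/(k i) leq_addr.
Qed.

Notation multiplesE := (multiples fmul fone n).

Lemma ev_multiples B gs : U_of (multiplesE B gs) =
  flatten [seq [seq 'X_[mon n m] * g | m <- box n B] | g <- U_of gs].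
Proof.
rewrite /multiples map_flatten -!map_comp; congr flatten; apply: eq_map => g /=.
rewrite -map_comp; apply: eq_map => m.
rewrite -[LHS]/(ev n (pmul fmul n [:: (fone, m)] g)).
by rewrite ev_pmul {1}/ev big_seq1 /= rone scale1r.
Qed.

Lemma uspan_multiples B gs g : ideal_le B (U_of gs) g -> uspan (U_of (multiplesE B gs)) g.
Proof.
case=> c cB ->; apply: span_sum => i _; rewrite [c i]mpolyE mulr_suml big_seq.
apply: span_sum => k /(deg_le_supp (cB i)) kB; rewrite -scalerAl; apply: span_scale.
apply: span_mem; have [m mB <-] := mon_box kB; rewrite ev_multiples.
apply/flatten_mapP; exists (U_of gs)`_i; first exact: mem_nth.
exact: (map_f (fun m => 'X_[mon n m] * (U_of gs)`_i)).
Qed.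

Lemma uspan_in_ideal U (gs : seq {mpoly K[n]}) g :
  (forall u, u \in U -> in_ideal gs u) -> uspan U g -> in_ideal gs g.
Proof.
move=> Ugs; elim=> [|a u v /Ugs/in_idealP ugs _ /in_idealP vgs]; apply/in_idealP; first exact: span0.
by apply: span_add => //; rewrite -mul_mpolyC; apply: (@span_scale _ {mpoly K[n]}^o).
Qed.

Lemma multiples_in_ideal B gs u : u \in U_of (multiplesE B gs) -> in_ideal (U_of gs) u.
Proof.
rewrite ev_multiples => /flatten_mapP[g gG /mapP[m _ ->]]; apply/in_idealP.
by apply: (@span_scale _ {mpoly K[n]}^o); exact: span_mem.
Qed.

Notation fkernelE := (frobenius_kernel p fadd fmul fopp finv feq dep fzero fone find n).

(** All monomials have been eliminated at the end: those of the support in the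
    loop, and the others from the outset. *)
Lemma frobenius_kernel_span B G J g : uspan (U_of (fkernelE B G J)) g <->
  uspan (U_of (multiplesE B G)) g /\ uspan (U_of (multiplesE B J)) (g ^+ p).
Proof.
rewrite /frobenius_kernel; set st := start _ _ _ _ _ _ _; set st' := foldl _ _ _.
have [sol zm zk] : [/\ forall g, solvable p (L st'.1) (U_of st'.2) g <-> solvable p (L st.1) (U_of st.2) g,
     forall m, m \in support st -> zero_at (mon n m) st' & forall k, zero_at k st -> zero_at k st'].
  exact: foldl_eliminate_correct.
have z k : zero_at k st'.
  have [/mapP[m mS ->]|/zero_at_support/zk //] := boolP (k \in [seq mon n m | m <- support st]).
  exact: zm.
have -> : U_of [seq gw.1 | gw <- st'.1] = [seq gw.1 | gw <- L st'.1] by rewrite -!map_comp.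
have -> : uspan [seq gw.1 | gw <- L st'.1] g <-> solvable p (L st'.1) (U_of st'.2) g.
  apply: iff_sym; apply: solvable_zero => x xin; apply/mpolyP=> k; rewrite mcoeff0.
    exact: (z k).1.
  exact: (z k).2.
rewrite sol /st /=.
have -> : L [seq (f, ppow fmul fone n f p) | f <- multiplesE B G] = ppairs (U_of (multiplesE B G)).
  by rewrite /ppairs -!map_comp; apply: eq_map => f; rewrite /= /evp /= ev_ppow.
split=> [[w /pspan_ppairs[Gg ->] //]|[Gg Jg]].
by exists (g ^+ p) => //; apply/pspan_ppairs.
Qed.

Lemma deg_le_degree gs f : f \in U_of gs -> deg_le (degree gs) f.
Proof.
have ms t : (mdeg (mon n t) <= sumn t)%N.
  rewrite mdegE; under eq_bigr do rewrite mnmE.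
  elim: n t => [|k IH] t; first by rewrite big_ord0.
  rewrite big_ord_recl /=; case: t => [|a t] /=; first by rewrite big1 // => i _; rewrite nth_nil.
  by rewrite leq_add2l; exact: IH.
elim: gs => //= q gs IH; rewrite /degree /= map_cat sumn_cat -/(degree gs).
rewrite inE => /predU1P[->|/IH fd]; last by apply: deg_leW fd; exact: leq_addl.
apply: (@deg_leW _ _ (sumn [seq sumn t.2 | t <- q])); first exact: leq_addr.
elim: q => [|t q IHq]; first by rewrite ev_nil; exact: deg_le0.
rewrite /ev big_cons -/(ev n q) /=; apply: deg_leD; last by apply: deg_leW IHq; exact: leq_addl.
by apply/deg_leZ/deg_le_mnm; apply: leq_trans (ms _) (leq_addr _ _).
Qed.

Lemma over_coefs gs f : f \in U_of gs ->
  forall m, pfield char_p [seq rep t.1 | t <- flatten gs] f@_m.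
Proof.
pose cs := [seq rep t.1 | t <- flatten gs]; rewrite -/cs; have SF := pfield_subfield char_p cs.
have: {subset [seq rep t.1 | t <- flatten gs] <= cs} by [].
clearbody cs; elim: gs => //= q gs IH; rewrite map_cat => sub.
rewrite inE => /predU1P[->|/IH]; last by apply=> x xg; apply: sub; rewrite mem_cat xg orbT.
have {}sub : {subset [seq rep t.1 | t <- q] <= cs} by move=> x xq; apply: sub; rewrite mem_cat xq.
move=> m; elim: q sub => [|t q IHq] sub; first by rewrite ev_nil mcoeff0; exact: (sf0 SF).
rewrite /ev big_cons -/(ev n q) mcoeffD mcoeffZ mcoeffX; apply: (sfD SF).
  apply: (sfM SF); first by apply: pfield_mem; apply: sub; rewrite inE eqxx.
  by case: eqP => _; [exact: (sf1 SF) | exact: (sf0 SF)].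
by apply: IHq => x xq; apply: sub; rewrite inE xq orbT.
Qed.

(** By [bounded_generation] the solutions with bounded multipliers, which
    [frobenius_kernel] spans over [K], generate the ideal of all solutions. *)
Theorem frobenius_kernel_ideal G J g :
  in_ideal (U_of (fkernelE (root_bound p n (degree (G ++ J)) (size (flatten J))) G J)) g <->
  in_ideal (U_of G) g /\ in_ideal (U_of J) (g ^+ p).
Proof.
set B := root_bound _ _ _ _; have D := exprD_char p_pr (mpoly_char char_p n).
split=> [/in_idealP|[gG gJ]].
  suff kP u : u \in U_of (fkernelE B G J) -> in_ideal (U_of G) u /\ in_ideal (U_of J) (u ^+ p).
    elim=> [|a u v /kP[/in_idealP uG /in_idealP uJ] _ [/in_idealP vG /in_idealP vJ]].
      by rewrite (expr0_char _ p_pr); split; apply/in_idealP; exact: span0.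
    split; apply/in_idealP; rewrite ?D; apply: span_add => //.
      exact: (@span_scale _ {mpoly K[n]}^o).
    by rewrite -[a *: u]/(a * u) exprMn; exact: (@span_scale _ {mpoly K[n]}^o).
  move=> uk; have /frobenius_kernel_span[uG uJ] : uspan (U_of (fkernelE B G J)) u by exact: span_mem.
  by split; [apply: uspan_in_ideal uG | apply: uspan_in_ideal uJ] => x; exact: multiples_in_ideal.
pose cs := [seq rep t.1 | t <- flatten J].
have Gd f : f \in U_of G -> deg_le (degree (G ++ J)) f.
  by move=> fG; apply: deg_le_degree; rewrite map_cat mem_cat fG.
have Jd f : f \in U_of J -> deg_le (degree (G ++ J)) f.
  by move=> fJ; apply: deg_le_degree; rewrite map_cat mem_cat fJ orbT.
have := bounded_generation Gd Jd (@over_coefs J) gG gJ.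
have -> : root_bound p n (degree (G ++ J)) (size [seq rep t.1 | t <- flatten J]) = B.
  by rewrite size_map.
move=> h; apply/in_idealP; apply: span_trans h => u [/uspan_multiples uG /uspan_multiples uJ].
have /in_idealP : in_ideal (U_of (fkernelE B G J)) u; last by [].
apply: (@uspan_in_ideal (U_of (fkernelE B G J))); last exact/frobenius_kernel_span.
by move=> x xk; apply/in_idealP; exact: span_mem.
Qed.

End Elimination.

Lemma ev_parse n d : ev n (parse d) = poly_of_data rep n d.
Proof.
rewrite /ev big_map; apply: eq_bigr => t _ /=; congr (_ *: 'X_[_]).
apply/mnmP=> i; rewrite !mnmE; have [it|ti] := ltnP i (size (items (tl t))).
  by rewrite (nth_map DNil).
by rewrite !nth_default ?size_map.
Qed.

Lemma items_enc {T} `{Code T} (l : seq T) : items (enc l) = [seq enc x | x <- l].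
Proof. by elim: l => //= x l IH; congr cons; exact: IH. Qed.

Lemma nat_of_data_of_nat k : nat_of_data (data_of_nat k) = k.
Proof. by rewrite /nat_of_data; elim: k => //= k ->. Qed.

Lemma polys_of_enc n (gs : seq tpoly) : polys_of_data rep n (enc gs) = [seq ev n g | g <- gs].
Proof.
rewrite /polys_of_data items_enc -map_comp; apply: eq_map => g /=.
rewrite /poly_of_data items_enc big_map; apply: eq_bigr => t _.
congr (_ *: 'X_[_]); apply/mnmP=> i; rewrite !mnmE.
rewrite -[tl (enc t)]/(enc t.2) items_enc; have [it|ti] := ltnP i (size t.2).
  by rewrite (nth_map 0%N) // nat_of_data_of_nat.
by rewrite !nth_default ?size_map.
Qed.

Section Chain.
Variables (n : nat) (fs d : data) (R Q : comPzRingType) (pi : {rmorphism {mpoly K[n]} -> R})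
  (iota : {rmorphism R -> Q}).
Let D := pi (poly_of_data rep n d).
Hypotheses (pi_pres : presents (polys_of_data rep n fs) pi) (Q_tot : total_ring_of_fractions iota)
  (D_reg : nonzerodivisor D).

Notation algorithmE := (algorithm p fadd fmul fopp finv feq dep fzero fone find).

Lemma V_frac e f : V iota p D e f -> exists r, is_frac iota D r f.
Proof. by elim: e => //= e IH [/IH]. Qed.

(** By induction on [e]. For [f = r/D], the condition that [f^p] is in [V_e]
    means that [r^p / D^(p-1)] is in [D V_e], that is, [r^p] is in [D^(p-1)
    I_e]; lifted to polynomials, [g^p] is in the ideal generated by [twist]. *)
Lemma algorithm_V e g f : is_frac iota D (pi g) f ->
  V iota p D e f <-> in_ideal [seq ev n h | h <- algorithmE n fs d e] g.
Proof.
have [surj ker] := pi_pres; have [inj units _] := Q_tot.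
have [u uD] := units _ D_reg.
elim: e g f => [|e IH] g f gf.
  split=> [_|]; last by exists (pi g).
  by exists (fun=> g); rewrite big_ord1 /= ev_pone mulr1.
set G := algorithmE n fs d e in IH *.
have -> : algorithmE n fs d e.+1 =
    next p fadd fmul fopp finv feq dep fzero fone find n [seq parse f | f <- items fs] (parse d) G by [].
rewrite /next frobenius_kernel_ideal.
set J := twist _ _ _ _ _ _ _.
have JE : [seq ev n h | h <- J] = polys_of_data rep n fs ++
    [seq poly_of_data rep n d ^+ p.-1 * u | u <- [seq ev n h | h <- G]].
  rewrite /J /twist map_cat -!map_comp; congr (_ ++ _).
    by apply: eq_map => h /=; rewrite ev_parse.
  by apply: eq_map => h /=; rewrite ev_pmul ev_ppow ev_parse.
have J_split : in_ideal [seq ev n h | h <- J] (g ^+ p) <->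
    exists2 h, in_ideal [seq ev n h | h <- G] h & pi (g ^+ p) = D ^+ p.-1 * pi h.
  rewrite JE; split=> [/in_idealP|[h /in_idealP hG gh]].
    suff: forall x, span (fun u : {mpoly K[n]}^o => u \in polys_of_data rep n fs ++
        [seq poly_of_data rep n d ^+ p.-1 * u | u <- [seq ev n h | h <- G]]) x ->
      exists2 h, in_ideal [seq ev n h | h <- G] h & pi x = D ^+ p.-1 * pi h by apply.
    move=> x; elim=> [|a v w vJ _ [h /in_idealP hG wh]].
      by exists 0; [apply/in_idealP; exact: span0 | rewrite !rmorph0 mulr0].
    move: vJ; rewrite mem_cat => /orP[vf|/mapP[h' h'G ->]].
      exists h; first exact/in_idealP.
      rewrite rmorphD /= -wh -[RHS]add0r; congr (_ + _).
      rewrite -[a *: v]/(a * v) rmorphM /= (_ : pi v = 0) ?mulr0 //.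
      by apply/ker/in_idealP; exact: span_mem.
    exists (a * h' + h).
      by apply/in_idealP; apply: (@spanD _ {mpoly K[n]}^o).
    rewrite rmorphD /= wh -[a *: _]/(a * _) !rmorphM /= rmorphD rmorphM mulrDr; congr (_ + _).
    by rewrite rmorphXn mulrCA.
  have /ker/in_idealP kf : pi (g ^+ p - poly_of_data rep n d ^+ p.-1 * h) = 0.
    by rewrite rmorphB gh rmorphM rmorphXn subrr.
  apply/in_idealP; rewrite -[g ^+ p](subrK (poly_of_data rep n d ^+ p.-1 * h)).
  apply: span_add; first by apply: span_sub kf => x xf; rewrite mem_cat xf.
  apply: (@span_map _ _ _ {mpoly K[n]}^o id (fun x : {mpoly K[n]}^o => poly_of_data rep n d ^+ p.-1 * x) _ _ h _ _ _ hG).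
  - by rewrite mulr0.
  - by move=> a x y; rewrite mulrDr -[a *: x]/(a * x) mulrCA.
  by move=> x h'G; apply: span_mem; rewrite mem_cat; apply/orP; right; exact: map_f.
rewrite J_split /=.
(* As [D] is regular, its image is invertible with inverse [u]. *)
have cancelD x y : x * iota D ^+ p.-1 = y * iota D ^+ p.-1 -> x = y.
  move=> e'; rewrite -[x]mulr1 -[y]mulr1 -(expr1n _ p.-1) -uD exprMn.
  by rewrite [u ^+ _ * _]mulrC !mulrA e'.
have fracp h : is_frac iota D (pi h) (f ^+ p) <-> pi (g ^+ p) = D ^+ p.-1 * pi h.
  rewrite /is_frac; split=> [fh|gh].
    apply: inj; rewrite rmorphXn rmorphXn /= -gf rmorphM rmorphXn -fh.
    have -> : (f * iota D) ^+ p = f ^+ p * (iota D * iota D ^+ p.-1).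
      by rewrite exprMn -exprS prednK.
    by rewrite [RHS]mulrC mulrA.
  apply: cancelD; rewrite -mulrA -exprS (prednK p_gt0) -exprMn gf.
  have -> : iota (pi g) ^+ p = iota (pi (g ^+ p)) by rewrite !rmorphXn.
  by rewrite gh rmorphM rmorphXn mulrC.
split=> [[Vf Vfp]|[gG [h hG gh]]].
  split; first exact/(IH g f gf).
  have [r fr] := V_frac Vfp; have [h hr] := surj r; rewrite -hr in fr.
  by exists h; [exact/(IH h _ fr) | exact/fracp].
split; first exact/(IH g f gf).
by apply/(IH h); first exact/fracp.
Qed.

Lemma algorithm_generates e :
  generated_by_fracs iota D [seq pi g | g <- polys_of_data rep n (enc (algorithmE n fs d e))] (V iota p D e).
Proof.
have [surj _] := pi_pres; rewrite polys_of_enc => f; split=> [Vf|[r [fr]]].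
  have [r fr] := V_frac Vf; have [g gr] := surj r; rewrite -gr in fr *.
  exists (pi g); split=> //; move/(algorithm_V _ fr)/in_idealP: Vf => Sg; apply/in_idealP.
  apply: (@span_map _ _ {mpoly K[n]}^o R^o pi pi _ _ g _ _ _ Sg); first exact: rmorph0.
    by move=> a x y; rewrite rmorphD -[a *: x]/(a * x) rmorphM.
  by move=> x xin; apply: span_mem; exact: map_f.
move=> /in_idealP rG.
suff [g gr gG] : exists2 g, pi g = r & in_ideal [seq ev n h | h <- algorithmE n fs d e] g.
  by rewrite -gr in fr; apply/(algorithm_V _ fr).
elim: rG => [|a u v /mapP[h hG ->] _ [g <- /in_idealP gG]].
  by exists 0; [exact: rmorph0 | apply/in_idealP; exact: span0].
have [b <-] := surj a; exists (b * h + g).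
  by rewrite rmorphD rmorphM.
by apply/in_idealP; apply: (@spanD _ {mpoly K[n]}^o).
Qed.

End Chain.

End Correct.

(** * Programs for the field operations *)

Record field_operations (K : fieldType) (rep : data -> K) (fadd fmul : data -> data -> data)
    (fopp finv : data -> data) (feq : data -> data -> bool) : Prop := FieldOperations {
  add_comp : computable (fun z : data * data => fadd z.1 z.2);
  add_rep : forall a b, rep (fadd a b) = rep a + rep b;
  mul_comp : computable (fun z : data * data => fmul z.1 z.2);
  mul_rep : forall a b, rep (fmul a b) = rep a * rep b;
  opp_comp : computable fopp;
  opp_rep : forall a, rep (fopp a) = - rep a;
  inv_comp : computable finv;
  inv_rep : forall a, rep a != 0 -> rep (finv a) = (rep a)^-1;
  eq_comp : computable (fun z : data * data => feq z.1 z.2);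
  eq_rep : forall a b, feq a b = (rep a == rep b) }.

(** The program for the inverse is specified on nonzero elements only; a test
    makes it total. *)
Lemma field_operations_exist (K : fieldType) (rep : data -> K) : computable_field rep ->
  exists fadd fmul fopp finv feq, field_operations rep fadd fmul fopp finv feq.
Proof.
case=> surj [Pa addP] [Po oppP] [Pm mulP] [Pi invP] [Pe eqP'].
have /functional_choice[fadd fa] : forall z : data * data, exists c,
    eval Pa (enc z) c /\ rep c = rep z.1 + rep z.2.
  by move=> z; have [c] := addP z.1 z.2; exists c.
have /functional_choice[fmul fm] : forall z : data * data, exists c,
    eval Pm (enc z) c /\ rep c = rep z.1 * rep z.2.
  by move=> z; have [c] := mulP z.1 z.2; exists c.
have /functional_choice[fopp fo] : forall a, exists c, eval Po a c /\ rep c = - rep a.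
  by move=> a; have [c] := oppP a; exists c.
have /functional_choice[finv fi] : forall a, exists c, rep a != 0 ->
    eval Pi a c /\ rep c = (rep a)^-1.
  move=> a; have [a0|a0] := boolP (rep a == 0); first by exists a.
  by have [c] := invP a a0; exists c.
have [z0 z0E] := surj 0; pose feq a b := rep a == rep b.
have ceq : computable (fun z : data * data => feq z.1 z.2) by exists Pe => -[a b]; exact: eqP'.
exists (fun a b => fadd (a, b)), (fun a b => fmul (a, b)), fopp,
  (fun a => if feq a z0 then DNil else finv a), feq.
split=> //.
- by exists Pa => -[a b]; exact: (fa (a, b)).1.
- by move=> a b; exact: (fa (a, b)).2.
- by exists Pm => -[a b]; exact: (fm (a, b)).1.
- by move=> a b; exact: (fm (a, b)).2.
- by exists Po => a; exact: (fo a).1.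
- by move=> a; exact: (fo a).2.
- have [C HC] : computable (fun a : data => feq a z0).
    exact: (comp_comp (f := fun a => (a, z0)) ceq (comp_pair comp_id (comp_const z0))).
  exists (PIf C PNil Pi) => a; have := HC a; rewrite /feq z0E.
  case: eqP => [_ h|/eqP a0 h]; first by apply: EvIfT h (EvNil _).
  by apply: EvIfF h (fi a a0).1.
by move=> a a0; rewrite /feq z0E (negbTE a0); exact: (fi a a0).2.
Qed.

Lemma computable_V (p : nat) (K : fieldType) (rep : data -> K) :
  p \in [pchar K] -> computable_field rep -> condition_P rep p ->
   exists P : prog,
   forall (n : nat) (fs d : data) (e : nat)
     (R : comPzRingType) (pi : {rmorphism {mpoly K[n]} -> R})
     (Q : comPzRingType) (iota : {rmorphism R -> Q}),
   let D := pi (poly_of_data rep n d) in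
   presents (polys_of_data rep n fs) pi ->
   total_ring_of_fractions iota ->
   nonzerodivisor D ->
   exists2 gs : data,
     eval P (DCons (data_of_nat n) (DCons fs (DCons d (data_of_nat e)))) gs &
     generated_by_fracs iota D
       [seq pi g | g <- polys_of_data rep n gs] (V iota p D e).
Proof.
move=> char_p computable_K [Pd depP]; have surj := rep_surj computable_K.
have [fadd [fmul [fopp [finv [feq [ca ra cm rm co ro ci ri ce re]]]]]] :=
  field_operations_exist computable_K.
have [z0 z0E] := surj 0; have [z1 z1E] := surj 1.
have /functional_choice[dep dP] : forall l : seq data, exists b : bool,
    eval Pd (enc l) (enc b) /\ (b <-> pth_power_dependent p [seq rep c | c <- l]).
  by move=> l; have [b bd bP] := depP (enc l); exists b; rewrite bP items_enc map_id.
have cd : computable dep by exists Pd => l; exact: (dP l).1.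
have rd l := (dP l).2.
have crel := comp_relation p z0 z1 ca cm ce cd.
have [find [cf fP]] := comp_search crel
  (relation_exists char_p surj ra rm re rd z0E z1E).
have [P HP] := comp_algorithm p z0 z1 ca cm co ci ce cd cf.
exists P => n fs d e R pi Q iota D pres tot reg.
exists (enc (algorithm p fadd fmul fopp finv feq dep z0 z1 find n fs d e)).
  exact: (HP (n, (fs, (d, e)))).
exact: (algorithm_generates char_p ra rm ro ri re rd z0E z1E fP).
Qed.

Theorem theorem1p1 (p : nat) (K : fieldType) (rep : data -> K)
    (char_p : p \in [pchar K]) (computable_K : computable_field rep) :
  (condition_P rep p ->
   exists P : prog,
   forall (n : nat) (fs d : data) (e : nat)
     (R : comPzRingType) (pi : {rmorphism {mpoly K[n]} -> R})
     (Q : comPzRingType) (iota : {rmorphism R -> Q}),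
   let D := pi (poly_of_data rep n d) in
   presents (polys_of_data rep n fs) pi ->
   reduced R ->
   total_ring_of_fractions iota ->
   nonzerodivisor D ->
   in_conductor iota D ->
   exists2 gs : data,
     eval P (DCons (data_of_nat n) (DCons fs (DCons d (data_of_nat e)))) gs &
     generated_by_fracs iota D
       [seq pi g | g <- polys_of_data rep n gs] (V iota p D e))
  /\
  (forall (R Q : comPzRingType) (iota : {rmorphism R -> Q}) (D : R),
   finitely_generated_algebra K R ->
   reduced R ->
   total_ring_of_fractions iota ->
   nonzerodivisor D ->
   in_conductor iota D ->
   [/\ forall e f, V iota p D e.+1 f -> V iota p D e f,
       exists e0, forall e, (e0 <= e)%N ->
         forall f, V iota p D e f <-> V iota p D e0 f
     & forall e, (forall f, V iota p D e f <-> V iota p D e.+1 f) ->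
         forall f, V iota p D e f <-> integral iota f]).
Proof.
split=> [cP|R Q iota D [n [pi surj]] _ tot reg cond].
  have [P HP] := computable_V char_p computable_K cP.
  by exists P => n fs d e R pi Q iota D pres _ tot reg _; exact: HP.
have p_pr := pcharf_prime char_p.
have R_char : p%:R = 0 :> R by rewrite -(rmorph_nat pi) (mpoly_char char_p) rmorph0.
have RN := noetherian_image surj (@noetherian_mpoly K n).
split=> [e f []//||].
  exact: (V_stabilizes p_pr R_char RN tot reg cond).
exact: (V_stationary p_pr R_char RN tot reg cond).
Qed.
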